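(* Let $I$ be a proper nonzero monomial ideal of $S=\mathbb{K}[x_1,\ldots,x_n]$ with analytic spread $\ell=\ell(I)$. Set $s=\mu(\overline{I^{\ell-1}})!$ (the factorial of $\mu(\overline{I^{\ell-1}})$). Then for every integer $m\geq 1$, we have $$\operatorname{reg}(\overline{I})\leq \operatorname{reg}(I^{sm})-\gamma(I)(sm-1).$$
   Context: $\mathbb{K}$ is a field and $S=\mathbb{K}[x_1,\ldots,x_n]$ is the (standard graded) polynomial ring in $n$ variables, with $\mathfrak{m}=(x_1,\ldots,x_n)$. For a graded $S$-module $M$ with graded Betti numbers $\beta_{i,j}(M)$ (so the minimal graded free resolution of $M$ has $i$-th term $\bigoplus_j S(-j)^{\beta_{i,j}(M)}$), the Castelnuovo--Mumford regularity is $\operatorname{reg}(M)=\max\{j-i : \beta_{i,j}(M)\neq 0\}$; ideals are regarded as graded $S$-modules. For a monomial ideal $I$, $G(I)$ is its unique set of minimal monomial generators and $\mu(I)=|G(I)|$. For a monomial $u$, $\deg_{x_j}(u)$ is the exponent of $x_j$ in $u$, and $$\gamma(I):=\min\{\deg_{x_j}(u) : 1\leq j\leq n,\ u\in G(I),\ x_j \text{ divides } u\}.$$ $\overline{I}$ denotes the integral closure of $I$ in $S$, i.e. the set of $f\in S$ satisfying an equation $f^k+c_1f^{k-1}+\cdots+c_{k-1}f+c_k=0$ with $c_i\in I^i$; for a monomial ideal it is again a monomial ideal. The Rees algebra is $\mathcal{R}(I)=S[It]=\bigoplus_{k\ge 0}I^kt^k$, and the analytic spread $\ell(I)$ is the Krull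 dimension of $\mathcal{R}(I)/\mathfrak{m}\mathcal{R}(I)$. By convention $I^0=S$. *)

(* Defs.v *)
From HB Require Import structures.
From mathcomp Require Import all_boot all_order all_algebra.
From mathcomp Require Import finmap.
From mathcomp Require Import boolp classical_sets cardinality.
From mathcomp Require Import mpoly.

Set Implicit Arguments.
Unset Strict Implicit.
Unset Printing Implicit Defensive.

Import Order.TTheory GRing.Theory Num.Theory.
Local Open Scope classical_set_scope.
Local Open Scope ring_scope.

(* The value is [x0] when [A] has no greatest (resp. least) element. *)
Definition set_max d (T : porderType d) (x0 : T) (A : set T) : T :=
  xget x0 (A `&` ubound A).

Definition set_min d (T : porderType d) (x0 : T) (A : set T) : T :=
  xget x0 (A `&` lbound A).

Section Ideals.
Variable R : comNzRingType.
Implicit Types (I J A : set R).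

Definition is_ideal I : Prop :=
  [/\ I 0, forall a b, I a -> I b -> I (a + b) & forall a b, I b -> I (a * b)].

Definition is_prime_ideal I : Prop :=
  [/\ is_ideal I, ~ I 1 & forall a b, I (a * b) -> I a \/ I b].

Definition ideal_gen A : set R := smallest is_ideal A.

Definition ideal_mul I J : set R :=
  ideal_gen [set x | exists a b, [/\ I a, J b & x = a * b]].

Fixpoint ideal_exp I (k : nat) : set R :=
  if k is k'.+1 then ideal_mul I (ideal_exp I k') else [set: R].

Definition integral_closure I : set R :=
  [set f | exists (k : nat) (c : nat -> R),
     [/\ (0 < k)%N,
         forall i, (1 <= i <= k)%N -> ideal_exp I i (c i) &
         f ^+ k + \sum_(1 <= i < k.+1) c i * f ^+ (k - i) = 0]].

Definition prime_chain (d : nat) (P : nat -> set R) : Prop :=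
  (forall i, (i <= d)%N -> is_prime_ideal (P i)) /\
  (forall i, (i < d)%N -> P i `<` P i.+1).

(* Only meaningful for rings of finite Krull dimension; 0 otherwise. *)
Definition krull_dim : nat :=
  set_max 0%N [set d | exists P, prime_chain d P].

Lemma ideal_gen_ideal A : is_ideal (ideal_gen A).
Proof.
split=> [J [[]] //|a b Ia Ib J JP|a b Ib J JP].
  by case: (JP) => -[_ JD _] _; apply: JD; [apply: Ia|apply: Ib].
by case: (JP) => -[_ _ JM] _; apply: JM; apply: Ib.
Qed.

Lemma ideal_gen_sub A J : is_ideal J -> A `<=` J -> ideal_gen A `<=` J.
Proof. by move=> JI AJ x; apply. Qed.

Lemma sub_ideal_gen A : A `<=` ideal_gen A.
Proof. by move=> x Ax J [_]; apply. Qed.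

Lemma ideal_exp_ideal I k : is_ideal (ideal_exp I k).
Proof. by case: k => [|k]; [split|apply: ideal_gen_ideal]. Qed.

Lemma ideal_expD I i j a b :
  ideal_exp I i a -> ideal_exp I j b -> ideal_exp I (i + j) (a * b).
Proof.
elim: i a => [|i IHi] a Ia Ib.
  by have [_ _ IM] := ideal_exp_ideal I j; apply: IM.
have [I0 ID IM] := ideal_exp_ideal I (i.+1 + j).
suff: ideal_exp I i.+1 `<=` [set x | ideal_exp I (i.+1 + j) (x * b)] by apply.
apply: ideal_gen_sub.
  split=> [|x y Ix Iy|x y Iy] /=; first by rewrite mul0r.
    by rewrite mulrDl; apply: ID.
  by rewrite -mulrA; apply: IM.
move=> x [u [v [Iu Iv ->]]] /=; rewrite -mulrA.
by apply: sub_ideal_gen; exists u, (v * b); split=> //; apply: IHi.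
Qed.

End Ideals.

(* The Rees algebra R[It], as a subring of R[t] = {poly R}. *)
Section Rees.
Variables (R : comNzRingType) (I : set R).

Definition rees_pred : {pred {poly R}} :=
  fun p => `[< forall k, ideal_exp I k p`_k >].

Lemma rees_subring_closed : subring_closed rees_pred.
Proof.
have IS k := ideal_exp_ideal I k.
split=> [|p q /asboolP Ip /asboolP Iq|p q /asboolP Ip /asboolP Iq];
  apply/asboolP => k; have [I0 ID IM] := IS k.
- by rewrite coef1; case: k I0 {ID IM} => [|k].
- rewrite coefB; apply: ID (Ip k) _; rewrite -mulN1r; exact: IM (Iq k).
- rewrite coefM; apply: (big_ind (ideal_exp I k)) => // i _.
  by rewrite -{1}(subnKC (ltn_ord i : i <= k)%N); apply: ideal_expD.
Qed.

HB.instance Definition _ :=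
  GRing.isSubringClosed.Build {poly R} rees_pred rees_subring_closed.

Record rees := Rees { rees_val :> {poly R}; _ : rees_val \in rees_pred }.

HB.instance Definition _ := [isSub for rees_val].
HB.instance Definition _ := [Choice of rees by <:].
HB.instance Definition _ := [SubChoice_isSubComNzRing of rees by <:].

End Rees.

Section PolynomialRing.
Variables (K : fieldType) (n : nat).
Local Notation S := {mpoly K[n]}.
Implicit Type I : set S.

Definition max_ideal : set S := ideal_gen (range (fun i : 'I_n => 'X_i)).

Section Fiber.
Variable I : set S.

(* The extension of the ideal (x_1, ..., x_n) to the Rees algebra. *)
Definition max_rees : set (rees I) :=
  ideal_gen [set x : rees I | exists2 c, max_ideal c & rees_val x = c%:P].

Definition max_rees_pred : {pred rees I} := fun x => `[< max_rees x >].

Lemma max_rees_idealr_closed : idealr_closed max_rees_pred.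
Proof.
have [m0 mD mM] := ideal_gen_ideal
  [set x : rees I | exists2 c, max_ideal c & rees_val x = c%:P].
split=> [||a u v /asboolP mu /asboolP mv].
- exact/asboolP.
- apply/negP => /asboolP.
  have mC : max_ideal `<=` [set f : S | f@_0%MM = 0].
    apply: ideal_gen_sub; first split=> [|f g /= f0 g0|f g /= g0].
    + exact: mcoeff0.
    + by rewrite mcoeffD f0 g0 addr0.
    + by rewrite rmorphM /= g0 mulr0.
    by move=> _ [i _ <-] /=; rewrite mcoeffX mnm1_eq0.
  suff sub : max_rees `<=` [set x : rees I | (x : {poly S})`_0@_0%MM = 0].
    by move/sub => /=; rewrite coef1 mcoeff1 eqxx => /eqP; rewrite oner_eq0.
  apply: ideal_gen_sub; first split=> [|f g /= f0 g0|f g /= g0].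
  + by rewrite /= coef0 mcoeff0.
  + by rewrite coefD mcoeffD f0 g0 addr0.
  + by rewrite coef0M rmorphM /= g0 mulr0.
  by move=> x [c mc xc] /=; rewrite xc coefC eqxx; apply: mC.
- by apply/asboolP; apply: mD mv; apply: mM.
Qed.

HB.instance Definition _ :=
  isIdealr.Build (rees I) max_rees_pred max_rees_idealr_closed.

Definition fiber_ring : comNzRingType := {ideal_quot max_rees_pred}.

Definition analytic_spread : nat := krull_dim fiber_ring.

End Fiber.

Definition is_monomial_ideal I : Prop :=
  exists A : set 'X_{1..n}, I = ideal_gen [set 'X_[a] | a in A].

(* G(I), each monomial being represented by its exponent vector. *)
Definition min_gens I : set 'X_{1..n} :=
  [set a | I 'X_[a] /\ forall b, I 'X_[b] -> (b <= a)%MM -> b = a].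

Definition mu I : nat := #|` fset_set (min_gens I)|.

Definition gamma I : nat :=
  set_min 0%N [set d | exists (a : 'X_{1..n}) (j : 'I_n),
                 [/\ min_gens I a, (0 < a j)%N & d = a j]].

(* A minimal graded free resolution
     ... -> F_2 -> F_1 -> F_0 -> I -> 0
   of a homogeneous ideal I, regarded as a graded S-module.  F_i is the module
   of row vectors 'rV[S]_(rk i), graded so that its r-th basis vector has degree
   deg i r, i.e. F_i is the direct sum of the S(- deg i r).  The map
   F_(i+1) -> F_i is v |-> v *m diff i, and F_0 -> I is v |-> v *m aug. *)
Record min_free_resolution I := MinFreeResolution {
  rk : nat -> nat;
  deg : forall i, 'I_(rk i) -> int;
  aug : 'cV[S]_(rk 0);
  diff : forall i, 'M[S]_(rk i.+1, rk i);
  aug_graded : forall r a, a \in msupp (aug r 0) -> (mdeg a)%:Z = deg r;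
  diff_graded : forall i r s a, a \in msupp (diff i r s) ->
    (mdeg a)%:Z + deg s = deg r;
  aug_image : forall f, I f <-> exists v : 'rV_(rk 0), f = (v *m aug) 0 0;
  aug_exact : forall v : 'rV_(rk 0),
    v *m aug = 0 <-> exists w, v = w *m diff 0;
  diff_exact : forall i (v : 'rV_(rk i.+1)),
    v *m diff i = 0 <-> exists w, v = w *m diff i.+1;
  diff_minimal : forall i r s, max_ideal (diff i r s)
}.

(* Minimal graded free resolutions are unique up to isomorphism, so the value
   does not depend on the resolution that is selected. *)
Definition betti I (i : nat) (j : int) : nat :=
  xget 0%N [set b | exists F : min_free_resolution I,
              b = #|[pred r : 'I_(rk F i) | deg r == j]|].

Definition reg I : int :=
  set_max 0 [set k | exists i j, betti I i j <> 0%N /\ k = j - i%:Z].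

End PolynomialRing.

(* Main.v *)
(* Write L for the closure of I, l for its analytic spread, J = I^k with k = s m.

   A monomial x^u lies in L iff x^(k u) lies in J. For the nontrivial direction let
   v_1, ..., v_r be the minimal generators of the closure of I^(l-1). The closure of I^l
   is I times the closure of I^(l-1), so x^u v_i is a multiple of some g v_f(i) with g
   in I; a cycle of f of length p <= r gives x^(p u) in I^p, and p divides s. The product
   formula for closures is a descent in the cone of exponents of the Rees algebra:
   removing from an exponent as much as possible of one generator after another runs
   through a strictly decreasing chain of faces, hence through a strictly increasing
   chain of monomial primes above m R(I), so that at most l generators occur and one of
   them has coefficient at least 1.

   The regularity of a monomial ideal M is the maximum of |c| + p - n over the degrees c
   such that the Koszul complex of M in degree c is not exact at the faces of size p.
   Replacing the variables in the Koszul complex by powers does not change this maximum: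
   nonzero homology can be followed while a side is lengthened (box_stretch) or shortened
   (box_shrink) without |c| + p decreasing. Start from a class realising reg L and
   stretch all sides to infinity; let t be the total degree of the nonnegative part of the
   degree reached. If t >= gamma, multiply degrees by k: the same complex occurs for J in
   a degree larger by (k - 1) t, and shrinking gives a Betti number of J. If t < gamma,
   the complex only depends on the supports of the generators of I, so it occurs for J in
   every degree whose nonnegative part has total degree k gamma - 1. *)
Require Import Defs.
From HB Require Import structures.
From mathcomp Require Import all_boot all_order all_algebra.
From mathcomp Require Import boolp mpoly ring lra zify.

Set Implicit Arguments.
Unset Strict Implicit.
Unset Printing Implicit Defensive.

Import Order.TTheory GRing.Theory Num.Theory.
Local Open Scope ring_scope.

(** * Koszul-type complexes of boxes *)

(** [betti] and [reg] select their values by [xget]. Hence a minimal resolution must be constructed,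
    its degrees compared with those of an arbitrary one, and the set that defines [reg] bounded.
    Only the nonvanishing of Betti numbers matters, so homology groups are never formed: vanishing
    means that cycles have primitives, and a quotient P'/P is replaced by the mapping cone of the
    inclusion of P in P', which is again a cube. Sides are stretched to infinity for the following
    reason. Multiplication by k moves a degree by k - 1 times its nonnegative part, since a
    coordinate -1 must stay -1. If that part is below gamma, the gain is too small, and the degree
    has to be moved by other means; this is possible only when all upper ends are so large that
    exponents no longer matter. The number k gamma - 1 is the largest total degree, off a set F of
    variables, that still forces one of k factors to be supported in F. The spread l enters through
    a balance: the coefficients of the generators of I in an exponent of t-degree l add up to l, and
    at most l generators share this sum. *)

Section Cube.
Variables (K : fieldType) (n : nat) (V : lmodType K).
Local Notation chain := {ffun {set 'I_n} -> V}.
Local Notation family := ({set 'I_n} -> V -> Prop).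
Implicit Types (s t : chain) (F : {set 'I_n}) (P : family) (j : 'I_n).

Definition cube_sign j F : K := (-1) ^+ #|[set i in F | (i < j)%N]|.

(** The differential raises the size of a face by one, so that degree p of a cube is homological
    degree n - p of the Koszul complex. *)
Definition cube_diff s : chain :=
  [ffun F : {set 'I_n} => \sum_(j in F) cube_sign j F *: s (F :\ j)].

Lemma cube_diff_is_linear : linear cube_diff.
Proof.
move=> a s t; apply/ffunP => F; rewrite !ffunE scaler_sumr -big_split /=.
apply: eq_bigr => j _; rewrite !ffunE scalerDr !scalerA.
by rewrite mulrC.
Qed.

HB.instance Definition _ :=
  GRing.isLinear.Build K chain chain _ cube_diff cube_diff_is_linear.

Lemma cube_diffK s : cube_diff (cube_diff s) = 0.
Proof.
apply/ffunP => F; rewrite !ffunE.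
pose G j i := (cube_sign j F * cube_sign i (F :\ j)) *: s (F :\ j :\ i).
have GN j i : j \in F -> i \in F -> (i < j)%N -> G j i = - G i j.
  move=> jF iF ij; rewrite /G (_ : F :\ i :\ j = F :\ j :\ i); last first.
    by apply/setP => x; rewrite !inE andbCA.
  rewrite -scaleNr; congr (_ *: _).
  rewrite /cube_sign (_ : [set _ in F :\ j | _] = [set x in F | (x < i)%N]).
    rewrite (cardsD1 i [set x in F | (x < j)%N]) !inE iF ij /=.
    rewrite (_ : [set x in F | (x < j)%N] :\ i = [set x in F :\ i | (x < j)%N]).
      by rewrite exprD expr1 mulN1r mulNr mulrC.
    by apply/setP => x; rewrite !inE andbA.
  apply/setP => x; rewrite !inE; case: eqP => //= -> ; rewrite jF /=.
  by rewrite ltnNge ltnW.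
have -> : \sum_(j in F) cube_sign j F *: cube_diff s (F :\ j) =
   \sum_(j in F) (\sum_(i in F | (i < j)%N) G j i + \sum_(i in F | (j < i)%N) G j i).
  apply: eq_bigr => j jF; rewrite ffunE scaler_sumr.
  rewrite (bigID (fun i : 'I_n => (i < j)%N)) /=.
  congr (_ + _).
    apply: eq_big => [i|i _]; last by rewrite scalerA.
    by rewrite !inE; case: eqP => //= ->; rewrite ltnn andbF.
  apply: eq_big => [i|i _]; last by rewrite scalerA.
  rewrite !inE -leqNgt (ltn_neqAle j i) -(inj_eq val_inj) /= eq_sym.
  by case: (i \in F); case: (_ == _).
rewrite big_split /= [X in _ + X](exchange_big_dep (fun i => i \in F)) /=; last first.
  by move=> ? ? _ /andP[].
rewrite -big_split /=; apply: big1 => j jF.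
rewrite [X in _ + X](eq_bigl (fun i : 'I_n => (i \in F) && (i < j)%N)); last first.
  by move=> i; rewrite jF.
rewrite -big_split /= big1 // => i /andP[iF ij].
by rewrite GN // addNr.
Qed.

Definition subsp (Q : V -> Prop) : Prop :=
  Q 0 /\ forall a u v, Q u -> Q v -> Q (a *: u + v).

Lemma subspD Q u v : subsp Q -> Q u -> Q v -> Q (u + v).
Proof. by move=> [_ QD] Qu Qv; rewrite -[u]scale1r; apply: QD. Qed.

Lemma subspZ Q a u : subsp Q -> Q u -> Q (a *: u).
Proof. by move=> [Q0 QD] Qu; rewrite -[_ *: u]addr0; apply: QD. Qed.

Lemma subspB Q u v : subsp Q -> Q u -> Q v -> Q (u - v).
Proof. by move=> QS Qu Qv; apply: subspD => //; rewrite -scaleN1r; apply: subspZ. Qed.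

Lemma subsp_sum Q (I : Type) (r : seq I) (p : pred I) (f : I -> V) :
  subsp Q -> (forall i, p i -> Q (f i)) -> Q (\sum_(i <- r | p i) f i).
Proof.
by move=> QS Qf; apply: (big_ind Q) => //; [case: QS | move=> *; apply: subspD].
Qed.

Definition chain_in P s := forall F, P F (s F).
Definition chain_deg p s := forall F, s F != 0 -> #|F| = p.

Definition cube_exact P p := forall s, chain_in P s -> chain_deg p s ->
  cube_diff s = 0 ->
  exists2 t, chain_in P t /\ (forall F, t F != 0 -> #|F|.+1 = p) & s = cube_diff t.

Definition cube_family P := (forall F, subsp (P F)) /\
  (forall (F G : {set _}) v, F \subset G -> P F v -> P G v).

Lemma cube_diff_in P t : cube_family P -> chain_in P t -> chain_in P (cube_diff t).
Proof.
move=> [PS Pm] tP F; rewrite ffunE; apply: subsp_sum => // j jF.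
by apply: subspZ => //; apply: Pm (tP _); apply: subsetDl.
Qed.

Lemma cube_diff_deg p t : (forall F, t F != 0 -> #|F|.+1 = p) ->
  chain_deg p (cube_diff t).
Proof.
move=> tp F; rewrite ffunE => /eqP; apply: contra_notP => Fp.
apply: big1 => j jF; have [->|/tp] := eqVneq (t (F :\ j)) 0; first by rewrite scaler0.
by move=> E; case: Fp; rewrite (cardsD1 j) jF.
Qed.

Lemma cube_exact_big P p : (forall F, subsp (P F)) -> (n < p)%N -> cube_exact P p.
Proof.
move=> PS np s sP sp _; exists 0; last first.
  rewrite linear0; apply/ffunP => F; rewrite [RHS]ffunE; apply/eqP/negPn/negP => /sp Fp.
  by have := max_card F; rewrite card_ord Fp leqNgt np.
by split => F; rewrite ffunE ?eqxx //; case: (PS F).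
Qed.

Lemma eq_cube_exact P P' p : (forall F v, P F v <-> P' F v) ->
  cube_exact P p -> cube_exact P' p.
Proof.
move=> PP' E s sP sp s0; have [|t [tP tp] ->] := E s _ sp s0.
  by move=> F; apply/PP'.
by exists t => //; split=> // F; apply/PP'.
Qed.

Section Split.
Variable j : 'I_n.

Definition chain_off s : chain := [ffun F : {set 'I_n} => if j \in F then 0 else s F].
Definition chain_on s : chain := [ffun F : {set 'I_n} => if j \in F then s F else 0].

Lemma chain_off_on s : s = chain_off s + chain_on s.
Proof. by apply/ffunP => F; rewrite !ffunE; case: ifP; rewrite ?add0r ?addr0. Qed.

Lemma cube_diff_offE s F : j \in F ->
  cube_diff (chain_off s) F = cube_sign j F *: s (F :\ j).
Proof.
move=> jF; rewrite ffunE (bigD1 j) //= ffunE !inE eqxx /= big1 ?addr0 // => i /andP[_ ij].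
by rewrite ffunE !inE eq_sym ij jF scaler0.
Qed.

Lemma cube_diff_onE s F : j \notin F -> cube_diff (chain_on s) F = 0.
Proof.
move=> jF; rewrite ffunE big1 // => i _.
by rewrite ffunE !inE (negPf jF) andbF scaler0.
Qed.

Lemma cube_signK F : cube_sign j F * cube_sign j F = 1.
Proof. by rewrite /cube_sign -exprD addnn -mul2n exprM sqrrN expr1n expr1n. Qed.

Variables P0 P1 P2 : family.
Hypotheses (fam0 : cube_family P0) (fam1 : cube_family P1) (fam2 : cube_family P2).
Hypotheses (ind0 : forall F v, P0 (j |: F) v -> P0 F v)
           (ind1 : forall F v, P1 (j |: F) v -> P1 F v).
Hypotheses (sub01 : forall F v, P0 F v -> P1 F v) (sub12 : forall F v, P1 F v -> P2 F v).

(** When P is contained in P' and both ignore the direction j, this is the mapping cone of the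
    inclusion, a model of P'/P without quotient spaces. *)
Definition cube_glue P P' : family := fun F => if j \in F then P' F else P F.

(** Exactness in the middle of the sequence of 0 -> P1/P0 -> P2/P0 -> P2/P1 -> 0. The part off j of
    a primitive lies in P1 instead of P0; its boundary is a cycle for P1/P0, and a primitive of that
    cycle replaces it. *)
Lemma cube_exact_glue_trans p :
  cube_exact (cube_glue P0 P1) p -> cube_exact (cube_glue P1 P2) p ->
  cube_exact (cube_glue P0 P2) p.
Proof.
have [S0 m0] := fam0; have [S1 m1] := fam1; have [S2 m2] := fam2.
move=> ex01 ex12 s sP sp s0.
have [|t [tP tp] st] := ex12 s _ sp s0.
  by move=> F; move: (sP F); rewrite /cube_glue; case: ifP => // _ /sub01.
have Er : cube_diff (chain_off t) = s - cube_diff (chain_on t).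
  by rewrite st {2}(chain_off_on t) linearD /= addrK.
have [|||r [rP rp] Er'] := ex01 (cube_diff (chain_off t)).
- move=> F; rewrite /cube_glue; case: ifPn => jF.
    rewrite cube_diff_offE //; apply: subspZ => //.
    have := tP (F :\ j); rewrite /cube_glue !inE eqxx /=; apply: m1.
    by apply: subsetDl.
  rewrite Er !ffunE [X in _ - X](_ : _ = 0) ?subr0.
    by have := sP F; rewrite /cube_glue (negPf jF).
  by have := cube_diff_onE t jF; rewrite ffunE.
- apply: cube_diff_deg => F; rewrite ffunE; case: ifP; rewrite ?eqxx // => _; exact: tp.
- exact: cube_diffK.
exists (r + chain_on t); last by rewrite linearD /= -Er' Er subrK.
split=> F.
  have := rP F; have := tP F; rewrite /cube_glue !ffunE; case: ifP => jF.
    by move=> tF rF; apply: subspD => //; apply: sub12.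
  by rewrite addr0.
rewrite !ffunE; case: ifP => jF; rewrite ?addr0; last exact: rp.
by have [->|/rp //] := eqVneq (r F) 0; rewrite add0r; apply: tp.
Qed.

(** The same sequence one step earlier: P1/P0 in degree p stands between P2/P1 in degree p - 1 and
    P2/P0 in degree p. The primitive t found for P2/P0 has its part on j in P2 only, and the task is
    to move that part into P1. *)
Lemma cube_exact_glue_left p :
  cube_exact (cube_glue P0 P2) p ->
  (forall p', p = p'.+1 -> cube_exact (cube_glue P1 P2) p') ->
  cube_exact (cube_glue P0 P1) p.
Proof.
have [S0 m0] := fam0; have [S1 m1] := fam1; have [S2 m2] := fam2.
move=> ex02 ex12 s sP sp s0.
have [|t [tP tp] st] := ex02 s _ sp s0.
  by move=> F; move: (sP F); rewrite /cube_glue; case: ifP => // _ /sub12.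
case: p => [|p] in ex02 ex12 sp tp *.
  have t0 : t = 0 by apply/ffunP => F; rewrite ffunE; apply/eqP/negPn/negP => /tp.
  exists 0; last by rewrite st t0.
  split=> F; rewrite ffunE ?eqxx // /cube_glue; case: ifP => _.
    by case: (S1 F).
  by case: (S0 F).
have tp' F : t F != 0 -> #|F| = p by move=> /tp[].
pose t1 := chain_on t; pose t0 := chain_off t.
have t01 : t = t0 + t1 by exact: chain_off_on.
(* [w] cancels the boundary of [t1] on the sets containing j; the sets without j then follow from d
   d = 0. It has values in P1 because the boundary of [t1] is s minus that of [t0]. *)
pose w : chain := chain_off
  [ffun F : {set 'I_n} => - cube_sign j (j |: F) *: cube_diff t1 (j |: F)].
have t1E : cube_diff t1 = s - cube_diff t0 by rewrite st t01 linearD /= addrC addKr.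
have t1deg : chain_deg p.+1 (cube_diff t1).
  apply: cube_diff_deg => F; rewrite ffunE; case: ifP; rewrite ?eqxx // => _; exact: tp.
have v0 : cube_diff (t1 + w) = 0.
  have on0 F : j \in F -> cube_diff (t1 + w) F = 0.
    move=> jF; rewrite linearD ffunE cube_diff_offE // [X in _ *: X]ffunE setD1K //.
    by rewrite scalerA mulrN cube_signK scaleN1r subrr.
  have vv : cube_diff (t1 + w) = chain_off (cube_diff (t1 + w)).
    by apply/ffunP => F; rewrite [RHS]ffunE; case: ifP => // /on0.
  apply/ffunP => F; case: (boolP (j \in F)) => jF; first by rewrite on0 // ffunE.
  have jF' : j \in j |: F by rewrite setU11.
  have : cube_diff (cube_diff (t1 + w)) (j |: F) = 0 by rewrite cube_diffK ffunE.
  rewrite {1}vv cube_diff_offE // setU1K // => /(congr1 ( *:%R (cube_sign j (j |: F)))).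
  by rewrite scalerA cube_signK scale1r scaler0 => ->; rewrite ffunE.
have [||k [kP kp] Ek] := ex12 p erefl (t1 + w) _ _ v0.
- move=> F; rewrite /cube_glue ffunE [t1 F]ffunE [w F]ffunE; case: ifPn => jF.
    by rewrite addr0; have := tP F; rewrite /cube_glue jF.
  rewrite add0r ffunE; apply: subspZ => //; apply: ind1.
  have jF' : j \in j |: F by rewrite setU11.
  rewrite t1E ffunE [X in _ + X]ffunE.
  apply: subspB => //; first by have := sP (j |: F); rewrite /cube_glue jF'.
  rewrite cube_diff_offE // setU1K //; apply: subspZ => //.
  apply: (m1 F); first exact: subsetUr.
  by apply: sub01; have := tP F; rewrite /cube_glue (negPf jF).
- move=> F; rewrite ffunE [t1 F]ffunE [w F]ffunE; case: ifPn => jF.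
    by rewrite addr0; apply: tp'.
  rewrite add0r ffunE => /eqP; apply: contra_notP => Fp.
  have [->|/t1deg] := eqVneq (cube_diff t1 (j |: F)) 0; first by rewrite scaler0.
  by rewrite cardsU1 jF add1n => -[].
(* [e] has values in P1, like the part of k off j, and the same boundary as [t1], which it
   replaces. *)
pose e := chain_on (cube_diff (chain_off k)).
have Ew : w = chain_off (cube_diff (chain_off k)).
  apply/ffunP => F; rewrite [RHS]ffunE; case: ifPn => jF; first by rewrite !ffunE jF.
  have : (t1 + w) F = w F by rewrite ffunE /t1 ffunE (negPf jF) add0r.
  rewrite Ek => <-; rewrite {1}(chain_off_on k) linearD ffunE cube_diff_onE //.
  by rewrite addr0.
have Ee : cube_diff e = cube_diff t1.
  have := cube_diffK (chain_off k); rewrite {1}(chain_off_on (cube_diff (chain_off k))) -Ew -/e.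
  rewrite linearD /= => h; move: v0; rewrite linearD /= => h'.
  apply: (addIr (cube_diff w)); rewrite h' addrC; exact: h.
exists (t0 + e); last by rewrite linearD /= Ee t1E addrC subrK.
split=> F.
  rewrite ffunE [t0 F]ffunE [e F]ffunE /cube_glue; case: ifPn => jF.
    rewrite add0r cube_diff_offE //; apply: subspZ => //.
    have := kP (F :\ j); rewrite /cube_glue !inE eqxx /=; apply: m1.
    exact: subsetDl.
  by rewrite addr0; have := tP F; rewrite /cube_glue (negPf jF).
rewrite ffunE [t0 F]ffunE [e F]ffunE; case: ifPn => jF; last by rewrite addr0; apply: tp.
rewrite add0r; suff dk : chain_deg p (cube_diff (chain_off k)) by move=> /dk ->.
by apply: cube_diff_deg => G; rewrite ffunE; case: ifP; rewrite ?eqxx // => _; exact: kp.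
Qed.

End Split.
End Cube.

(** * Boxes of degrees and the change of their side lengths *)

Section Boxes.
Variables (K : fieldType) (n : nat) (V : lmodType K).
Variable Q : ('I_n -> nat) -> V -> Prop.
Hypothesis Qsub : forall w, subsp (Q w).
Hypothesis Qmono : forall w w' v, (forall i, (w i <= w' i)%N) -> Q w v -> Q w' v.
Implicit Types (lo hi : 'I_n -> nat) (j : 'I_n).

(* The Koszul complex of the powers x_i^(hi i - lo i). For hi = lo + 1 it computes
   Betti numbers, for large hi it is Takayama's complex for local cohomology. *)
Definition box lo hi (F : {set 'I_n}) : V -> Prop :=
  Q (fun i => if i \in F then hi i else lo i).

Lemma box_family lo hi : (forall i, (lo i <= hi i)%N) -> cube_family (box lo hi).
Proof.
move=> lh; split=> [F|F G v FG]; first exact: Qsub.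
apply: Qmono => i; case: ifP => iF; first by rewrite (subsetP FG).
by case: ifP.
Qed.

Definition upd (f : 'I_n -> nat) j x : 'I_n -> nat := fun i => if i == j then x else f i.

Lemma upd_id f j : upd f j (f j) = f.
Proof. by apply/funext => i; rewrite /upd; case: eqP => // ->. Qed.

(** A box is the mapping cone of its two faces orthogonal to j; a cut or an extension at height y
    brings in a third face, and the lemmas on glued families apply. *)
Let slice lo hi j x (F : {set 'I_n}) : V -> Prop := box (upd lo j x) (upd hi j x) F.

Lemma box_glue lo hi j x y F v :
  cube_glue j (slice lo hi j x) (slice lo hi j y) F v <-> box (upd lo j x) (upd hi j y) F v.
Proof.
suff -> : cube_glue j (slice lo hi j x) (slice lo hi j y) F = box (upd lo j x) (upd hi j y) F by [].
rewrite /cube_glue /slice /box; case: ifPn => jF; congr Q; apply/funext => i; rewrite /upd.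
  by case: eqP => // ->; rewrite jF.
by case: eqP => // ->; rewrite (negPf jF).
Qed.

Section Steps.
Variables (lo hi : 'I_n -> nat) (j : 'I_n) (y : nat).
Hypotheses (lh : forall i, (lo i <= hi i)%N).

Let fam x : cube_family (slice lo hi j x).
Proof. by apply: box_family => i; rewrite /upd; case: ifP. Qed.

Let ind x F v : slice lo hi j x (j |: F) v -> slice lo hi j x F v.
Proof.
rewrite /slice /box => h; set f := (X in Q X); rewrite (_ : f = fun i => if i \in j |: F then upd hi j x i else upd lo j x i) //.
by apply/funext => i; rewrite /f !inE /upd; case: eqP => //= _; rewrite !if_same.
Qed.

Let sub x x' F v : (x <= x')%N -> slice lo hi j x F v -> slice lo hi j x' F v.
Proof. by move=> xx; apply: Qmono => i; rewrite /upd; case: (i \in F); case: ifP. Qed.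

Lemma box_exact_trans p : (lo j <= y <= hi j)%N ->
  cube_exact (box lo (upd hi j y)) p -> cube_exact (box (upd lo j y) hi) p ->
  cube_exact (box lo hi) p.
Proof.
move=> /andP[ly yh] e1 e2.
suff : cube_exact (cube_glue j (slice lo hi j (lo j)) (slice lo hi j (hi j))) p.
  by apply: eq_cube_exact => F v; rewrite box_glue !upd_id.
apply: (@cube_exact_glue_trans _ _ _ _ _ (slice lo hi j y)) => //.
- by move=> F v; apply: sub.
- by move=> F v; apply: sub.
- by move: e1; apply: eq_cube_exact => F v; rewrite box_glue upd_id.
- by move: e2; apply: eq_cube_exact => F v; rewrite box_glue upd_id.
Qed.

Lemma box_exact_left p : (hi j <= y)%N ->
  cube_exact (box lo (upd hi j y)) p ->
  (forall p', p = p'.+1 -> cube_exact (box (upd lo j (hi j)) (upd hi j y)) p') ->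
  cube_exact (box lo hi) p.
Proof.
move=> hy e1 e2.
suff : cube_exact (cube_glue j (slice lo hi j (lo j)) (slice lo hi j (hi j))) p.
  by apply: eq_cube_exact => F v; rewrite box_glue !upd_id.
apply: (@cube_exact_glue_left _ _ _ _ _ _ (slice lo hi j y)) => //.
- by move=> F v; apply: ind.
- by move=> F v; apply: sub.
- by move=> F v; apply: sub.
- by move: e1; apply: eq_cube_exact => F v; rewrite box_glue upd_id.
- by move=> p' /e2; apply: eq_cube_exact => F v; rewrite box_glue.
Qed.

End Steps.

(** When a box that is not exact is cut at height [(lo j).+1], one of the two pieces is not exact in
    the same degree. Lower ends only grow, and the sum of the side lengths drops. *)
Lemma box_shrink lo hi p : (forall i, (lo i < hi i)%N) -> ~ cube_exact (box lo hi) p ->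
  exists2 lo', forall i, (lo i <= lo' i)%N & ~ cube_exact (box lo' (fun i => (lo' i).+1)) p.
Proof.
have [m] := ubnP (\sum_i (hi i - lo i))%N.
elim: m => // m IH in lo hi *; rewrite ltnS => hm lh nex.
case: (pselect (forall i, hi i = (lo i).+1)) => [E|/existsNP[j hj]].
  by exists lo => //; move: nex; rewrite (_ : hi = fun i => (lo i).+1) //; apply/funext.
have hj' : ((lo j).+1 < hi j)%N by rewrite ltn_neqAle lh andbT eq_sym; apply/eqP.
have lh' i : (lo i <= hi i)%N by rewrite ltnW.
have dec f g : (forall i, (lo i < hi i)%N -> (hi i - lo i > g i - f i)%N \/ (g i = hi i /\ f i = lo i)) ->
    (g j - f j < hi j - lo j)%N -> (\sum_i (g i - f i) < m)%N.
  move=> h hj2; apply: leq_trans hm; rewrite (bigD1 j) //= [X in (_ < X)%N](bigD1 j) //=.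
  rewrite -addSn leq_add // leq_sum // => i _; have [|[-> ->]//] := h i (lh i).
  exact: ltnW.
case: (pselect (cube_exact (box lo (upd hi j (lo j).+1)) p)) => [ex1|nex1]; last first.
  apply: (IH _ _ _ _ nex1) => [|i]; last by rewrite /upd; case: eqP => // ->.
  apply: dec => [i|]; rewrite /upd ?eqxx; last by rewrite ltn_sub2r // ltnW.
  by case: eqP => [-> _|]; [left; rewrite ltn_sub2r // ltnW|right].
case: (pselect (cube_exact (box (upd lo j (lo j).+1) hi) p)) => [ex2|nex2].
  case: nex; apply: (box_exact_trans lh' (j := j) (y := (lo j).+1)) => //.
  by rewrite leqnSn ltnW.
have [||lo' le ne] := IH _ _ _ _ nex2.
- apply: dec => [i|]; rewrite /upd ?eqxx; last by rewrite ltn_sub2l // ltnW.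
  by case: eqP => [-> _|]; [left; rewrite ltn_sub2l // ltnW|right].
- by move=> i; rewrite /upd; case: eqP => // ->.
by exists lo' => // i; apply: leq_trans (le i); rewrite /upd; case: eqP => // ->.
Qed.

(** If the class dies when side j is lengthened, the added box is not exact in degree p - 1. Its
    lower end is [hi j], larger than [lo j] by at least 1, which pays for the loss in p. *)
Lemma box_stretch N lo hi p : (forall i, (lo i < hi i <= N)%N) ->
  ~ cube_exact (box lo hi) p ->
  exists lo' p', [/\ forall i, (lo' i < N)%N,
    (\sum_i lo i + p <= \sum_i lo' i + p')%N
    & ~ cube_exact (box lo' (fun=> N)) p'].
Proof.
have [m] := ubnP #|[pred i | hi i != N]|.
elim: m => // m IH in lo hi p *; rewrite ltnS => hm lh nex.
have lh' i : (lo i <= hi i)%N by have /andP[/ltnW] := lh i.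
case: (pselect (forall i, hi i = N)) => [E|/existsNP[j hj]].
  exists lo, p; split=> // [i|]; first by have := lh i; rewrite E leqnn andbT.
  by move: nex; rewrite (_ : hi = fun i => N) //; apply/funext.
have hj' : (hi j < N)%N by have /andP[_] := lh j; rewrite leq_eqVlt => /predU1P[].
have cardm : (#|[pred i | upd hi j N i != N]| < m)%N.
  apply: leq_trans hm; rewrite [X in (_ < X)%N](cardD1 j) inE.
  have -> /= : hi j != N by apply/eqP.
  rewrite add1n ltnS; apply/subset_leq_card/subsetP => i; rewrite !inE /upd.
  by case: (i =P j) => [->|_] /=; rewrite ?eqxx.
case: (pselect (cube_exact (box lo (upd hi j N)) p)) => [ex1|nex1]; last first.
  apply: (IH _ _ _ _ _ nex1) => // i; rewrite /upd; case: eqP => [->|//].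
  by rewrite leqnn andbT; have /andP[lj] := lh j; apply: leq_trans.
case: (pselect (forall p', p = p'.+1 -> cube_exact (box (upd lo j (hi j)) (upd hi j N)) p')).
  by move=> ex2; case: nex; apply: (box_exact_left lh' (j := j) (y := N)) => //; apply: ltnW.
move=> /existsNP[p' /not_implyP[-> nex2]].
have [||lo' [q [lN le ne]]] := IH _ _ _ _ _ nex2 => //.
  by move=> i; rewrite /upd; case: eqP => // _; rewrite hj' leqnn.
exists lo', q; split=> //; apply: leq_trans le.
rewrite -addSnnS leq_add2r (bigD1 j) //= [X in (_ < X)%N](bigD1 j) //= /upd eqxx.
rewrite -addSn.
apply: leq_add; first by have /andP[] := lh j.
by apply: leq_sum => i /negPf ->.
Qed.

End Boxes.

(** * Multigraded minimal resolutions *)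

Section Shift.
Variables (K : fieldType) (n : nat).
Implicit Types (a b c : 'X_{1..n}) (w : 'I_n -> nat).

(* Indices are shifted by one: [w] stands for the degree w - 1 in Z^n, in which the
   module vanishes as soon as a coordinate is -1. The unit cube at [c] thus has its
   vertices in the degrees c - 1 + 1_F, and its homology is Koszul homology in
   degree [c]. *)
Definition shift_mod d (N : 'X_{1..n} -> 'M[K]_d) w : 'M[K]_d :=
  if [forall i, 0 < w i]%N then N [multinom (w i).-1 | i < n] else 0.

Definition shift_sub d (N : 'X_{1..n} -> 'M[K]_d) w (v : 'rV[K]_d) : Prop :=
  (v <= shift_mod N w)%MS.

Definition mono_mod d (N : 'X_{1..n} -> 'M[K]_d) :=
  forall a b, (a <= b)%MM -> (N a <= N b)%MS.

Definition unit_cube d (N : 'X_{1..n} -> 'M[K]_d) c :=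
  box (shift_sub N) c (fun i => (c i).+1).

Lemma subsp_mx d d' (A : 'M[K]_(d', d)) : subsp (fun v : 'rV[K]_d => (v <= A)%MS).
Proof.
split=> [|a u v uA vA]; first exact: sub0mx.
by rewrite addmx_sub // scalemx_sub.
Qed.

Lemma shift_sub_mono d (N : 'X_{1..n} -> 'M[K]_d) w w' v : mono_mod N ->
  (forall i, (w i <= w' i)%N) -> shift_sub N w v -> shift_sub N w' v.
Proof.
move=> Nm ww; rewrite /shift_sub => /submx_trans; apply.
rewrite /shift_mod; case: ifP => [/forallP w0|_]; last exact: sub0mx.
have -> : [forall i, 0 < w' i]%N by apply/forallP => i; apply: leq_trans (ww i).
apply: Nm; apply/mnm_lepP => i; rewrite !mnmE.
by have := w0 i; have := ww i; case: (w i) => // x; case: (w' i).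
Qed.

Lemma unit_cube_family d (N : 'X_{1..n} -> 'M[K]_d) c : mono_mod N ->
  cube_family (unit_cube N c).
Proof.
move=> Nm; apply: box_family => [w|w w' v|i]; last exact: leqnSn.
  exact: subsp_mx.
exact: shift_sub_mono.
Qed.

(** The degree c - 1 + 1_F. The truncation at 0 is harmless: [unit_cubeE] reads the value only when
    no coordinate is -1. *)
Definition cube_exp c (F : {set 'I_n}) : 'X_{1..n} := [multinom (c i + (i \in F)).-1 | i < n].

Lemma unit_cubeE d (N : 'X_{1..n} -> 'M[K]_d) c F v :
  unit_cube N c F v <->
  if [forall i, (0 < c i) || (i \in F)]%N then is_true (v <= N (cube_exp c F))%MS else v = 0.
Proof.
rewrite /unit_cube /box /shift_sub /shift_mod.
have -> : [forall i, (0 < if i \in F then (c i).+1 else c i)]%N = [forall i, (0 < c i) || (i \in F)]%N.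
  by apply: eq_forallb => i; case: ifP; rewrite ?orbT ?orbF.
case: ifP => _; last by rewrite submx0; split=> /eqP.
rewrite (_ : [multinom _ | i < n] = cube_exp c F) //.
by apply/mnmP => i; rewrite !mnmE; case: ifP; rewrite ?addn1 ?addn0.
Qed.

Lemma cube_expT c : cube_exp c setT = c.
Proof. by apply/mnmP => i; rewrite mnmE inE addn1. Qed.

Lemma cube_exp1 c j : cube_exp c (setT :\ j) = (c - U_(j))%MM.
Proof.
by apply/mnmP => i; rewrite !mnmE !inE eq_sym; case: eqP => _ /=; rewrite ?addn0 ?addn1 ?subn1 ?subn0.
Qed.

Definition below_mod d (N : 'X_{1..n} -> 'M[K]_d) c : 'M[K]_d :=
  (\sum_(j < n | (0 < c j)%N) N (c - U_(j))%MM)%MS.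

Lemma unit_cube_boundary_top d (N : 'X_{1..n} -> 'M[K]_d) c s : mono_mod N ->
  chain_deg n s -> (s setT <= below_mod N c)%MS ->
  exists2 t, chain_in (unit_cube N c) t /\ (forall F, t F != 0 -> #|F|.+1 = n)
    & s = cube_diff t.
Proof.
move=> Nm sn vS; have [u Eu] := sub_sumsmxP vS.
pose t := [ffun F : {set 'I_n} => \sum_(j < n | (0 < c j)%N && (F == setT :\ j))
   cube_sign K j setT *: (u j *m N (c - U_(j))%MM)].
exists t.
  split=> F; rewrite ffunE.
    apply: subsp_sum => [|j /andP[cj /eqP->]].
      by case: (unit_cube_family c Nm).
    apply: subspZ; first by case: (unit_cube_family c Nm).
    apply/unit_cubeE; rewrite cube_exp1; case: ifP => [_|]; first exact: submxMl.
    by move=> /forallP[] i; rewrite !inE andbT; case: eqP => [->|_]; rewrite ?cj ?orbT.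
  apply: contra_neq_eq => nF; rewrite big1 // => j /andP[_ /eqP FE].
  case/eqP: nF; rewrite FE -[RHS]card_ord -cardsT [in RHS](cardsD1 j) inE add1n.
  by [].
apply/ffunP => F; rewrite ffunE; have [->|FT] := eqVneq F setT; last first.
  have -> : s F = 0.
    apply/eqP/negPn/negP => /sn Fn; case/negP: FT.
    by rewrite eqEcard subsetT cardsT card_ord Fn leqnn.
  rewrite big1 // => j jF; rewrite ffunE big1 ?scaler0 // => i /andP[_ /eqP E].
  case/eqP: FT; apply/setP => x; rewrite inE.
  have /setP/(_ x) := E; rewrite !inE andbT; have [->|_] := eqVneq x j; first by rewrite jF.
  have [->|_ /= ->//] := eqVneq x i.
  by have /setP/(_ j) := E; rewrite !inE eqxx andbT => /esym/negbFE/eqP <-; rewrite jF.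
rewrite Eu [RHS](bigID (fun j : 'I_n => 0 < c j)%N) /= [X in _ = _ + X]big1 ?addr0.
  apply: eq_big => [j|j cj]; first by rewrite inE.
  rewrite ffunE (big_pred1 j) ?scalerA ?cube_signK ?scale1r // => i /=.
  apply/andP/eqP => [[_ /eqP/setP/(_ i)]|->]; last by rewrite cj eqxx.
  by rewrite !inE eqxx andbT => /negbFE/eqP.
move=> j /andP[_ cj]; rewrite ffunE big1 ?scaler0 // => i /andP[ci /eqP/setP/(_ j)].
rewrite !inE eqxx !andbT /= => /esym E; have/eqP E' := negbFE E; by move: cj; rewrite E' ci.
Qed.

(** Degree n of the cube is Koszul homology in degree 0, so failure of exactness there means that N
    needs a generator in degree c. *)
Lemma unit_cube_exact_top d (N : 'X_{1..n} -> 'M[K]_d) c : mono_mod N ->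
  cube_exact (unit_cube N c) n <-> (N c <= below_mod N c)%MS.
Proof.
move=> Nm; split=> [ex|/row_subP NS].
  apply/row_subP => k; pose v := row k (N c).
  pose s := [ffun F : {set 'I_n} => if F == setT then v else 0].
  have [|||t [tP tn] st] := ex s.
  - move=> F; rewrite ffunE; case: eqP => [->|_]; last first.
      by case: (unit_cube_family c Nm) => + _ => /(_ F)[].
    apply/unit_cubeE; rewrite cube_expT row_sub.
    by case: ifP => // /forallP[] i; rewrite inE orbT.
  - move=> F; rewrite ffunE; have [->|_] := eqVneq F setT; last by rewrite eqxx.
    by rewrite cardsT card_ord.
  - apply/ffunP => F; rewrite !ffunE big1 // => j jF; rewrite ffunE.
    case: eqVneq => [/setP/(_ j)|]; first by rewrite !inE eqxx.
    by rewrite scaler0.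
  have := congr1 (fun x : {ffun _} => x setT) st.
  rewrite /= ffunE eqxx -/v => ->; rewrite ffunE.
  apply: summx_sub => j _; apply: scalemx_sub.
  have /unit_cubeE := tP (setT :\ j).
  case: ifP => [/forallP/(_ j)|_ ->]; last exact: sub0mx.
  rewrite !inE eqxx orbF cube_exp1 => cj /submx_trans; apply.
  by rewrite /below_mod (sumsmx_sup j).
move=> s sP sn _; apply: unit_cube_boundary_top => //.
have /unit_cubeE := sP setT; rewrite cube_expT; case: ifP => [_|_ ->]; last exact: sub0mx.
by move/submx_trans; apply; apply/row_subP.
Qed.

End Shift.

(** * Koszul homology of multigraded free modules *)

Section FreeModules.
Variables (K : fieldType) (n r : nat) (lab : 'I_r -> 'X_{1..n}).
Implicit Types (a b c : 'X_{1..n}).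

Definition free_mod a : 'M[K]_r := diag_mx (\row_i (lab i <= a)%MM%:R).

Lemma free_modP a (v : 'rV[K]_r) :
  reflect (forall i, v 0 i != 0 -> (lab i <= a)%MM) (v <= free_mod a)%MS.
Proof.
apply: (iffP submxP) => [[w ->] i|h].
  by rewrite mul_mx_diag !mxE; case: (_ <= _)%MM; rewrite ?mulr0 ?eqxx.
exists v; apply/rowP => i; rewrite mul_mx_diag !mxE.
have [->|/h->] := eqVneq (v 0 i) 0; first by rewrite mul0r.
by rewrite mulr1.
Qed.

Lemma free_mod_mono : mono_mod free_mod.
Proof.
move=> a b ab; apply/row_subP => k; apply/free_modP => i hi.
have /free_modP/(_ i hi) h := row_sub k (free_mod a); exact: lepm_trans h ab.
Qed.

(* If [lab i <> c], contracting along a coordinate where they differ kills the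
   [i]-th summand of the unit cube. *)
Lemma free_mod_exact c p : (p < n)%N -> cube_exact (unit_cube free_mod c) p.
Proof.
move=> pn s sP sp s0.
have out i F : s F 0 i != 0 -> (forall k, 0 < c k \/ k \in F)%N /\ (lab i <= cube_exp c F)%MM.
  move=> si; have /unit_cubeE := sP F; case: ifP => [/forallP h|_ E]; last first.
    by move: si; rewrite E mxE eqxx.
  by move=> /free_modP/(_ _ si); split=> // k; apply/orP.
pose jj i := [pick j : 'I_n | lab i j != c j].
(* This is where p < n enters: for [lab i = c] the i-th summand could be nonzero on the full set
   only, which has size n. *)
have jjP i : (exists F, s F 0 i != 0) -> exists2 j, jj i = Some j & (lab i j < c j)%N.
  move=> [F si]; have [cF lF] := out _ _ si; rewrite /jj; case: pickP => [j lj|lc].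
    exists j => //; rewrite ltn_neqAle lj /=; move/mnm_lepP: lF => /(_ j); rewrite mnmE.
    have := cF j; have := lj; case: (j \in F); rewrite ?addn1 // addn0 => + _.
    by move=> _ /leq_trans; apply; apply: leq_pred.
  have FT : F = setT.
    apply/setP => k; rewrite inE; apply/negPn/negP => kF.
    move/mnm_lepP: lF => /(_ k); rewrite mnmE (negPf kF) addn0.
    move: (lc k) => /negbFE/eqP->; case: (cF k) => [ck|]; last by rewrite (negPf kF).
    by rewrite -ltnS prednK // ltnn.
  have : #|F| = p by apply: sp; apply: contra si => /eqP->; rewrite mxE.
  by rewrite FT cardsT card_ord => E; rewrite E ltnn in pn.
pose t : {ffun {set 'I_n} -> 'rV[K]_r} := [ffun F : {set 'I_n} => \row_i
  if jj i is Some j then if j \in F then 0 else cube_sign K j (j |: F) * s (j |: F) 0 i else 0].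
exists t; last first.
  apply/ffunP => F; apply/rowP => i.
  case: (pselect (exists F, s F 0 i != 0)) => [/jjP[j ji lj]|si]; last first.
    have {}si F' : s F' 0 i = 0 by apply/eqP/negPn/negP => h; apply: si; exists F'.
    rewrite si ffunE summxE big1 // => k _; rewrite !mxE ffunE mxE.
    by case: (jj i) => [j|]; rewrite ?mulr0 // si mulr0 if_same mulr0.
  have tE G : t G 0 i = if j \in G then 0 else cube_sign K j (j |: G) * s (j |: G) 0 i.
    by rewrite ffunE mxE ji.
  rewrite ffunE summxE; case: (boolP (j \in F)) => jF.
    rewrite (bigD1 j) //= mxE tE !inE eqxx /= setD1K // mulrA cube_signK mul1r big1 ?addr0 //.
    by move=> k /andP[_ kj]; rewrite mxE tE !inE eq_sym kj jF mulr0.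
  have : cube_diff s (j |: F) 0 i = 0 by rewrite s0 ffunE mxE.
  rewrite ffunE summxE (bigD1 j) ?setU11 //= setU1K // mxE.
  move=> /eqP; rewrite addr_eq0 => /eqP/(congr1 ( *%R (cube_sign K j (j |: F)))).
  rewrite mulrA cube_signK mul1r => ->; rewrite mulrN mulr_sumr -sumrN.
  apply: eq_big => [k|k]; rewrite !inE.
    by have [->|_] := eqVneq k j; rewrite ?(negPf jF) ?andbT.
  move=> /andP[+ kj]; rewrite (negPf kj) /= => kF.
  rewrite !mxE tE !inE (negPf jF) andbF !mulrA -mulNr; congr (_ * _); last first.
    congr (s _ 0 i); apply/setP => x; rewrite !inE.
    by case: (eqVneq x j) => // ->; rewrite eq_sym kj.
  rewrite /cube_sign.
  have jk : (j < k)%N || (k < j)%N by rewrite -neq_ltn eq_sym; exact: kj.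
  have -> : [set x in j |: F :\ k | (x < j)%N] = [set x in j |: F | (x < j)%N] :\ k.
    apply/setP => x; rewrite !inE; case: (eqVneq x j) => [->|_] /=; first by rewrite ltnn andbF.
    by rewrite andbA.
  have -> : #|[set x in j |: F | (x < k)%N]| = ((j < k) + #|[set x in F | (x < k)%N]|)%N.
    rewrite (cardsD1 j) !inE eqxx /=; congr (_ + _)%N; apply: eq_card => x; rewrite !inE.
    by case: (eqVneq x j) => // ->; rewrite (negPf jF).
  have -> : #|[set x in j |: F | (x < j)%N]| = ((k < j) + #|[set x in j |: F | (x < j)%N] :\ k|)%N.
    by rewrite (cardsD1 k) !inE (negPf kj) kF.
  rewrite !exprD; set x := _ ^+ #|_|; set y := _ ^+ #|_|.
  case: ltngtP jk => //= _ _; rewrite ?expr0 ?expr1; ring.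
split=> F.
  apply/unit_cubeE; case: ifP => [_|/negbT/forallPn[k]].
    apply/free_modP => i; rewrite ffunE mxE.
    case: (pselect (exists F, s F 0 i != 0)) => [/jjP[j ji lj]|si]; last first.
      have {}si F' : s F' 0 i = 0 by apply/eqP/negPn/negP => h; apply: si; exists F'.
      by case: (jj i) => [j|]; rewrite ?eqxx // si mulr0 if_same eqxx.
    rewrite ji; case: ifP => jF; rewrite ?eqxx // mulf_eq0 negb_or => /andP[_ /out[_ /mnm_lepP le]].
    apply/mnm_lepP => k; have := le k; rewrite !mnmE !inE; have [->|_//] := eqVneq k j.
    by move=> _; rewrite jF addn0 -ltnS prednK //; apply: leq_ltn_trans lj.
  rewrite negb_or => /andP[ck kF]; apply/rowP => i; rewrite ffunE !mxE.
  case: (pselect (exists F, s F 0 i != 0)) => [/jjP[j ji lj]|si]; last first.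
    have {}si F' : s F' 0 i = 0 by apply/eqP/negPn/negP => h; apply: si; exists F'.
    by case: (jj i) => [j|]; rewrite // si mulr0 if_same.
  rewrite ji; case: ifP => jF //; apply/eqP; rewrite mulf_eq0; apply/orP; right.
  apply/negPn/negP => /out[/(_ k)[|]]; first by rewrite (negPf ck).
  rewrite !inE (negPf kF) orbF => /eqP E; move: ck; rewrite E -leqNgt leqn0 => /eqP cj.
  by rewrite cj in lj.
apply: contra_neq_eq => Fp; apply/rowP => i; rewrite ffunE !mxE.
case: (jj i) => // j; case: ifP => // jF; suff -> : s (j |: F) = 0 by rewrite mxE mulr0.
by apply/eqP; apply: contra_neqT Fp => /sp <-; rewrite cardsU1 jF.
Qed.

End FreeModules.

(** * Minimal generators, syzygies and dimension shifting *)

Section Syzygies.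
Variables (K : fieldType) (n d : nat) (N : 'X_{1..n} -> 'M[K]_d) (B : 'X_{1..n}).
Implicit Types (a b c : 'X_{1..n}).

Definition mnm_min a b : 'X_{1..n} := [multinom minn (a i) (b i) | i < n].
(** Every element already occurs in a degree below B, so minimal generators live in the finite set
    of degrees below B. *)
Definition bounded_mod e (M : 'X_{1..n} -> 'M[K]_e) :=
  forall a, (M a <= M (mnm_min a B))%MS.

Hypotheses (Nmono : mono_mod N) (Nbd : bounded_mod N).

(** A complement in N a of what comes from smaller degrees. Bases of these complements, taken over
    all a of total degree at most [mdeg B], form a minimal system of generators. *)
Definition new_mod a : 'M[K]_d := (N a :\: below_mod N a)%MS.
Definition gen_idx : finType := {a : 'X_{1..n < (mdeg B).+1} & 'I_(\rank (new_mod a))}.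
Definition gen_rk := #|gen_idx|.
Definition gen_lab (r : 'I_gen_rk) : 'X_{1..n} :=
  bmnm (tag (enum_val r : gen_idx)).
Definition gen_mx : 'M[K]_(gen_rk, d) :=
  \matrix_r row (tagged (enum_val r : gen_idx)) (row_base (new_mod (tag (enum_val r : gen_idx)))).
Definition syz a : 'M[K]_gen_rk := (kermx gen_mx :&: free_mod K gen_lab a)%MS.

Lemma lem_sub1P a b : (a <= b)%MM -> a != b ->
  exists2 j, (0 < b j)%N & (a <= b - U_(j))%MM.
Proof.
move=> /mnm_lepP ab; apply: contra_neqP => h; apply/mnmP => j.
apply/eqP; rewrite eqn_leq ab /= leqNgt; apply/negP => aj.
apply: h; exists j; first exact: leq_ltn_trans aj.
apply/mnm_lepP => i; rewrite mnmBE mnm1E; have [<-|_] := eqVneq; last by rewrite subn0.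
by rewrite subn1 -ltnS prednK //; apply: leq_ltn_trans aj.
Qed.

Lemma below_modP a b : (a <= b)%MM -> a != b -> (N a <= below_mod N b)%MS.
Proof.
move=> ab ne; have [j bj abj] := lem_sub1P ab ne.
by apply: submx_trans (Nmono abj) _; rewrite /below_mod (sumsmx_sup j).
Qed.

Lemma mod_split a : (N a <= new_mod a + below_mod N a)%MS.
Proof.
rewrite -(addsmx_diff_cap_eq (N a) (below_mod N a)) addsmxS //; exact: capmxSr.
Qed.

Lemma new_mod_bound a : (0 < \rank (new_mod a))%N -> (a <= B)%MM.
Proof.
move=> r0; apply/mnm_lepP => j; rewrite leqNgt; apply/negP => Baj.
have Nb : (N a <= below_mod N a)%MS.
  apply: submx_trans (Nbd a) _; apply: below_modP.
    by apply/mnm_lepP => i; rewrite mnmE geq_minl.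
  apply/eqP => /mnmP/(_ j); rewrite mnmE => /minn_idPl; rewrite leqNgt Baj //.
move: r0; rewrite lt0n mxrank_eq0 => /eqP[].
apply/eqP; rewrite -submx0 -(capmx_diff (N a) (below_mod N a)) sub_capmx submx_refl.
by apply: submx_trans Nb; apply: diffmxSl.
Qed.

Lemma gen_row_mod r : (row r gen_mx <= N (gen_lab r))%MS.
Proof.
rewrite rowK; apply: submx_trans (row_sub _ _) _.
by rewrite eq_row_base; apply: diffmxSl.
Qed.

Lemma gen_lab_bound r : (gen_lab r <= B)%MM.
Proof.
by apply: new_mod_bound; case: (tagged (enum_val r)) => m /(leq_ltn_trans _); apply.
Qed.

Lemma free_image a (x : 'rV[K]_gen_rk) :
  (x <= free_mod K gen_lab a)%MS -> (x *m gen_mx <= N a)%MS.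
Proof.
move=> /free_modP xa; rewrite mulmx_sum_row; apply: summx_sub => r _.
have [->|/xa ra] := eqVneq (x 0 r) 0; first by rewrite scale0r sub0mx.
by apply/scalemx_sub/(submx_trans (gen_row_mod r))/Nmono.
Qed.

(** Graded Nakayama lemma, by induction on the total degree. *)
Lemma gen_surj a (v : 'rV[K]_d) : (v <= N a)%MS ->
  exists2 x, (x <= free_mod K gen_lab a)%MS & v = x *m gen_mx.
Proof.
have [m] := ubnP (mdeg a); elim: m => // m IH in a v *; rewrite ltnS => am va.
have /sub_addsmxP[[u w] /= Ev] := submx_trans va (mod_split a).
have [x xa Ex] : exists2 x, (x <= free_mod K gen_lab a)%MS & u *m new_mod a = x *m gen_mx.
  have [r0|] := posnP (\rank (new_mod a)).
    have /eqP-> : new_mod a == 0 by rewrite -mxrank_eq0 r0.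
    by exists 0; rewrite ?sub0mx // mulmx0 mul0mx.
  move=> /new_mod_bound aB.
  have aB' : (mdeg a < (mdeg B).+1)%N.
    by rewrite ltnS !mdegE; apply: leq_sum => i _; apply/mnm_lepP.
  have : (u *m new_mod a <= row_base (new_mod a))%MS by rewrite eq_row_base submxMl.
  move=> /submxP[y ->].
  pose ab : 'X_{1..n < (mdeg B).+1} := BMultinom aB'.
  pose g (i : 'I_(\rank (new_mod ab))) : 'I_gen_rk := enum_rank (Tagged (fun a : 'X_{1..n < (mdeg B).+1} => 'I_(\rank (new_mod a))) i).
  exists (\sum_i y 0 i *: delta_mx 0 (g i)).
    apply: summx_sub => i _; apply: scalemx_sub; apply/free_modP => r.
    rewrite mxE eqxx /=; have [->|] := eqVneq r (g i); last by rewrite eqxx.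
    by move=> _; rewrite /gen_lab enum_rankK; apply: lepm_refl.
  rewrite mulmx_suml mulmx_sum_row; apply: eq_bigr => i _.
  rewrite -scalemxAl -rowE rowK; congr (_ *: _).
  by rewrite /g enum_rankK.
have : (w *m below_mod N a <= below_mod N a)%MS by apply: submxMl.
move=> /sub_sumsmxP[z Ez].
have zP j : exists xj, (0 < a j)%N -> (xj <= free_mod K gen_lab a)%MS /\
    z j *m N (a - U_(j))%MM = xj *m gen_mx.
  have [aj0|aj] := posnP (a j); first by exists 0.
  have [|xj h1 h2] := IH (a - U_(j))%MM (z j *m N (a - U_(j))%MM) _ (submxMl _ _).
    have Ea : (a - U_(j) + U_(j))%MM = a by rewrite submK // lep1mP -lt0n.
    by apply: leq_trans am; rewrite -[in X in (_ < X)%N]Ea mdegD mdeg1 addn1.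
  exists xj => _; split => //; apply: submx_trans h1 _; apply: free_mod_mono.
  exact: lem_subr.
have [xs xsP] := choice zP.
exists (x + \sum_(j < n | (0 < a j)%N) xs j).
  by rewrite addmx_sub //; apply: summx_sub => j /xsP[].
rewrite mulmxDl Ev Ex Ez mulmx_suml; congr (_ + _).
by apply: eq_bigr => j /xsP[].
Qed.

(** The generators of degree c are a basis of a complement of [below_mod N c], and all other terms
    of the relation lie in [below_mod N c]. This is the source of the minimality of the
    resolution. *)
Lemma gen_minimal c (x : 'rV[K]_gen_rk) : (x <= free_mod K gen_lab c)%MS ->
  x *m gen_mx = 0 -> forall r, gen_lab r = c -> x 0 r = 0.
Proof.
move=> /free_modP xc x0 r Er.
pose cb := tag (enum_val r); have Ecb : bmnm cb = c by [].
pose T (a : 'X_{1..n < (mdeg B).+1}) := 'I_(\rank (new_mod a)).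
pose y : 'rV[K]_(\rank (new_mod cb)) := \row_i x 0 (enum_rank (Tagged T i)).
have Ey : y *m row_base (new_mod cb) = \sum_(r' | gen_lab r' == c) x 0 r' *: row r' gen_mx.
  rewrite (reindex_onto (@enum_rank gen_idx) enum_val) => [|? _]; last exact: enum_valK.
  rewrite mulmx_sum_row.
  pose G (a : 'X_{1..n < (mdeg B).+1}) (i : T a) := x 0 (enum_rank (Tagged T i)) *: row i (row_base (new_mod a)).
  transitivity (\sum_(a | a == cb) \sum_(i : T a) G a i).
    by rewrite big_pred1_eq; apply: eq_bigr => i _; rewrite mxE.
  rewrite sig_big_dep /=; apply: eq_big => [p|[a i] _].
    by rewrite /gen_lab enum_rankK eqxx !andbT -Ecb.
  by rewrite rowK /G enum_rankK.
have y0 : y *m row_base (new_mod cb) = 0.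
  apply/eqP; rewrite -submx0 -(capmx_diff (N c) (below_mod N c)) sub_capmx.
  apply/andP; split.
    by rewrite (submx_trans (submxMl _ _)) // eq_row_base Ecb.
  move: x0; rewrite Ey mulmx_sum_row (bigID (fun r' => gen_lab r' == c)) /=.
  move/eqP; rewrite addr_eq0 => /eqP->; rewrite -scaleN1r scalemx_sub //.
  apply: summx_sub => r' ne; have [->|/xc le] := eqVneq (x 0 r') 0.
    by rewrite scale0r sub0mx.
  exact/scalemx_sub/(submx_trans (gen_row_mod r'))/below_modP.
have {}y0 : y = 0.
  by apply: (row_free_inj (row_base_free _)); rewrite y0 mul0mx.
have := congr1 (fun m : 'rV_ _ => m 0 (tagged (enum_val r))) y0.
have eta (u : gen_idx) : Tagged T (tagged u) = u by case: u.
by rewrite !mxE (eta (enum_val r)) enum_valK.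
Qed.

Lemma syz_mono : mono_mod syz.
Proof. by move=> a b ab; apply: capmxS => //; apply: free_mod_mono. Qed.

(** The labels of the generators lie below B, so the free module does not change when a degree is
    cut off at B. One and the same B thus serves the whole resolution. *)
Lemma syz_bounded : bounded_mod syz.
Proof.
move=> a; apply: capmxS => //; apply/row_subP => k; apply/free_modP => r hr.
have /free_modP/(_ r hr)/mnm_lepP ra := row_sub k (free_mod K gen_lab a).
apply/mnm_lepP => i; rewrite mnmE leq_min ra /=.
by have /mnm_lepP := gen_lab_bound r.
Qed.

Lemma gen_lab_top c :
  (exists r, gen_lab r = c) <-> ~ cube_exact (unit_cube N c) n.
Proof.
rewrite unit_cube_exact_top //; split=> [[r <-]|/negP nb].
  move=> Nb; have r0 : (0 < \rank (new_mod (gen_lab r)))%N.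
    by rewrite /gen_lab; case: (tagged (enum_val r)) => m; apply: leq_ltn_trans.
  move: r0; rewrite lt0n mxrank_eq0 => /eqP[].
  apply/eqP; rewrite -submx0 -(capmx_diff (N (gen_lab r)) (below_mod N (gen_lab r))).
  by rewrite sub_capmx submx_refl; apply: submx_trans Nb; apply: diffmxSl.
have r0 : (0 < \rank (new_mod c))%N.
  rewrite lt0n mxrank_eq0; apply: contra nb => /eqP E.
  by apply: submx_trans (mod_split c) _; rewrite E adds0mx.
have cB := new_mod_bound r0.
have cB' : (mdeg c < (mdeg B).+1)%N.
  by rewrite ltnS !mdegE; apply: leq_sum => i _; apply/mnm_lepP.
pose cb : 'X_{1..n < (mdeg B).+1} := BMultinom cB'.
exists (enum_rank (Tagged (fun a : 'X_{1..n < (mdeg B).+1} => 'I_(\rank (new_mod a))) (Ordinal r0 : 'I_(\rank (new_mod cb))))).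
by rewrite /gen_lab enum_rankK.
Qed.

Definition chain_mulmx e e' (A : 'M[K]_(e, e')) (s : {ffun {set 'I_n} -> 'rV[K]_e}) :
  {ffun {set 'I_n} -> 'rV[K]_e'} := [ffun F => s F *m A].

Lemma cube_diff_mulmx e e' (A : 'M[K]_(e, e')) s :
  cube_diff (chain_mulmx A s) = chain_mulmx A (cube_diff s).
Proof.
apply/ffunP => F; rewrite !ffunE mulmx_suml; apply: eq_bigr => j _.
by rewrite ffunE scalemxAl.
Qed.

Lemma unit_cube_syz c F v :
  unit_cube syz c F v <-> unit_cube (free_mod K gen_lab) c F v /\ v *m gen_mx = 0.
Proof.
rewrite !unit_cubeE; case: ifP => _.
  rewrite sub_capmx; split=> [/andP[/sub_kermxP]|[-> /sub_kermxP->]] //.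
by split=> [->|[]//]; rewrite mul0mx.
Qed.

Lemma unit_cube_image c F v :
  unit_cube (free_mod K gen_lab) c F v -> unit_cube N c F (v *m gen_mx).
Proof.
by rewrite !unit_cubeE; case: ifP => _; [apply: free_image | move->; rewrite mul0mx].
Qed.

Lemma chain_lift c s : chain_in (unit_cube N c) s ->
  exists t, [/\ chain_in (unit_cube (free_mod K gen_lab) c) t, chain_mulmx gen_mx t = s
    & forall F, t F != 0 -> s F != 0].
Proof.
move=> sP.
have ex F : exists x, [/\ unit_cube (free_mod K gen_lab) c F x, x *m gen_mx = s F
    & x != 0 -> s F != 0].
  have [s0|s0] := eqVneq (s F) 0.
    exists 0; rewrite mul0mx s0 eqxx; split=> //.
    by case: (unit_cube_family c (@free_mod_mono K _ _ gen_lab)) => + _ => /(_ F)[].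
  have := sP F; rewrite unit_cubeE; case: ifP => [h|_ E]; last by rewrite E eqxx in s0.
  by move=> /gen_surj[x xF Ex]; exists x; split; rewrite ?unit_cubeE ?h.
have [f fP] := choice ex; exists [ffun F => f F]; split=> [F||F].
- by rewrite ffunE; case: (fP F).
- by apply/ffunP => F; rewrite !ffunE; case: (fP F).
- by rewrite ffunE; case: (fP F).
Qed.

Let free_fam c := unit_cube_family c (@free_mod_mono K _ _ gen_lab).

(** The connecting map of 0 -> syz -> free -> N -> 0, the free module being exact below degree n.
    For p + 1 = n it is not; there [gen_minimal] shows that a syzygy of degree c has no component at
    generators of degree c, hence is a boundary in the free module. *)
Lemma syz_exact_shift c p : (p < n)%N ->
  cube_exact (unit_cube syz c) p.+1 <-> cube_exact (unit_cube N c) p.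
Proof.
move=> pn; split=> ex s sP sp s0.
  have [t [tP Et ts]] := chain_lift sP.
  have tdeg : chain_deg p t by move=> F /ts/sp.
  have [|||u [uP up] Eu] := ex (cube_diff t).
  - move=> F; apply/unit_cube_syz; split; first exact: cube_diff_in.
    have := cube_diff_mulmx gen_mx t; rewrite Et s0 => /ffunP/(_ F).
    by rewrite [LHS]ffunE [RHS]ffunE.
  - by apply: cube_diff_deg => F /tdeg->.
  - exact: cube_diffK.
  have [|||r [rP rp] Er] := free_mod_exact (lab := gen_lab) (c := c) pn (s := t - u).
  - move=> F; rewrite !ffunE; apply: (subspB ((free_fam c).1 F) (tP F)).
    by have /unit_cube_syz[] := uP F.
  - move=> F; rewrite !ffunE; have [->|/tdeg//] := eqVneq (t F) 0.
    by rewrite sub0r oppr_eq0 => /up[].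
  - by rewrite linearB /= Eu subrr.
  exists (chain_mulmx gen_mx r).
    split=> F; rewrite ffunE; first exact: unit_cube_image.
    by move=> h; apply: rp; apply: contra_neq h => ->; rewrite mul0mx.
  rewrite cube_diff_mulmx -Er -Et; apply/ffunP => F; rewrite !ffunE mulmxBl.
  by have /unit_cube_syz[_ ->] := uP F; rewrite subr0.
have sP' : chain_in (unit_cube (free_mod K gen_lab) c) s.
  by move=> F; have /unit_cube_syz[] := sP F.
have [r [rP rp] Er] : exists2 r, chain_in (unit_cube (free_mod K gen_lab) c) r /\
    (forall F, r F != 0 -> #|F|.+1 = p.+1) & s = cube_diff r.
  have [pn'|] := ltnP p.+1 n; first exact: free_mod_exact.
  rewrite leq_eqVlt ltnNge pn orbF => /eqP En; rewrite -En in sp *.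
  apply: unit_cube_boundary_top => //; first exact: free_mod_mono.
  have /unit_cube_syz[] := sP setT; rewrite unit_cubeE cube_expT.
  case: ifP => [_|_ ->]; last by rewrite sub0mx.
  move=> sc /(gen_minimal sc) sm; rewrite [s setT]row_sum_delta.
  apply: summx_sub => i _; have [->|si] := eqVneq (s setT 0 i) 0.
    by rewrite scale0r sub0mx.
  apply: scalemx_sub; move/free_modP: sc => /(_ i si) le.
  have [|j cj lej] := lem_sub1P le; first by apply: contra_neq si; apply: sm.
  rewrite /below_mod (sumsmx_sup j) //; apply/free_modP => k.
  by rewrite mxE eqxx; have [->|] := eqVneq k i; rewrite ?eqxx.
have [|||t [tP tp] Et] := ex (chain_mulmx gen_mx r).
- by move=> F; rewrite ffunE; apply: unit_cube_image.
- move=> F; rewrite ffunE => h.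
  have rF : r F != 0 by apply: contra_neq h => ->; rewrite mul0mx.
  by have [] := rp F rF.
- rewrite cube_diff_mulmx -Er; apply/ffunP => F; rewrite !ffunE.
  by have /unit_cube_syz[] := sP F.
have [u [uP Eu ut]] := chain_lift tP.
exists (r - cube_diff u); last by rewrite linearB /= cube_diffK subr0.
split=> F.
  apply/unit_cube_syz; split.
    by rewrite !ffunE; apply: (subspB ((free_fam c).1 F) (rP F)); have := cube_diff_in (free_fam c) uP F; rewrite ffunE.
  have := cube_diff_mulmx gen_mx u; rewrite Eu -Et => /ffunP/(_ F).
  by rewrite [LHS]ffunE [RHS]ffunE !ffunE mulmxBl => ->; rewrite subrr.
rewrite ffunE [X in _ + X]ffunE; have [->|/rp//] := eqVneq (r F) 0.
rewrite sub0r oppr_eq0 => h; congr _.+1.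
by apply: (cube_diff_deg (t := u)) h => G /ut/tp.
Qed.

Lemma syz_exact0 c : (0 < n)%N -> cube_exact (unit_cube syz c) 0.
Proof.
move=> n0 s sP sp s0; have [|t [_ tp] ->] := free_mod_exact (lab := gen_lab) (c := c) n0 _ sp s0.
  by move=> F; have /unit_cube_syz[] := sP F.
exists 0; last by congr cube_diff; apply/ffunP => F; rewrite [RHS]ffunE; apply/eqP/negPn/negP => /tp.
split=> F; rewrite ffunE ?eqxx //.
by case: (unit_cube_family c syz_mono) => + _ => /(_ F)[].
Qed.

End Syzygies.

(* Imported only here: its [set0], [setT] and [[set x | P]] mask those of finset. *)
From mathcomp Require Import finmap classical_sets cardinality.
From mathcomp Require Import generic_quotient ring_quotient.
Local Open Scope quotient_scope.
Local Open Scope classical_set_scope.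
Local Open Scope ring_scope.

(** * Comparison of two minimal graded resolutions *)

Section Comparison.
Variables (K : fieldType) (n : nat).
Local Notation S := {mpoly K[n]}.

Definition homog_part (k : int) (p : S) : S :=
  if k is Posz m then pihomog mdeg m p else 0.

Lemma homog_part_is_additive k : additive (homog_part k).
Proof. by move=> p q; case: k => m /=; rewrite ?raddfB //= subrr. Qed.

HB.instance Definition _ k :=
  GRing.isAdditive.Build S S (homog_part k) (homog_part_is_additive k).

Lemma homog_partZX k c a :
  homog_part k (c *: 'X_[a]) = if k == (mdeg a)%:Z then c *: 'X_[a] else 0.
Proof.
case: k => m //=; rewrite linearZ /= pihomogX eq_sym.
by rewrite (inj_eq (can_inj absz_nat)); case: eqP; rewrite ?scaler0.
Qed.

Lemma homog_partP k p a : a \in msupp (homog_part k p) -> (mdeg a)%:Z = k.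
Proof.
case: k => m /=; last by rewrite msupp0.
by have /dhomogP := pihomogP [measure of mdeg] m p; move=> /(_ a) h /h ->.
Qed.

Lemma homog_partM k e p q : (forall a, a \in msupp q -> (mdeg a)%:Z = e) ->
  homog_part k (p * q) = homog_part (k - e) p * q.
Proof.
move=> qe; rewrite [in LHS](mpolyE q) [in LHS](mpolyE p) mulr_suml (raddf_sum (homog_part k)).
rewrite [in RHS](mpolyE p) (raddf_sum (homog_part (k - e))) mulr_suml; apply: eq_bigr => a _.
rewrite mulr_sumr (raddf_sum (homog_part k)) [in RHS](mpolyE q) mulr_sumr.
rewrite big_seq [RHS]big_seq; apply: eq_bigr => b /qe be.
rewrite /= -scalerAl -scalerAr -mpolyXD scalerA !homog_partZX mdegD PoszD be.
rewrite subr_eq; case: eqP => _; rewrite ?mul0r //.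
by rewrite -scalerAl -scalerAr -mpolyXD scalerA.
Qed.

Lemma homog_part_id k p : (forall a, a \in msupp p -> (mdeg a)%:Z = k) ->
  homog_part k p = p.
Proof.
move=> pk; rewrite [in LHS](mpolyE p) [RHS]mpolyE (raddf_sum (homog_part k)) big_seq [RHS]big_seq.
by apply: eq_bigr => a /pk ak /=; rewrite homog_partZX ak eqxx.
Qed.

Lemma max_idealP (f : S) : max_ideal f <-> f@_0%MM = 0.
Proof.
split=> [|f0].
  have : @max_ideal K n `<=` [set f : S | f@_0%MM = 0] => [|/[apply]//].
  apply: ideal_gen_sub.
    split=> [|g h /= g0 h0|g h /= h0]; first exact: mcoeff0.
      by rewrite mcoeffD g0 h0 addr0.
    by rewrite rmorphM /= h0 mulr0.
  by move=> _ [i _ <-] /=; rewrite mcoeffX mnm1_eq0.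
have [I0 ID IM] := ideal_gen_ideal (range (fun i : 'I_n => 'X_i : S)).
rewrite [f]mpolyE big_seq; apply: (big_ind (@max_ideal K n)) => // a af.
have : mdeg a != 0%N.
  by rewrite mdeg_eq0; apply: contraTneq af => ->; rewrite mcoeff_msupp f0 eqxx.
rewrite mdegE sum_nat_eq0 => /forallPn[i] /=.
move=> ai; have Ea : (a - U_(i) + U_(i))%MM = a by rewrite submK // lep1mP.
rewrite -Ea mpolyXD scalerAl; apply: IM; apply: sub_ideal_gen; exists i => //.
Qed.

Definition graded_mx p q (e : 'I_p -> int) (e' : 'I_q -> int) (A : 'M[S]_(p, q)) :=
  forall r s a, a \in msupp (A r s) -> (mdeg a)%:Z + e' s = e r.

(** In an arbitrary lift each entry may be replaced by its homogeneous part of the required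
    degree. *)
Lemma graded_lift p q q' (e : 'I_p -> int) (e1 : 'I_q -> int) (e2 : 'I_q' -> int)
    (U : 'M[S]_(p, q)) (D : 'M[S]_(q', q)) :
  graded_mx e e1 U -> graded_mx e2 e1 D -> (forall r, exists w, row r U = w *m D) ->
  exists2 W : 'M[S]_(p, q'), graded_mx e e2 W & U = W *m D.
Proof.
move=> Ug Dg /choice[w wP].
exists (\matrix_(r, s) homog_part (e r - e2 s) (w r 0 s)).
  by move=> r s a; rewrite mxE => /homog_partP->; rewrite subrK.
apply/matrixP => r s; have := congr1 (fun M : 'rV_ _ => homog_part (e r - e1 s) (M 0 s)) (wP r).
rewrite mxE homog_part_id => [|a /Ug <-]; last by rewrite addrK.
move=> ->; rewrite !mxE (raddf_sum (homog_part _)); apply: eq_bigr => t _; rewrite mxE.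
rewrite /= (@homog_partM _ (e2 t - e1 s)); last by move=> a /Dg <-; rewrite addrK.
by congr (homog_part _ _ * _); rewrite opprB addrA subrK.
Qed.

Lemma rows_lift p q q' (U : 'M[S]_(p, q)) (D : 'M[S]_(q', q)) :
  (forall r, exists w, row r U = w *m D) -> exists W : 'M[S]_(p, q'), U = W *m D.
Proof.
move=> /choice[w wP]; exists (\matrix_r w r); apply/row_matrixP => r.
by rewrite row_mul rowK.
Qed.

Definition const0 p q (A : 'M[S]_(p, q)) := forall r s, (A r s)@_0%MM = 0.

Lemma const0_mull p q q' (A : 'M[S]_(p, q)) (D : 'M[S]_(q, q')) : const0 D -> const0 (A *m D).
Proof.
move=> D0 r s; rewrite mxE raddf_sum big1 // => t _.
by rewrite /= rmorphM /= D0 mulr0.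
Qed.

Lemma const0_mulr p q q' (D : 'M[S]_(p, q)) (A : 'M[S]_(q, q')) : const0 D -> const0 (D *m A).
Proof.
move=> D0 r s; rewrite mxE raddf_sum big1 // => t _.
by rewrite /= rmorphM /= D0 mul0r.
Qed.

Lemma const0D p q (A D : 'M[S]_(p, q)) : const0 A -> const0 D -> const0 (A + D).
Proof. by move=> A0 D0 r s; rewrite mxE mcoeffD A0 D0 addr0. Qed.

Variables (I : set S) (F F' : min_free_resolution I).

Lemma diff_const0 (G : min_free_resolution I) i : const0 (diff G i).
Proof. by move=> r s; apply/max_idealP; apply: diff_minimal. Qed.

Lemma diffK (G : min_free_resolution I) i : diff G i.+1 *m diff G i = 0.
Proof.
apply/row_matrixP => r; rewrite row_mul row0; apply/diff_exact.
by exists (delta_mx 0 r); rewrite rowE.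
Qed.

Lemma diff0_aug (G : min_free_resolution I) : diff G 0 *m aug G = 0.
Proof.
apply/row_matrixP => r; rewrite row_mul row0; apply/aug_exact.
by exists (delta_mx 0 r); rewrite rowE.
Qed.

Lemma aug_lift (G G' : min_free_resolution I) :
  exists2 W, graded_mx (@deg _ _ _ G 0) (@deg _ _ _ G' 0) W & aug G = W *m aug G'.
Proof.
apply: (@graded_lift _ 1 _ (@deg _ _ _ G 0) (fun=> 0) (@deg _ _ _ G' 0)) => [r s a|r s a|r].
- by rewrite (ord1 s) => /aug_graded; rewrite addr0.
- by rewrite (ord1 s) => /aug_graded; rewrite addr0.
have : I (aug G r 0).
  by apply/(aug_image G); exists (delta_mx 0 r); rewrite -rowE mxE.
move=> /(aug_image G')[v Ev]; exists v; apply/rowP => s; rewrite (ord1 s) -Ev.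
by rewrite mxE.
Qed.

(* Comparison of two minimal resolutions: [p] and [q] are the degree [i] parts of
   chain maps between them, [h] that of a homotopy from the composite to 1. *)
Lemma resolution_compare i : exists (p : 'M[S]_(rk F i, rk F' i))
    (q : 'M[S]_(rk F' i, rk F i)) (h : 'M[S]_(rk F i, rk F i.+1)),
  [/\ graded_mx (@deg _ _ _ F i) (@deg _ _ _ F' i) p,
      forall r, exists w, row r (diff F i *m p) = w *m diff F' i,
      forall r, exists w, row r (diff F' i *m q) = w *m diff F i,
      diff F i *m (p *m q - 1%:M - h *m diff F i) = 0
    & const0 (p *m q - 1%:M)].
Proof.
elim: i => [|i [p [q [h [pg pl ql ph pq]]]]].
  have [p pg Ep] := aug_lift F F'; have [q _ Eq] := aug_lift F' F.
  have [h Eh] : exists h, p *m q - 1%:M = h *m diff F 0.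
    apply: rows_lift => r; apply/aug_exact.
    by rewrite -row_mul mulmxBl -mulmxA -Eq -Ep mul1mx subrr row0.
  exists p, q, h; split=> // [r|r||].
  - by apply/aug_exact; rewrite -row_mul -mulmxA -Ep diff0_aug row0.
  - by apply/aug_exact; rewrite -row_mul -mulmxA -Eq diff0_aug row0.
  - by rewrite Eh subrr mulmx0.
  - by rewrite Eh; apply/const0_mull/diff_const0.
have [|p' pg' Ep] := graded_lift (e := @deg _ _ _ F i.+1) _ (@diff_graded _ _ _ F' i) pl.
  move=> r s a; rewrite mxE => /msupp_sum_le/flatten_mapP[t _ /msuppM_le/allpairsP[[b c] /=]].
  by move=> [/diff_graded Eb /pg Ec ->]; rewrite mdegD PoszD -addrA Ec.
have [q' Eq] := rows_lift ql.
have [h' Eh] : exists h', p' *m q' - 1%:M - diff F i *m h = h' *m diff F i.+1.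
  apply: rows_lift => r; apply/diff_exact.
  suff E : (p' *m q' - 1%:M - diff F i *m h) *m diff F i = 0 by rewrite -row_mul E row0.
  rewrite -[RHS]ph !mulmxBr mulmx1 !mulmxBl mul1mx -[p' *m q' *m _]mulmxA -Eq.
  by rewrite mulmxA -Ep !mulmxA.
have Epq : p' *m q' - 1%:M = diff F i *m h + h' *m diff F i.+1 by rewrite -Eh [RHS]addrC subrK.
exists p', q', h'; split=> // [r|r||].
- by apply/diff_exact; rewrite -row_mul -mulmxA -Ep mulmxA diffK mul0mx row0.
- by apply/diff_exact; rewrite -row_mul -mulmxA -Eq mulmxA diffK mul0mx row0.
- by rewrite Epq addrK mulmxA diffK mul0mx.
- rewrite Epq; apply: const0D; first exact/const0_mulr/diff_const0.
  exact/const0_mull/diff_const0.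
Qed.

Lemma resolution_deg i (r : 'I_(rk F i)) : exists r' : 'I_(rk F' i), deg r' = deg r.
Proof.
have [p [q [_ [pg _ _ _ pq]]]] := resolution_compare i.
apply/not_existsP => nr; have := pq r r.
rewrite !mxE eqxx mulr1n mcoeffB mcoeff1 eqxx raddf_sum big1.
  by move/eqP; rewrite sub0r oppr_eq0 oner_eq0.
move=> s _ /=; rewrite rmorphM /=; have [->|] := eqVneq (p r s)@_0%MM 0; first exact: mul0r.
by rewrite -mcoeff_msupp => /pg; rewrite mdeg0 add0r => /nr.
Qed.

End Comparison.

(** * Multidegree components and exactness over the polynomial ring *)

Section Strands.
Variables (K : fieldType) (n : nat).
Local Notation S := {mpoly K[n]}.
Implicit Types (a b c : 'X_{1..n}).

(** The component of multidegree a of a vector in the sum of the S(- lab s). *)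
Definition strand p (lab : 'I_p -> 'X_{1..n}) a (v : 'rV[S]_p) : 'rV[K]_p :=
  \row_s (if (lab s <= a)%MM then (v 0 s)@_(a - lab s)%MM else 0).

Definition monomial_mx p q (lab : 'I_p -> 'X_{1..n}) (lab' : 'I_q -> 'X_{1..n})
    (A : 'M[K]_(p, q)) : 'M[S]_(p, q) :=
  \matrix_(r, s) (A r s *: 'X_[(lab r - lab' s)%MM]).

Lemma strand_free p (lab : 'I_p -> 'X_{1..n}) a v : (strand lab a v <= free_mod K lab a)%MS.
Proof. by apply/free_modP => i; rewrite mxE; case: ifP => //; rewrite eqxx. Qed.

Lemma strand_inj p (lab : 'I_p -> 'X_{1..n}) v w :
  (forall a, strand lab a v = strand lab a w) -> v = w.
Proof.
move=> h; apply/rowP => s; apply/mpolyP => b.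
have := congr1 (fun x : 'rV_ _ => x 0 s) (h (lab s + b)%MM).
by rewrite !mxE lem_addr addmC addmK.
Qed.

Lemma strand0 p (lab : 'I_p -> 'X_{1..n}) a : strand lab a 0 = 0.
Proof. by apply/rowP => s; rewrite !mxE mcoeff0 if_same. Qed.

Lemma mcoeffMX_if (f : S) c a : (f * 'X_[c])@_a = if (c <= a)%MM then f@_(a - c)%MM else 0.
Proof.
case: ifPn => ca; first by rewrite -{1}(submK ca) addmC mcoeffMX.
apply/eqP; rewrite mcoeff_eq0; apply: contra ca.
by rewrite (perm_mem (msuppMX _ _)) => /mapP[b _ ->]; apply: lem_addr.
Qed.

Lemma strand_mul p q (lab : 'I_p -> 'X_{1..n}) (lab' : 'I_q -> 'X_{1..n})
    (A : 'M[K]_(p, q)) a v : (forall r s, A r s != 0 -> (lab' s <= lab r)%MM) ->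
  strand lab' a (v *m monomial_mx lab lab' A) = strand lab a v *m A.
Proof.
move=> Ale; apply/rowP => s; rewrite !mxE; case: ifPn => sa.
  rewrite raddf_sum; apply: eq_bigr => r _; rewrite /= !mxE.
  have [->|/Ale le] := eqVneq (A r s) 0; first by rewrite scale0r mulr0 mcoeff0 mulr0.
  rewrite -scalerAr mcoeffZ mulrC mcoeffMX_if; congr (_ * _).
  have -> : (lab r - lab' s <= a - lab' s)%MM = (lab r <= a)%MM.
    apply/mnm_lepP/mnm_lepP => h i; move/mnm_lepP: le => /(_ i) le; have := h i.
      by rewrite !mnmBE; move/mnm_lepP: sa => /(_ i) sa; rewrite leq_subLR subnKC.
    by rewrite !mnmBE => /leq_sub2r; apply.
  case: ifP => // ra; congr (_@__); apply/mnmP => i; rewrite !mnmBE.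
  by move/mnm_lepP: le => /(_ i) le; rewrite subnBA // subnK //; move/mnm_lepP: sa => /(_ i).
rewrite big1 // => r _; rewrite !mxE; have [->|/Ale le] := eqVneq (A r s) 0.
  by rewrite mulr0.
case: ifPn => ra; last by rewrite mul0r.
by case/negP: sa; apply: lepm_trans ra.
Qed.

Lemma strand_bound p (lab : 'I_p -> 'X_{1..n}) v :
  exists D, forall a, strand lab a v != 0 -> (mdeg a < D)%N.
Proof.
exists (\max_s (mdeg (lab s) + msize (v 0%R s)))%N => a /eqP; apply: contra_notT.
rewrite -leqNgt => Da; apply/rowP => s; rewrite !mxE; case: ifP => // sa.
apply/eqP; rewrite mcoeff_eq0; apply: msize_mdeg_ge.
rewrite -(leq_add2l (mdeg (lab s))) -mdegD addmC submK //; apply: leq_trans Da.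
by rewrite (bigD1 s) //= leq_maxl.
Qed.

Lemma strand_surj p (lab : 'I_p -> 'X_{1..n}) D (u : 'X_{1..n} -> 'rV[K]_p) :
  (forall a, (u a <= free_mod K lab a)%MS) -> (forall a, u a != 0 -> (mdeg a < D)%N) ->
  exists v, forall a, strand lab a v = u a.
Proof.
move=> uf uD.
exists (\row_s \sum_(a : 'X_{1..n < D} | (lab s <= a)%MM) u a 0 s *: 'X_[(a - lab s)%MM]).
move=> a; apply/rowP => s; rewrite !mxE; case: ifPn => sa; last first.
  have /free_modP/(_ s) := uf a; have [->//|_ h] := eqVneq (u a 0 s) 0.
  by rewrite h in sa.
rewrite raddf_sum /=.
rewrite (eq_bigr (fun b : 'X_{1..n < D} => u b 0 s * (bmnm b == a)%:R)); last first.
  move=> b sb; rewrite mcoeffZ mcoeffX; congr (_ * _%:R); congr nat_of_bool.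
  apply/eqP/eqP => [/(congr1 (fun x => x + lab s)%MM)|->//].
  by rewrite !submK.
have [u0|/uD aD] := eqVneq (u a) 0.
  rewrite big1 => [|b _]; first by rewrite u0 mxE.
  by case: eqP => [->|]; rewrite ?mulr0 // u0 mxE mul0r.
rewrite (bigD1 (BMultinom aD)) //= eqxx mulr1 big1 ?addr0 // => b /andP[_ ne].
by case: eqP => [E|]; rewrite ?mulr0 //; case/eqP: ne; apply: val_inj.
Qed.

End Strands.

Section Level.
Variables (K : fieldType) (n d : nat) (N : 'X_{1..n} -> 'M[K]_d) (B : 'X_{1..n}).
Local Notation S := {mpoly K[n]}.
Hypotheses (Nmono : mono_mod N) (Nbd : bounded_mod B N).

Lemma gen_mx_le (lab : 'I_d -> 'X_{1..n}) : (forall a, (N a <= free_mod K lab a)%MS) ->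
  forall (r : 'I_(gen_rk N B)) s, gen_mx N B r s != 0 -> (lab s <= gen_lab r)%MM.
Proof.
move=> Nl r s; have /free_modP/(_ s) := submx_trans (gen_row_mod r) (Nl (gen_lab r)).
by rewrite mxE.
Qed.

(** Membership in the image can be tested in each multidegree, where [gen_surj] supplies preimages;
    only finitely many are nonzero, so they assemble to a vector of polynomials. *)
Lemma level_exact (lab : 'I_d -> 'X_{1..n}) (v : 'rV[S]_d) :
  (forall a, (N a <= free_mod K lab a)%MS) ->
  (exists w, v = w *m monomial_mx (@gen_lab _ _ _ N B) lab (gen_mx N B)) <->
  (forall a, (strand lab a v <= N a)%MS).
Proof.
move=> Nl; have le := gen_mx_le Nl; split=> [[w ->] a|vN].
  by rewrite strand_mul //; apply: free_image => //; apply: strand_free.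
have ex a : exists x, [/\ (x <= free_mod K (@gen_lab _ _ _ N B) a)%MS,
    strand lab a v = x *m gen_mx N B & x != 0 -> strand lab a v != 0].
  have [->|_] := eqVneq (strand lab a v) 0.
    by exists 0; rewrite sub0mx mul0mx eqxx.
  by have [x xf xE] := gen_surj Nmono Nbd (vN a); exists x.
have [u uP] := choice ex; have [D DP] := strand_bound lab v.
have [||w wP] := strand_surj (u := u) (D := D) (lab := @gen_lab _ _ _ N B).
- by move=> a; have [] := uP a.
- by move=> a; have [_ _ h] := uP a => /h/DP.
exists w; apply: (@strand_inj _ _ _ lab) => a; rewrite strand_mul // wP.
by have [] := uP a.
Qed.

Lemma level_kernel (lab : 'I_d -> 'X_{1..n}) (v : 'rV[S]_(gen_rk N B)) :
  (forall a, (N a <= free_mod K lab a)%MS) ->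
  v *m monomial_mx (@gen_lab _ _ _ N B) lab (gen_mx N B) = 0 <->
  (forall a, (strand (@gen_lab _ _ _ N B) a v <= syz N B a)%MS).
Proof.
move=> Nl; have le := gen_mx_le Nl; split=> [v0 a|vs].
  rewrite sub_capmx strand_free andbT; apply/sub_kermxP.
  by rewrite -(strand_mul _ _ le) v0 strand0.
apply: (@strand_inj _ _ _ lab) => a; rewrite strand_mul // strand0.
by have := vs a; rewrite sub_capmx => /andP[/sub_kermxP].
Qed.

End Level.

(** * The minimal resolution of a monomial ideal and its regularity *)

Section Resolution.
Variables (K : fieldType) (n : nat) (E : pred 'X_{1..n}) (B : 'X_{1..n}).
Local Notation S := {mpoly K[n]}.
Implicit Types (a b c : 'X_{1..n}).
Hypotheses (Emono : forall a b, (a <= b)%MM -> E a -> E b)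
           (Ebd : forall a, E a -> E (mnm_min a B)).

Definition mideal : set S := [set f | forall a, a \in msupp f -> E a].

Definition mideal_mod a : 'M[K]_1 := if E a then 1%:M else 0.

Lemma mideal_mod_mono : mono_mod mideal_mod.
Proof.
move=> a b ab; rewrite /mideal_mod; case: ifP => [/(Emono ab)->|_]; first exact: submx_refl.
exact: sub0mx.
Qed.

Lemma mideal_mod_bounded : bounded_mod B mideal_mod.
Proof.
move=> a; rewrite /mideal_mod; case: ifP => [/Ebd->|_]; first exact: submx_refl.
exact: sub0mx.
Qed.

Record level := Level {
  ldim : nat; lmod : 'X_{1..n} -> 'M[K]_ldim; lfree : 'I_ldim -> 'X_{1..n};
  lmod_mono : mono_mod lmod; lmod_bounded : bounded_mod B lmod;
  lmod_free : forall a, (lmod a <= free_mod K lfree a)%MS }.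

Lemma syz_free d (N : 'X_{1..n} -> 'M[K]_d) a :
  (syz N B a <= free_mod K (@gen_lab _ _ _ N B) a)%MS.
Proof. exact: capmxSr. Qed.

Definition next_level (l : level) : level :=
  Level (@syz_mono _ _ _ (lmod l) B) (syz_bounded (lmod_mono l) (lmod_bounded l))
    (@syz_free _ (lmod l)).

Lemma mideal_mod_free a : (mideal_mod a <= free_mod K (fun _ : 'I_1 => 0%MM : 'X_{1..n}) a)%MS.
Proof.
apply/row_subP => k; apply/free_modP => i _; apply/mnm_lepP => j.
by rewrite mnm0E.
Qed.

Definition level0 : level := Level mideal_mod_mono mideal_mod_bounded mideal_mod_free.

Fixpoint lev i : level := if i is i'.+1 then next_level (lev i') else level0.

Definition res_lab i : 'I_(gen_rk (lmod (lev i)) B) -> 'X_{1..n} := @gen_lab _ _ _ _ _.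

(** Level 0 is the ideal inside a free module of rank one with label 0. Hence [res_diff 0] is the
    augmentation, and the differential i of the resolution is [res_diff i.+1]. *)
Definition res_diff i : 'M[S]_(gen_rk (lmod (lev i)) B, ldim (lev i)) :=
  monomial_mx (@res_lab i) (@lfree (lev i)) (gen_mx (lmod (lev i)) B).

Lemma res_diff_graded i r s a : a \in msupp (res_diff i r s) ->
  ((mdeg a)%:Z + (mdeg (@lfree (lev i) s))%:Z = (mdeg (res_lab r))%:Z)%R.
Proof.
rewrite mxE; have [->|A0] := eqVneq (gen_mx (lmod (lev i)) B r s) 0.
  by rewrite scale0r msupp0.
rewrite msuppMCX // inE => /eqP->; rewrite -PoszD -mdegD submK //.
exact: (gen_mx_le (@lmod_free (lev i)) A0).
Qed.

Lemma res_aug_image f : mideal f <-> exists v : 'rV_(gen_rk mideal_mod B), f = (v *m res_diff 0) 0 0.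
Proof.
have Ef : forall v : 'rV[S]_1, (forall a, strand (@lfree (lev 0)) a v <= lmod (lev 0) a)%MS <-> mideal (v 0 0).
  move=> v; split=> [h a|h a].
    rewrite mcoeff_msupp => va; have := h a; rewrite /= /mideal_mod; case: (E a) => //.
    rewrite submx0 => /eqP/(congr1 (fun x : 'rV_ _ => x 0 0)); rewrite !mxE /=.
    rewrite (_ : (0 <= a)%MM); last by apply/mnm_lepP => i; rewrite mnm0E.
    by rewrite subm0 => v0; rewrite v0 eqxx in va.
  rewrite /= /mideal_mod; case: ifPn => [_|Ea]; first exact: submx1.
  rewrite submx0; apply/eqP/rowP => i; rewrite (ord1 i) !mxE; case: ifP => // _.
  by rewrite /= subm0; apply/eqP; rewrite mcoeff_eq0; apply: contra Ea; apply: h.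
have X := level_exact (lmod_mono (lev 0)) (lmod_bounded (lev 0)) _ (@lmod_free (lev 0)).
split=> [If|[v ->]].
  have /X[w Ew] : (forall a, strand (@lfree (lev 0)) a (const_mx f : 'rV_1) <= lmod (lev 0) a)%MS.
    by apply/Ef; rewrite mxE.
  by exists w; rewrite -Ew mxE.
by apply/Ef/X; exists v.
Qed.

Lemma res_exact i (v : 'rV_(gen_rk (lmod (lev i)) B)) :
  v *m res_diff i = 0 <-> exists w, v = w *m res_diff i.+1.
Proof.
rewrite (level_kernel _ (@lmod_free (lev i))).
exact: iff_sym (level_exact (lmod_mono (lev i.+1)) (lmod_bounded (lev i.+1)) _ (@lmod_free (lev i.+1))).
Qed.

(** A nonzero constant entry would link generators of equal labels, while its row is a syzygy, which
    [gen_minimal] forbids. *)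
Lemma res_minimal i r s : max_ideal (res_diff i.+1 r s).
Proof.
apply/max_idealP; rewrite mxE mcoeffZ mcoeffX.
case: eqP => [E0|]; last by rewrite mulr0.
have [->|A0] := eqVneq (gen_mx (lmod (lev i.+1)) B r s) 0; first by rewrite mul0r.
have le := gen_mx_le (@lmod_free (lev i.+1)) A0.
have Elab : gen_lab s = res_lab r.
  by rewrite -[RHS](submK le) E0 add0m.
have rS := @gen_row_mod _ _ _ (lmod (lev i.+1)) B r.
have /andP[/sub_kermxP r0 rf] : (row r (gen_mx (lmod (lev i.+1)) B) <= kermx (gen_mx (lmod (lev i)) B))%MS
   && (row r (gen_mx (lmod (lev i.+1)) B) <= free_mod K (@res_lab i) (res_lab r))%MS.
  by rewrite -sub_capmx.
have := gen_minimal (lmod_mono (lev i)) rf r0 Elab.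
by rewrite mxE => E1; rewrite E1 eqxx in A0.
Qed.

(** Transparent, because the rank and the degrees of this resolution are later used by
    conversion. *)
Definition mideal_resolution : min_free_resolution mideal.
Proof.
refine (@MinFreeResolution K n mideal (fun i => gen_rk (lmod (lev i)) B)
  (fun i r => (mdeg (res_lab r))%:Z) (res_diff 0) (fun i => res_diff i.+1)
  _ _ res_aug_image _ _ res_minimal).
- by move=> r a /res_diff_graded <-; rewrite /= mdeg0 addr0.
- by move=> i r s a /res_diff_graded <-.
- by move=> v; apply: (@res_exact 0).
- by move=> i v; apply: (@res_exact i.+1).
Defined.

(** The resolution picked by [xget] is unknown; [resolution_deg] carries the degree j over in both
    directions. *)
Lemma betti_neq0 i j : betti mideal i j <> 0%N <->
  exists r : 'I_(gen_rk (lmod (lev i)) B), (mdeg (res_lab r))%:Z = j.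
Proof.
rewrite /betti; set P := (X in xget _ X).
have : P (xget 0%N P) by apply: (@xgetPex _ 0%N P); exists #|[pred r : 'I_(rk mideal_resolution i) | deg r == j]|, mideal_resolution.
move=> [F ->]; split=> [/eqP|[r Er]].
  rewrite -lt0n => /card_gt0P[r /eqP Er].
  by have [r' Er'] := resolution_deg mideal_resolution r; exists r'; rewrite -Er -Er'.
have [r' Er'] := @resolution_deg _ _ _ mideal_resolution F i r.
by apply/eqP; rewrite -lt0n; apply/card_gt0P; exists r'; rewrite inE Er' -Er.
Qed.

Hypothesis n_gt0 : (0 < n)%N.

Lemma lev_exact c i p : (p <= n)%N ->
  cube_exact (unit_cube (lmod (lev i)) c) p <->
  (p < i)%N \/ cube_exact (unit_cube mideal_mod c) (p - i).
Proof.
elim: i p => [|i IH] p pn; first by rewrite subn0; split=> [|[]//]; right.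
case: p pn => [|p] pn.
  by split=> [_|_]; [left|apply: syz_exact0].
rewrite (syz_exact_shift (lmod_mono (lev i)) (lmod_bounded (lev i)) _ pn).
by rewrite IH ?subSS //; apply: ltnW.
Qed.

Lemma res_lab_exists c i :
  (exists r : 'I_(gen_rk (lmod (lev i)) B), res_lab r = c) <->
  (i <= n)%N /\ ~ cube_exact (unit_cube mideal_mod c) (n - i).
Proof.
rewrite (gen_lab_top (lmod_mono (lev i)) (lmod_bounded (lev i))) lev_exact //.
rewrite not_orP; split=> [[/negP]|[ni ne]]; first by rewrite -leqNgt.
by split=> //; apply/negP; rewrite -leqNgt.
Qed.

Lemma reg_mideal : (exists a, E a) ->
  (forall c p, ~ cube_exact (unit_cube mideal_mod c) p -> (mdeg c + p)%:Z <= reg mideal + n%:Z)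
  /\ (exists c p, ~ cube_exact (unit_cube mideal_mod c) p /\ (mdeg c + p)%:Z = reg mideal + n%:Z).
Proof.
pose A := [set k | exists i j, betti mideal i j <> 0%N /\ k = j - i%:Z].
have AP k : A k <-> exists c p, [/\ (p <= n)%N, ~ cube_exact (unit_cube mideal_mod c) p
    & k = (mdeg c + p)%:Z - n%:Z].
  split=> [[i [j [/betti_neq0[r <-] ->]]]|[c' [p' [pn ne ->]]]].
    have [|le ne] := (res_lab_exists (res_lab r) i).1; first by exists r.
    exists (res_lab r), (n - i)%N; split=> //; first exact: leq_subr.
    by rewrite PoszD -subzn // addrA addrAC addrK.
  have [|r Er] := (res_lab_exists c' (n - p')).2; first by rewrite leq_subr subKn.
  exists (n - p')%N, (mdeg c')%:Z; split; first by apply/betti_neq0; exists r; rewrite Er.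
  by rewrite PoszD -subzn // opprB addrA.
(* All labels lie below B at every stage. Without such a bound [reg] could be the default value 0 of
   [set_max]. *)
have Abd k : A k -> k <= (mdeg B)%:Z.
  move=> [i [j [/betti_neq0[r <-] ->]]]; apply: le_trans (_ : (mdeg (res_lab r))%:Z <= _).
    by rewrite gerBl.
  rewrite lez_nat !mdegE; apply: leq_sum => t _.
  by have /mnm_lepP := gen_lab_bound (lmod_mono (lev i)) (lmod_bounded (lev i)) r.
move=> [a0 Ea0].
have [k0 Ak0] : exists k, A k.
  have [x _ Ex] := @gen_surj _ _ _ _ B mideal_mod_mono mideal_mod_bounded a0 1%:M
    (ltac:(by rewrite /mideal_mod Ea0 submx_refl)).
  have [r _] : exists r, x 0 r != 0.
    apply: contrapT => x0; move: Ex; rewrite (_ : x = 0).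
      by rewrite mul0mx => /eqP; rewrite oner_eq0.
    by apply/rowP => r; rewrite mxE; apply: contrapT => /eqP xr; apply: x0; exists r.
  exists ((mdeg (@res_lab 0 r))%:Z - 0); exists 0%N, (mdeg (@res_lab 0 r))%:Z; split=> //.
  by apply/(@betti_neq0 0); exists r.
have [M AM Mub] : exists2 M, A M & ubound A M.
  have ex : exists m : nat, `[< A (k0 + m%:Z) >] by exists 0%N; rewrite addr0; apply/asboolP.
  have bd (m : nat) : `[< A (k0 + m%:Z) >] -> (m <= absz ((mdeg B)%:Z - k0))%N.
    move=> /asboolP/Abd; rewrite -lerBrDl => h; rewrite -lez_nat; apply: (le_trans h).
    by rewrite abszE ler_norm.
  case: (ex_maxnP ex bd) => m /asboolP Am mm; exists (k0 + m%:Z) => // x Ax.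
  have [xk|/ltW kx] := lerP x k0; first by rewrite (le_trans xk) // lerDl.
  have Ex : x = k0 + (absz (x - k0))%:Z by rewrite gez0_abs ?subr_ge0 // [RHS]addrC subrK.
  by rewrite Ex lerD2l lez_nat; apply: mm; rewrite -Ex; apply/asboolP.
have [Areg regub] : (A `&` ubound A) (reg mideal).
  by apply: (@xgetPex _ 0 (A `&` ubound A)); exists M.
split=> [c p ne|].
  rewrite -lerBlDr; apply: regub; apply/AP; exists c, p; split=> //.
  rewrite leqNgt; apply/negP => np; apply: ne; apply: cube_exact_big => // F.
  by case: (unit_cube_family c mideal_mod_mono).
have [c [p [_ ne ->]]] := (AP _).1 Areg.
by exists c, p; rewrite subrK.
Qed.

End Resolution.

(** * Comparison of regularities *)

Section RegCompare.
Variables (K : fieldType) (n : nat) (E EL EJ : pred 'X_{1..n}) (B : 'X_{1..n}) (k gam : nat).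
Implicit Types (a b c g : 'X_{1..n}) (F : {set 'I_n}).
Hypotheses (k_gt0 : (0 < k)%N) (gam_gt0 : (0 < gam)%N).
Hypothesis E0 : ~~ E 0%MM.
Hypothesis Ex : exists a, E a.
Hypothesis Egen : forall a, E a -> exists g, [/\ (g <= a)%MM, (g <= B)%MM, E g &
  forall j, (0 < g j)%N -> (gam <= g j)%N].
Hypothesis EJP : forall a, EJ a <->
  exists g : 'I_k -> 'X_{1..n}, (forall i, E (g i)) /\ (forall j, \sum_i g i j <= a j)%N.
Hypothesis ELP : forall a, EL a = EJ (a *+ k)%MM.

Lemma EJ_mono a b : (a <= b)%MM -> EJ a -> EJ b.
Proof.
move=> /mnm_lepP ab /EJP[g [gE ga]]; apply/EJP; exists g; split=> // j.
exact: leq_trans (ab j).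
Qed.

Lemma EJ_gens a : EJ a -> exists g : 'I_k -> 'X_{1..n},
  [/\ forall i, E (g i), forall i, (g i <= B)%MM,
    forall i j, (0 < g i j)%N -> (gam <= g i j)%N & forall j, (\sum_i g i j <= a j)%N].
Proof.
move=> /EJP[g [gE ga]]; have [h hP] := choice (fun i => Egen (gE i)).
exists h; split=> [i|i|i|j]; try by case: (hP i).
apply: leq_trans (ga j); apply: leq_sum => i _; by case: (hP i) => /mnm_lepP.
Qed.

Lemma EJ_bounded a : EJ a -> EJ (mnm_min a (B *+ k)).
Proof.
move=> /EJ_gens[g [gE gB _ ga]]; apply/EJP; exists g; split=> // j.
rewrite mnmE leq_min ga /= mulmnE -[X in (_ <= X)%N]muln1 -[k in (_ * k * 1)%N]card_ord muln1.
by rewrite mulnC -sum_nat_const; apply: leq_sum => i _; apply/mnm_lepP.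
Qed.

Lemma EL_mono a b : (a <= b)%MM -> EL a -> EL b.
Proof.
rewrite !ELP => /mnm_lepP ab; apply: EJ_mono; apply/mnm_lepP => i.
by rewrite !mulmnE leq_mul2r ab orbT.
Qed.

Lemma EL_bounded a : EL a -> EL (mnm_min a B).
Proof.
rewrite !ELP => /EJ_bounded; congr EJ; apply/mnmP => i.
by rewrite !(mnmE, mulmnE) minnMl.
Qed.

(** If each of k generators whose product divides x^a involved a variable outside F, they would
    contribute at least [k * gam] there. Conversely, the k-th power of a generator supported in F
    divides x^a, the coordinates on F being large. So membership in I^k depends on supports only. *)
Lemma EJ_small a F : (\sum_(j | j \notin F) a j < k * gam)%N ->
  (forall j, j \in F -> k * mdeg B <= a j)%N ->
  EJ a <-> exists g, E g /\ forall j, (0 < g j)%N -> j \in F.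
Proof.
move=> small big; split=> [/EJ_gens[g [gE _ gg ga]]|[g0 [/Egen[g [gg0 gB gE _]] gF]]].
  apply: contrapT => nex; move: small; rewrite ltnNge => /negP; apply.
  apply: (@leq_trans (\sum_(j | j \notin F) \sum_i g i j)); last exact: leq_sum.
  rewrite exchange_big /= -[k in (k * _)%N]card_ord -sum_nat_const; apply: leq_sum => i _.
  have [j /andP[gj jF]] : exists j, (0 < g i j)%N && (j \notin F).
    apply: contrapT => h; apply: nex; exists (g i); split=> // j gj; apply/negPn/negP => jF.
    by apply: h; exists j; rewrite gj.
  by rewrite (bigD1 j) //=; apply: leq_trans (gg i j gj) _; apply: leq_addr.
apply/EJP; exists (fun=> g); split=> // j.
rewrite sum_nat_const card_ord; case: (posnP (g j)) => [->|gj]; first by rewrite muln0.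
have jF : j \in F by apply: gF; apply: leq_trans gj _; apply/mnm_lepP.
apply: leq_trans (big j jF); rewrite leq_mul2l; apply/orP; right.
apply: leq_trans (_ : B j <= _)%N; first exact/mnm_lepP.
by rewrite mdegE (bigD1 j) //= leq_addr.
Qed.

Let n_gt0 : (0 < n)%N.
Proof.
have [a Ea] := Ex; rewrite lt0n; apply/eqP => n0; move: E0; rewrite -(_ : a = 0%MM) ?Ea //.
by apply/mnmP => i; have := leq_trans (ltn_ord i) (eq_leq n0).
Qed.

Let ELx : exists a, EL a.
Proof.
have [a Ea] := Ex; exists a; rewrite ELP; apply/EJP; exists (fun=> a); split=> // j.
by rewrite sum_nat_const card_ord mulmnE mulnC.
Qed.

Let EJx : exists a, EJ a.
Proof. by have [a] := ELx; rewrite ELP; exists (a *+ k)%MM. Qed.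

Local Notation NL := (mideal_mod K EL).
Local Notation NJ := (mideal_mod K EJ).

Let regL := reg_mideal K EL_mono EL_bounded n_gt0 ELx.
Let regJ := reg_mideal K EJ_mono EJ_bounded n_gt0 EJx.

Lemma shift_mideal_eq (w w' : 'I_n -> nat) (E1 E2 : pred 'X_{1..n}) :
  (forall i, (0 < w i) = (0 < w' i))%N ->
  ((forall i, (0 < w i)%N) -> E1 [multinom (w i).-1 | i < n] = E2 [multinom (w' i).-1 | i < n]) ->
  shift_mod (mideal_mod K E1) w = shift_mod (mideal_mod K E2) w'.
Proof.
move=> ww EE; rewrite /shift_mod (eq_forallb (P2 := fun i => 0 < w' i)%N) //.
case: ifP => // /forallP w0; rewrite /mideal_mod EE // => i; by rewrite ww.
Qed.

(** Only the subspaces at the vertices enter exactness, so a class for another ideal may be read in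
    a box of J with different ends; shrinking that box yields a Betti number of J. *)
Lemma box_reg (E1 : pred 'X_{1..n}) lo hi lo' hi' p :
  (forall F, shift_mod (mideal_mod K E1) (fun i => if i \in F then hi i else lo i) =
    shift_mod NJ (fun i => if i \in F then hi' i else lo' i)) ->
  (forall i, lo' i < hi' i)%N ->
  ~ cube_exact (box (shift_sub (mideal_mod K E1)) lo hi) p ->
  (\sum_i lo' i + p)%N%:Z <= reg (@mideal K n EJ) + n%:Z.
Proof.
move=> EE lh ne.
have [|||lo2 le ne2] := @box_shrink K n _ (shift_sub NJ) _ _ lo' hi' p lh.
- by move=> w; apply: subsp_mx.
- by move=> w w' v ww; apply: shift_sub_mono => //; apply/mideal_mod_mono/EJ_mono.
- by move=> ex; apply: ne; apply: eq_cube_exact ex => F v; rewrite /box /shift_sub EE.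
have [regJ1 _] := regJ; pose c := [multinom lo2 i | i < n].
apply: le_trans (regJ1 c p _); last first.
  move=> ex; apply: ne2; apply: eq_cube_exact ex => F v; rewrite /unit_cube /box.
  by rewrite (_ : (fun i => _) = (fun i => if i \in F then (lo2 i).+1 else lo2 i)) //;
    apply/funext => i; rewrite mnmE.
rewrite lez_nat leq_add2r mdegE; apply: leq_sum => i _; by rewrite mnmE.
Qed.

(** A monomial of least degree in I^k is a minimal generator, and each of its k factors is
    nonconstant, hence has degree at least [gam]. *)
Lemma reg_EJ_ge : (k * gam + n)%N%:Z <= reg (@mideal K n EJ) + n%:Z.
Proof.
have ex : exists d, [exists a : 'X_{1..n < d.+1}, EJ a].
  have [a Ea] := EJx; exists (mdeg a); apply/existsP.
  by exists (BMultinom (ltnSn (mdeg a))).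
case: (ex_minnP ex) => d /existsP[c Ec] dmin.
have [regJ1 _] := regJ; apply: le_trans (regJ1 c n _).
  rewrite lez_nat leq_add2r; have [g [gE _ gg gc]] := EJ_gens Ec.
  rewrite mdegE; apply: (@leq_trans (\sum_j \sum_i g i j)); last by apply: leq_sum => j _; apply: gc.
  rewrite exchange_big /= -[k in (k * _)%N]card_ord -sum_nat_const; apply: leq_sum => i _.
  have [j gj] : exists j, (0 < g i j)%N.
    apply: contrapT => h; move/negP: E0; apply; rewrite -(_ : g i = 0%MM) //.
    apply/mnmP => j; rewrite mnm0E; apply/eqP; rewrite -leqn0 leqNgt; apply/negP => gj.
    by apply: h; exists j.
  by rewrite (bigD1 j) //=; apply: leq_trans (gg i j gj) _; apply: leq_addr.
move=> /(unit_cube_exact_top _ (mideal_mod_mono K EJ_mono)).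
rewrite /below_mod big1 ?submx0 /mideal_mod ?Ec ?oner_eq0 // => j cj.
case: ifP => // Ej; have : (mdeg (c - U_(j))%MM < d)%N.
  have := bmdeg c; rewrite ltnS; apply: leq_trans.
  have Ec' : (c - U_(j) + U_(j))%MM = c by rewrite submK // lep1mP -lt0n.
  by rewrite -[in X in (_ < X)%N]Ec' mdegD mdeg1 addn1.
move=> lt; suff : (d <= mdeg (c - U_(j))%MM)%N by rewrite leqNgt lt.
by apply: dmin; apply/existsP; exists (BMultinom (ltnSn (mdeg (c - U_(j))%MM))).
Qed.

Theorem reg_scaled_le : reg (@mideal K n EL) + (gam * (k - 1))%N%:Z <= reg (@mideal K n EJ).
Proof.
have [_ [c [p [ne Ereg]]]] := regL.
(* The common upper end: it exceeds all coordinates of c, and M - 1 is at least [mdeg B], as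
   [EJ_small] will require after multiplication by k. *)
pose M := (mdeg c + mdeg B + 2)%N.
have cM i : (c i < (c i).+1 <= M)%N.
  rewrite ltnSn /=; suff : (c i <= mdeg c)%N by rewrite /M; lia.
  by rewrite mdegE (bigD1 i) //= leq_addr.
have [|||lo [q [loM le ne']]] := @box_stretch K n _ (shift_sub NL) _ _ M c _ p cM.
- by move=> w; apply: subsp_mx.
- by move=> w w' v ww; apply: shift_sub_mono => //; apply/mideal_mod_mono/EL_mono.
- exact: ne.
have qn : (q <= n)%N.
  rewrite leqNgt; apply/negP => nq; apply: ne'; apply: cube_exact_big => // F.
  exact: subsp_mx.
have {}le : reg (@mideal K n EL) + n%:Z <= (\sum_i lo i + q)%N%:Z.
  by rewrite -Ereg lez_nat mdegE.
(* Indices are shifted by one, so [(lo i).-1] is the nonnegative part of the i-th coordinate. *)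
pose s := (\sum_i (lo i).-1)%N.
have sumlo : (\sum_i lo i = s + \sum_i (0 < lo i))%N.
  by rewrite -big_split /=; apply: eq_bigr => i _; case: (lo i) => //= x; rewrite addn1.
have [gs|sg] := leqP gam s.
  (* Multiplication of the degree x - 1 by k, in shifted indices; the index 0, which stands for -1,
     is kept. *)
  pose sc x := if x is x'.+1 then (k * x' + 1)%N else 0%N.
  have scE x : sc x = (x + (k - 1) * x.-1)%N by case: x => [|x] /=; nia.
  have := @box_reg EL lo (fun=> M) (fun i => sc (lo i)) (fun=> sc M) q _ _ ne'.
  have -> : (\sum_i sc (lo i) = \sum_i lo i + (k - 1) * s)%N.
    by rewrite big_distrr -big_split; apply: eq_bigr => i _; rewrite scE.
  move=> h; have {}h : ((\sum_i lo i + (k - 1) * s + q)%N)%:Z <= reg (@mideal K n EJ) + n%:Z.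
    apply: h => [F|i]; last by rewrite !scE; have := loM i; nia.
    apply: shift_mideal_eq => [i|w0].
      by case: (i \in F); [case: (M)|case: (lo i)] => //= x; rewrite addn1.
    rewrite ELP; congr EJ; apply/mnmP => i; rewrite mulmnE !mnmE; have := w0 i.
    by case: (i \in F); [case: (M)|case: (lo i)] => //= x _; rewrite addn1 mulnC.
  have : (gam * (k - 1) <= (k - 1) * s)%N by rewrite mulnC leq_mul2l gs orbT.
  move: (\sum_i lo i)%N ((k - 1) * s)%N (gam * (k - 1))%N le h => x y z; lia.
(* If every coordinate is -1, none can carry the degree [k * gam - 1]. But then the regularity of L
   is at most q - n <= 0, and the bound from [reg_EJ_ge] suffices. *)
case: (pselect (exists j, (0 < lo j)%N)) => [[j0 lj0]|nl]; last first.
  have lo0 : (\sum_i lo i = 0)%N.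
    apply: big1 => i _; apply/eqP; rewrite -leqn0 leqNgt; apply/negP => h.
    by apply: nl; exists i.
  have := reg_EJ_ge; move: le; rewrite lo0 add0n.
  have : (gam * (k - 1) <= k * gam)%N by nia.
  move: (gam * (k - 1))%N (k * gam)%N => x y; lia.
pose M' := (k * gam + k * mdeg B + 2)%N.
(* The whole degree [k * gam - 1] is put on coordinate [j0]; the other nonnegative coordinates
   become 0 and the coordinates -1 stay. *)
pose lo' i := if lo i == 0%N then 0%N else if i == j0 then (k * gam)%N else 1%N.
have kg : (0 < k * gam)%N by rewrite muln_gt0 k_gt0.
have lo'0 i : (0 < lo' i)%N = (0 < lo i)%N.
  by rewrite /lo'; have [->//|l0] := eqVneq (lo i) 0%N; rewrite [RHS]lt0n l0; case: eqP.
have sumlo' : (\sum_i (lo' i).-1 = (k * gam).-1)%N.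
  rewrite (bigD1 j0) //= /lo' eqxx (gtn_eqF lj0) big1 ?addn0 // => i /negPf ->.
  by case: ifP.
have := @box_reg EL lo (fun=> M) lo' (fun=> M') q _ _ ne'.
have -> : (\sum_i lo' i = (k * gam).-1 + \sum_i (0 < lo i))%N.
  rewrite -sumlo' -big_split /=; apply: eq_bigr => i _; rewrite -lo'0.
  by case: (lo' i) => //= x; rewrite addn1.
move=> h; have {}h : ((k * gam).-1 + \sum_i (0 < lo i) + q)%N%:Z <= reg (@mideal K n EJ) + n%:Z.
  apply: h => [F|i]; last by rewrite /lo' /M'; case: ifP => _; [lia|case: ifP => _; lia].
  apply: shift_mideal_eq => [i|w0].
    by case: (i \in F); rewrite ?lo'0 // /M /M' !addn2.
  have sumF (f : 'I_n -> nat) : (\sum_(j | j \notin F) f j <= \sum_j f j)%N.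
    by rewrite [X in (_ <= X)%N](bigID (fun j => j \notin F)) /= leq_addr.
  rewrite ELP; set a1 := (_ *+ k)%MM; set a2 := [multinom _ | i < n].
  have s1 : EJ a1 <-> exists g, E g /\ forall j, (0 < g j)%N -> j \in F.
    apply: EJ_small => [|j jF]; last by rewrite mulmnE mnmE jF mulnC leq_mul2r /M; lia.
    apply: leq_ltn_trans (_ : k * s < _)%N; last by rewrite ltn_mul2l k_gt0.
    rewrite big_distrr /=; apply: leq_trans (sumF _); apply: leq_sum => j jF.
    by rewrite mulmnE mnmE (negPf jF) mulnC.
  have s2 : EJ a2 <-> exists g, E g /\ forall j, (0 < g j)%N -> j \in F.
    apply: EJ_small => [|j jF]; last by rewrite mnmE jF /M'; lia.
    apply: leq_ltn_trans (_ : (k * gam).-1 < _)%N; last by rewrite prednK.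
    rewrite -sumlo'; apply: leq_trans (sumF _); apply: leq_sum => j jF.
    by rewrite mnmE (negPf jF).
  by apply/idP/idP => [/s1/s2|/s2/s1].
move: le h sg; rewrite sumlo; move: (\sum_i (0 < lo i))%N => x le h sg.
have : (s + gam * (k - 1) <= (k * gam).-1)%N by nia.
move: (gam * (k - 1))%N ((k * gam).-1) h => y z; lia.
Qed.


End RegCompare.

(** * Integral closures of monomial ideals *)

Section Closure.
Variables (R : comNzRingType) (I : set R).

Lemma rees_valP (x : rees I) k : ideal_exp I k (val x)`_k.
Proof. by case: x => p /= /asboolP. Qed.

Lemma rees_monomial k c : ideal_exp I k c -> c *: 'X^k \in rees_pred I.
Proof.
move=> Ic; apply/asboolP => i; rewrite coefZ coefXn; case: eqP => [->|_].
  by rewrite mulr1.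
by rewrite mulr0; case: (ideal_exp_ideal I i).
Qed.

(** An integral equation of f is the coefficient of t^k in an equation of f t over the Rees algebra.
    Sums of integral elements being integral, the closure is an ideal. *)
Lemma integral_closureP f :
  integral_closure I f <-> integralOver (val : rees I -> {poly R}) (f *: 'X).
Proof.
have [phi Ephi] : exists phi : {rmorphism rees I -> {poly R}}, (phi : rees I -> {poly R}) = val.
  by eexists (_ : {rmorphism rees I -> {poly R}}).
rewrite -Ephi; split=> [[k [c [k0 cI fk]]]|[p pm]].
  have /choice[x xP] (i : nat) : exists x : rees I, (1 <= i <= k)%N -> val x = c i *: 'X^i.
    case: (boolP (1 <= i <= k)%N) => [ik|_]; last by exists 0.
    by exists (Rees (rees_monomial (cI i ik))).
  pose p := 'X^k + \sum_(1 <= i < k.+1) (x i)%:P * 'X^(k - i).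
  have sp : (size (\sum_(1 <= i < k.+1) (x i)%:P * 'X^(k - i))%R <= k)%N.
    rewrite big_nat; apply: (big_ind (fun q : {poly _} => size q <= k)%N) => [|q r qk rk|i ik].
    - by rewrite size_poly0.
    - by rewrite (leq_trans (size_polyD _ _)) // geq_max qk.
    rewrite mul_polyC (leq_trans (size_scale_leq _ _)) // size_polyXn.
    by have := ik; case: (i) => // i'; rewrite /= ltnS => ik'; rewrite subnSK // leq_subr.
  exists p.
    by rewrite monicE lead_coefDl ?lead_coefXn // size_polyXn ltnS.
  rewrite /root /p rmorphD rmorph_sum /= map_polyXn hornerD hornerXn horner_sum.
  rewrite exprZn -[X in _ == X](scale0r 'X^k) -[X in _ == X *: _]fk scalerDl; apply/eqP; congr (_ + _).
  rewrite scaler_suml !big_nat; apply: eq_bigr => i ik.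
  rewrite rmorphM /= map_polyC map_polyXn hornerM hornerC hornerXn /= Ephi xP //.
  rewrite exprZn -scalerAl -scalerAr scalerA -exprD subnKC //.
  by have /andP[_] := ik; rewrite ltnS.
rewrite /root => /eqP pr.
have k0 : (0 < (size p).-1)%N.
  rewrite lt0n; apply/eqP => s0; have s1 : (size p <= 1)%N by case: (size p) s0 => [|[]].
  move: pr; rewrite (size1_polyC s1) map_polyC hornerC /=.
  have -> : p`_0 = 1 by have := monicP pm; rewrite /lead_coef s0.
  by move/eqP; rewrite rmorph1 oner_eq0.
pose k := (size p).-1; have sk : size p = k.+1 by rewrite prednK // (leq_trans k0) // leq_pred.
exists k, (fun i => (phi p`_(k - i))`_i); split=> // [i _|].
  by rewrite Ephi; apply: rees_valP.
have := congr1 (fun q : {poly R} => q`_k) pr.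
rewrite /= coef0 (horner_coef_wide _ (size_poly _ _)) -/(map_poly _ _) => E; rewrite -[RHS]E.
rewrite coef_sum sk big_ord_recr /= addrC; congr (_ + _).
  rewrite coef_map /=; have -> : p`_k = 1 by have := monicP pm.
  by rewrite rmorph1 mul1r exprZn coefZ coefXn eqxx mulr1.
rewrite big_add1 /= big_mkord (reindex_inj rev_ord_inj) /=; apply: eq_bigr => i _.
have ik : (i <= k)%N by rewrite ltnW.
rewrite coef_map /= exprZn -scalerAr coefZ coefMXn ltnNge ik /= mulrC.
by rewrite -subSn // subSS subKn.
Qed.

Lemma integral_closure_ideal : is_ideal (integral_closure I).
Proof.
split=> [|f g|a f].
- by apply/integral_closureP; rewrite scale0r; apply: integral0.
- by move=> /integral_closureP If /integral_closureP Ig; apply/integral_closureP;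
    rewrite scalerDl; apply: integral_add.
- move=> /integral_closureP If; apply/integral_closureP.
  rewrite -scalerA -mul_polyC; apply: integral_mul => //.
  have Ra : a%:P \in rees_pred I.
    by have := @rees_monomial 0 a Logic.I; rewrite expr0 alg_polyC.
  exact: (@integral_id _ _ (val : rees I -> {poly R}) (Rees Ra)).
Qed.

End Closure.

Section Powers.
Variables (R : comNzRingType) (I : set R).

Lemma ideal_exp_mul k l : is_ideal I -> ideal_exp (ideal_exp I k) l = ideal_exp I (k * l).
Proof.
move=> II; elim: l => [|l IH]; first by rewrite muln0.
rewrite mulnS /= IH; apply/seteqP; split.
  apply: ideal_gen_sub; first exact: ideal_exp_ideal.
  by move=> _ [a [b [Ia Ib ->]]]; apply: ideal_expD.
elim: k (k * l)%N {IH} => [|k IHk] j /= x Ix.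
  by apply: sub_ideal_gen; exists 1, x; rewrite mul1r; split.
have II' := ideal_gen_ideal [set x | exists a b, [/\ ideal_exp I k.+1 a, ideal_exp I j b & x = a * b]].
move: Ix; apply: ideal_gen_sub => // y [a [b [Ia Ib ->]]].
have := IHk j b Ib.
suff : ideal_mul (ideal_exp I k) (ideal_exp I j) `<=` [set z | ideal_mul (ideal_exp I k.+1) (ideal_exp I j) (a * z)] by apply.
have [I0 ID IM] := II'; apply: ideal_gen_sub.
  split=> [|z t Iz It|z t It] /=; first by rewrite mulr0.
    by rewrite mulrDr; apply: ID.
  by rewrite mulrCA; apply: IM.
move=> _ [c [d [Ic Id ->]]] /=; apply: sub_ideal_gen.
exists (a * c), d; split=> //; last by rewrite mulrA.
by apply: sub_ideal_gen; exists a, c.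
Qed.

End Powers.

(** * Monomial ideals as upward closed sets of exponents *)

Section MonomialIdeals.
Variables (K : fieldType) (n : nat).
Local Notation S := {mpoly K[n]}.
Implicit Types (a b c : 'X_{1..n}) (E F : pred 'X_{1..n}).

Definition up_closed E := forall a b, (a <= b)%MM -> E a -> E b.

Lemma mideal_ideal E : up_closed E -> is_ideal (@mideal K n E).
Proof.
move=> Eu; split=> [a|f g fE gE a|f g gE a]; first by rewrite msupp0.
  by move/msuppD_le; rewrite mem_cat => /orP[/fE|/gE].
by move=> /msuppM_le/allpairsP[[b c] /= [_ /gE Ec ->]]; apply: Eu Ec; apply: lem_addl.
Qed.

Lemma midealX E a : @mideal K n E 'X_[a] <-> E a.
Proof.
split=> [h|Ea b]; first by apply: h; rewrite msuppX mem_seq1.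
by rewrite msuppX mem_seq1 => /eqP->.
Qed.

Lemma mideal_sub E (I : set S) : is_ideal I -> (forall a, E a -> I 'X_[a]) -> @mideal K n E `<=` I.
Proof.
move=> [I0 ID IM] EI f fE; rewrite [f]mpolyE big_seq.
apply: (big_ind I) => // a /fE/EI Ia.
by rewrite -mul_mpolyC; apply: IM.
Qed.

Lemma monomial_idealE (I : set S) : is_monomial_ideal I ->
  exists2 E, up_closed E & I = @mideal K n E.
Proof.
move=> [A ->]; exists (fun a => `[< exists2 b, A b & (b <= a)%MM >]).
  move=> a b ab /asboolP[c Ac ca]; apply/asboolP; exists c => //; exact: lepm_trans ab.
apply/seteqP; split.
  apply: ideal_gen_sub.
    apply: mideal_ideal => a b ab /asboolP[c Ac ca]; apply/asboolP; exists c => //.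
    exact: lepm_trans ab.
  move=> _ [a Aa <-] b; rewrite msuppX mem_seq1 => /eqP->.
  by apply/asboolP; exists a => //; apply: lepm_refl.
apply: mideal_sub; first exact: ideal_gen_ideal.
move=> a /asboolP[b Ab ba]; rewrite -(submK ba) mpolyXD.
have [_ _ IM] := ideal_gen_ideal [set 'X_[K, c] | c in A].
by apply: IM; apply: sub_ideal_gen; exists b.
Qed.

Fixpoint mpow E k : pred 'X_{1..n} :=
  if k is k'.+1 then fun a => `[< exists b c, [/\ a = (b + c)%MM, E b & mpow E k' c] >]
  else xpredT.

Lemma mpow_up E k : up_closed E -> up_closed (mpow E k).
Proof.
case: k => [|k] Eu // a b ab /asboolP[c [d [E1 Ec Ed]]]; apply/asboolP.
exists (c + (b - a))%MM, d; split=> //; last by apply: Eu Ec; apply: lem_addr.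
by rewrite -addmA [(_ - _ + _)%MM]addmC addmA -E1 addmC submK.
Qed.

Lemma mpowD E k l a b : up_closed E -> mpow E k a -> mpow E l b -> mpow E (k + l) (a + b)%MM.
Proof.
move=> Eu; elim: k a => [|k IH] a /= Ea Eb.
  by apply: mpow_up Eb => //; apply: lem_addl.
have /asboolP[c [d [-> Ec Ed]]] := Ea; apply/asboolP.
by exists c, (d + b)%MM; split=> //; [rewrite addmA | apply: IH].
Qed.

Lemma mpowM E k N a : up_closed E -> mpow E k a -> mpow E (N * k) (a *+ N)%MM.
Proof.
move=> Eu Ea; elim: N => // N IH; rewrite mulSn mulmS; exact: mpowD.
Qed.

Lemma mpow1 E a : up_closed E -> mpow E 1 a = E a.
Proof.
move=> Eu; apply/idP/idP => [/asboolP[b [c [-> Eb _]]]|Ea].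
  by apply: Eu Eb; apply: lem_addr.
by apply/asboolP; exists a, 0%MM; rewrite addm0.
Qed.

Lemma mpowP E k a : up_closed E -> mpow E k a <->
  exists g : 'I_k -> 'X_{1..n}, (forall i, E (g i)) /\ (forall j, \sum_i g i j <= a j)%N.
Proof.
move=> Eu; elim: k a => [|k IH] a.
  split=> // _; have g0 (i : 'I_0) : 'X_{1..n} by case: i.
  by exists g0; split=> [[]//|j]; rewrite big_ord0.
split=> [/asboolP[b [c [-> Eb /IH[g [gE gc]]]]]|[g [gE ga]]].
  exists (fun i => if unlift ord0 i is Some i' then g i' else b); split=> [i|j].
    by case: unliftP => [i'|] _.
  rewrite big_ord_recl unlift_none mnmDE leq_add2l.
  by under eq_bigr do rewrite liftK.
have lea : (g ord0 <= a)%MM.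
  by apply/mnm_lepP => j; apply: leq_trans (ga j); rewrite big_ord_recl leq_addr.
apply/asboolP; exists (g ord0), (a - g ord0)%MM; split=> //.
  by rewrite addmC submK.
apply/IH; exists (fun i => g (lift ord0 i)); split=> // j.
rewrite mnmBE leq_subRL; last exact/mnm_lepP.
by apply: leq_trans (ga j); rewrite big_ord_recl.
Qed.

Lemma ideal_exp_mideal E k : up_closed E ->
  ideal_exp (@mideal K n E) k = @mideal K n (mpow E k).
Proof.
move=> Eu; elim: k => [|k IH] /=; first by apply/seteqP; split.
rewrite IH; apply/seteqP; split.
  apply: ideal_gen_sub; first exact: (mideal_ideal (@mpow_up E k.+1 Eu)).
  move=> _ [f [g [fE gE ->]]] a /msuppM_le/allpairsP[[b c] /= [/fE Eb /gE Ec ->]].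
  by apply/asboolP; exists b, c.
apply: mideal_sub; first exact: ideal_gen_ideal.
move=> a /asboolP[b [c [-> Eb Ec]]]; apply: sub_ideal_gen.
exists 'X_[b], 'X_[c]; split; last exact: mpolyXD.
  exact/midealX.
exact/midealX.
Qed.

End MonomialIdeals.

(** * Dickson's lemma and minimal generators *)

Section Dickson.
Variable n : nat.
Implicit Types (a b : 'X_{1..n}).

Lemma nondec_subseq (f : nat -> nat) : exists2 p : nat -> nat,
  (forall i j, (i < j)%N -> (p i < p j)%N) & forall i j, (i <= j)%N -> (f (p i) <= f (p j))%N.
Proof.
have /choice[q qP] m : exists i, (m <= i)%N /\ forall j, (m <= j)%N -> (f i <= f j)%N.
  have ex : exists v, `[< exists2 i, (m <= i)%N & f i = v >].
    by exists (f m); apply/asboolP; exists m.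
  case: (ex_minnP ex) => v /asboolP[i mi <-] vmin; exists i; split=> // j mj.
  by apply: vmin; apply/asboolP; exists j.
pose p := fix p i := if i is i'.+1 then q (p i').+1 else q 0%N.
have pS i : (p i < p i.+1)%N by have [] := qP (p i).+1.
have pinc i j : (i < j)%N -> (p i < p j)%N.
  elim: j => // j IH; rewrite ltnS leq_eqVlt => /predU1P[->//|/IH/ltn_trans]; exact.
exists p => // i j; rewrite leq_eqVlt => /predU1P[->//|/pinc/ltnW ij].
case: i ij => [|i] ij /=; first by have [_] := qP 0%N; apply.
by have [h1 h2] := qP (p i).+1; apply: h2; apply: leq_trans h1 ij.
Qed.

Lemma dickson_pair (f : nat -> 'X_{1..n}) : exists i j, (i < j)%N /\ (f i <= f j)%MM.
Proof.
suff [p pinc pm] : exists2 p : nat -> nat, (forall i j, (i < j)%N -> (p i < p j)%N) &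
    forall k, k \in enum 'I_n -> forall i j, (i <= j)%N -> (f (p i) k <= f (p j) k)%N.
  exists (p 0%N), (p 1%N); split; first exact: pinc.
  by apply/mnm_lepP => k; apply: pm; rewrite ?mem_enum.
elim: (enum 'I_n) => [|k s [p pinc pm]]; first by exists id.
have [q qinc qm] := nondec_subseq (fun i => f (p i) k).
exists (p \o q) => [i j /qinc/pinc//|k']; rewrite inE => /predU1P[->|ks] i j ij.
  exact: qm.
apply: pm => //; move: ij; rewrite leq_eqVlt => /predU1P[->//|/qinc/ltnW//].
Qed.

(** Otherwise each B has a counterexample f B. Let b collect least common multiples, so that f (b i)
    <= b j for i < j. A pair with f (b i) <= f (b j) then puts f (b i) below the minimum of f (b j)
    and b j, a contradiction. *)
Lemma dickson_bound (E : pred 'X_{1..n}) : up_closed E ->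
  exists B, forall a, E a -> E (mnm_min a B).
Proof.
move=> Eu; apply: contrapT => /forallNP nB.
have /choice[f fP] B : exists a, E a /\ ~ E (mnm_min a B).
  by apply: contrapT => h; apply: (nB B) => a Ea; apply: contrapT => na; apply: h; exists a.
pose b := fix b i := if i is i'.+1 then mlcm (b i') (f (b i')) else 0%MM.
have ble i j : (i <= j)%N -> (b i <= b j)%MM.
  elim: j => [|j IH]; first by rewrite leqn0 => /eqP->; apply: lepm_refl.
  rewrite leq_eqVlt => /predU1P[->|]; first exact: lepm_refl.
  by rewrite ltnS => /IH/lepm_trans; apply; apply: lem_mlcml.
have [i [j [ij fij]]] := dickson_pair (f \o b).
have [_] := fP (b j); apply; have [Ei _] := fP (b i); apply: Eu Ei.
apply/mnm_lepP => k; rewrite mnmE leq_min; move/mnm_lepP: fij => -> /=.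
have := ble _ _ ij => /mnm_lepP/(_ k); apply: leq_trans.
by rewrite /= mnmE leq_maxr.
Qed.

Lemma min_gens_mem (K : fieldType) (E : pred 'X_{1..n}) a :
  min_gens (@mideal K n E) a <-> E a /\ forall b, E b -> (b <= a)%MM -> b = a.
Proof.
split=> [[/midealX Ea h]|[Ea h]]; split=> //.
- by move=> b Eb; apply: h; apply/midealX.
- exact/midealX.
- by move=> b /midealX Eb; apply: h.
Qed.

Lemma min_gens_below (K : fieldType) (E : pred 'X_{1..n}) a : E a ->
  exists2 g, min_gens (@mideal K n E) g & (g <= a)%MM.
Proof.
have [m] := ubnP (mdeg a); elim: m => // m IH in a *; rewrite ltnS => am Ea.
case: (pselect (forall b, E b -> (b <= a)%MM -> b = a)) => [h|].
  by exists a; [apply/min_gens_mem | apply: lepm_refl].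
move=> /existsNP[b /not_implyP[Eb /not_implyP[ba /eqP ne]]].
have ltd : (mdeg b < mdeg a)%N.
  rewrite -(submK ba) mdegD -[X in (X < _)%N]add0n ltn_add2r lt0n mdeg_eq0.
  by apply: contra ne => /eqP E0; rewrite -(submK ba) E0 add0m.
have [g gm gb] := IH b (leq_trans ltd am) Eb.
by exists g => //; apply: lepm_trans ba.
Qed.

End Dickson.

(** * Finitely generated rational cones and their dual forms *)

Section Cones.
Variable m : nat.
Local Notation vect := 'rV[rat]_m.
Implicit Types (x y w g : vect) (G W : seq vect).

Definition dot w x : rat := (w *m x^T) 0 0.

Lemma dotDr w x y : dot w (x + y) = dot w x + dot w y.
Proof. by rewrite /dot linearD mulmxDr mxE. Qed.
Lemma dotZr w a x : dot w (a *: x) = a * dot w x.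
Proof. by rewrite /dot linearZ -scalemxAr mxE. Qed.
Lemma dotBr w x y : dot w (x - y) = dot w x - dot w y.
Proof. by rewrite -scaleN1r dotDr dotZr mulN1r. Qed.
Lemma dot0r w : dot w 0 = 0.
Proof. by rewrite /dot linear0 mulmx0 mxE. Qed.
Lemma dotDl w w' x : dot (w + w') x = dot w x + dot w' x.
Proof. by rewrite /dot mulmxDl mxE. Qed.
Lemma dotZl w a x : dot (a *: w) x = a * dot w x.
Proof. by rewrite /dot -scalemxAl mxE. Qed.
Lemma dotBl w w' x : dot (w - w') x = dot w x - dot w' x.
Proof. by rewrite -scaleN1r dotDl dotZl mulN1r. Qed.
Lemma dot0l x : dot 0 x = 0.
Proof. by rewrite /dot mul0mx mxE. Qed.
Lemma dot_suml (I : Type) (r : seq I) (P : pred I) (f : I -> vect) x :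
  dot (\sum_(i <- r | P i) f i) x = \sum_(i <- r | P i) dot (f i) x.
Proof. exact: (big_morph (fun w => dot w x) (fun w w' => dotDl w w' x) (dot0l x)). Qed.

Fixpoint cone G x : Prop :=
  if G is g :: G' then exists2 l : rat, 0 <= l & cone G' (x - l *: g) else x = 0.

Definition dual_of G W := forall x, cone G x <-> forall w, w \in W -> 0 <= dot w x.

Lemma seq_max (l0 : rat) (l : seq rat) :
  exists2 z, z \in l0 :: l & forall t, t \in l0 :: l -> t <= z.
Proof.
elim: l => [|a l [z zl zm]]; first by exists l0; rewrite ?inE // => t; rewrite inE => /eqP->.
have [za|/ltW az] := lerP z a.
  exists a; first by rewrite !inE eqxx orbT.
  move=> t; rewrite !inE => /or3P[/eqP->|/eqP->//|yl].
    by apply: le_trans za; apply: zm; rewrite inE eqxx.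
  by apply: le_trans za; apply: zm; rewrite inE yl orbT.
exists z; first by move: zl; rewrite !inE => /orP[->//|->]; rewrite !orbT.
move=> t; rewrite !inE => /or3P[/eqP->|/eqP->//|yl]; apply: zm; rewrite inE ?eqxx //.
by rewrite yl orbT.
Qed.

(* Fourier-Motzkin elimination of the coefficient of one generator. *)
Lemma dual_cons g G W : dual_of G W -> exists W', dual_of (g :: G) W'.
Proof.
move=> GW.
exists ([seq w <- W | 0 <= dot w g] ++
  [seq dot w1 g *: w2 - dot w2 g *: w1 | w1 <- [seq w <- W | 0 < dot w g],
                                         w2 <- [seq w <- W | dot w g < 0]]).
move=> x; split=> [/= [l l0 /GW xl] w|h].
  have le v : v \in W -> l * dot v g <= dot v x.
    by move=> /xl; rewrite dotBr dotZr subr_ge0.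
  rewrite mem_cat => /orP[|/allpairsP[[w1 w2] /= []]].
    by rewrite mem_filter => /andP[wg /le]; apply: le_trans; apply: mulr_ge0.
  rewrite !mem_filter => /andP[w1g /le w1l] /andP[w2g /le w2l] ->.
  rewrite dotBl !dotZl; nra.
(* Forms negative on g bound its coefficient from below; the largest such bound, or 0, satisfies the
   remaining conditions. *)
pose lows := [seq dot w x / dot w g | w <- W & dot w g < 0].
have [l ll lm] := seq_max 0 lows.
exists l; first by apply: lm; rewrite inE eqxx.
apply/GW => w wW; rewrite dotBr dotZr subr_ge0.
have [w0|w0|w0] := ltgtP (dot w g) 0.
- rewrite -ler_ndivrMr //; apply: lm; rewrite inE; apply/orP; right.
  by apply/mapP; exists w; rewrite ?mem_filter ?w0.
- move: ll; rewrite inE => /predU1P[->|/mapP[w2]].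
    rewrite mul0r; apply: h; rewrite mem_cat mem_filter (ltW w0) wW //.
  rewrite mem_filter => /andP[w2g w2W] ->.
  have : 0 <= dot (dot w g *: w2 - dot w2 g *: w) x.
    apply: h; rewrite mem_cat; apply/orP; right; apply/allpairsP; exists (w, w2).
    by rewrite !mem_filter w0 w2g.
  rewrite dotBl !dotZl subr_ge0 mulrAC ler_ndivrMr // => h'.
  by rewrite [leLHS]mulrC [leRHS]mulrC.
- rewrite w0 mulr0; apply: h; rewrite mem_cat mem_filter w0 lexx wW //.
Qed.

Lemma cone_dual G : exists W, dual_of G W.
Proof.
elim: G => [|g G [W GW]]; last exact: dual_cons GW.
exists ([seq delta_mx 0 i | i <- enum 'I_m] ++ [seq - delta_mx 0 i | i <- enum 'I_m]).
have dE x i : dot (delta_mx 0 i) x = x 0 i by rewrite /dot -rowE !mxE.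
move=> x; split=> [-> w _|h]; first by rewrite dot0r.
apply/rowP => i; rewrite mxE; apply/eqP; rewrite eq_le -oppr_ge0 -!dE.
rewrite -mulN1r -dotZl scaleN1r !h // mem_cat; apply/orP.
  by left; apply/mapP; exists i; rewrite ?mem_enum.
by right; apply/mapP; exists i; rewrite ?mem_enum.
Qed.

Section Dual.
Variables (G W : seq vect).
Hypothesis GW : dual_of G W.

Lemma coneD x y : cone G x -> cone G y -> cone G (x + y).
Proof.
by move=> /GW hx /GW hy; apply/GW => w wW; rewrite dotDr addr_ge0 ?hx ?hy.
Qed.

Lemma coneZ a x : 0 <= a -> cone G x -> cone G (a *: x).
Proof. by move=> a0 /GW hx; apply/GW => w wW; rewrite dotZr mulr_ge0 ?hx. Qed.

Lemma cone0 : cone G 0.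
Proof. by apply/GW => w _; rewrite dot0r. Qed.

(** l is the least ratio [dot w x / dot w g] over the forms w positive on g, found as a maximum of
    negatives. A form attaining it vanishes on the remainder, and w0 ensures that there is such a
    ratio. *)
Lemma cone_reduce x g w0 : w0 \in W -> 0 < dot w0 g -> cone G x ->
  exists2 l, 0 <= l & cone G (x - l *: g) /\
    exists w, [/\ w \in W, dot w (x - l *: g) = 0 & 0 < dot w g].
Proof.
move=> w0W w0g /GW xC; pose ups := [seq - (dot w x / dot w g) | w <- W & 0 < dot w g].
have [z zl zm] := seq_max (- (dot w0 x / dot w0 g)) ups.
have {zl}[w1 [w1W w1g Ez]] : exists w, [/\ w \in W, 0 < dot w g & z = - (dot w x / dot w g)].
  move: zl; rewrite inE => /predU1P[->|/mapP[w]]; first by exists w0.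
  by rewrite mem_filter => /andP[wg wW] ->; exists w.
exists (- z); first by rewrite Ez opprK divr_ge0 ?xC // ltW.
split; last first.
  exists w1; split=> //; rewrite dotBr dotZr Ez opprK divfK ?subrr //.
  by rewrite gt_eqF.
apply/GW => w wW; rewrite dotBr dotZr subr_ge0.
have [wg|wg] := lerP (dot w g) 0.
  apply: le_trans (xC w wW); rewrite mulr_ge0_le0 // Ez opprK divr_ge0 ?xC //.
  exact: ltW.
rewrite -ler_pdivlMr // lerNl; apply: zm; rewrite inE; apply/orP; right.
by apply/mapP; exists w; rewrite ?mem_filter ?wg.
Qed.

End Dual.

Lemma cone_mem G g : g \in G -> cone G g.
Proof.
elim: G => // h G IH; rewrite inE => /predU1P[->|/IH gG].
  by exists 1; rewrite ?ler01 // scale1r subrr; have [W /cone0] := cone_dual G.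
by exists 0; rewrite // scale0r subr0.
Qed.

(** Some N x is a sum of elements of G. Quantification over all additively closed P expresses this
    without carrying coefficients along. *)
Lemma cone_clear_denominators G x : cone G x -> exists2 N : nat, (0 < N)%N &
  forall P : vect -> Prop, P 0 -> (forall y z, P y -> P z -> P (y + z)) ->
    (forall g, g \in G -> P g) -> P (N%:R *: x).
Proof.
elim: G x => [|g G IH] x /=; first by move=> ->; exists 1%N => // P P0 _ _; rewrite scaler0.
move=> [l l0 /IH[N N0 NP]]; pose q := absz (denq l); pose p := absz (numq l).
have q0 : (0 < q)%N by rewrite absz_gt0 denq_eq0.
exists (N * q)%N; first by rewrite muln_gt0 N0.
move=> P P0 PD PG.
have Pn y k : P y -> P (k%:R *: y).
  by move=> Py; elim: k => [|k IHk]; rewrite ?scale0r // mulrS scalerDl scale1r; apply: PD.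
have -> : (N * q)%:R *: x = (N * p)%:R *: g + q%:R *: (N%:R *: (x - l *: g)).
  have El : l = p%:R / q%:R.
    rewrite -{1}[l]divq_num_den -[numq l]gez0_abs ?numq_ge0 // -[denq l]gez0_abs ?denq_ge0 //.
  have qN0 : q%:R != 0 :> rat by rewrite pnatr_eq0 -lt0n.
  rewrite scalerA scalerBr scalerA -natrM (_ : (q * N)%:R * l = (N * p)%:R).
    by rewrite addrCA subrr addr0 mulnC.
  by rewrite El !natrM; field.
apply: (PD); first by apply: Pn; apply: PG; rewrite inE eqxx.
apply: Pn; apply: (NP P P0 PD) => h hG; by apply: PG; rewrite inE hG orbT.
Qed.

End Cones.

(** * The cone of exponents of the Rees algebra *)

Section ReesCone.
Variables (n : nat) (E : pred 'X_{1..n}) (B : 'X_{1..n}).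
Implicit Types (a b c : 'X_{1..n}) (x w : 'rV[rat]_n.+1).
Hypotheses (Eu : up_closed E) (EB : forall a, E a -> E (mnm_min a B)).

(* The exponent of the monomial x^a t^k of S[t]. *)
Definition expo a (k : nat) : 'rV[rat]_n.+1 :=
  \row_i (if unlift ord0 i is Some j then (a j)%:R else k%:R).

Lemma expo0 : expo 0%MM 0 = 0.
Proof. by apply/rowP => i; rewrite !mxE; case: unliftP => // j _; rewrite mnm0E. Qed.

Lemma expoD a b k l : expo (a + b)%MM (k + l) = expo a k + expo b l.
Proof.
apply/rowP => i; rewrite !mxE; case: unliftP => [j|] _; last by rewrite natrD.
by rewrite mnmDE natrD.
Qed.

Lemma expoM a k N : expo (a *+ N)%MM (N * k) = N%:R *: expo a k.
Proof.
apply/rowP => i; rewrite !mxE; case: unliftP => [j|] _; last by rewrite natrM.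
by rewrite mulmnE mulnC natrM.
Qed.

Lemma expo_inj a b k l : expo a k = expo b l -> a = b /\ k = l.
Proof.
move=> /rowP e; split.
  apply/mnmP => j; have := e (lift ord0 j); rewrite !mxE liftK => /eqP.
  by rewrite eqr_nat => /eqP.
by have := e ord0; rewrite !mxE unlift_none => /eqP; rewrite eqr_nat => /eqP.
Qed.

Definition rees_gens : seq 'rV[rat]_n.+1 :=
  [seq expo U_(j)%MM 0 | j <- enum 'I_n] ++
  [seq expo (bmnm g) 1 | g : 'X_{1..n < (mdeg B).+1} <- enum {: 'X_{1..n < (mdeg B).+1}} & E (bmnm g)].

Lemma rees_gens_var j : expo U_(j)%MM 0 \in rees_gens.
Proof. by rewrite mem_cat; apply/orP; left; apply/mapP; exists j; rewrite ?mem_enum. Qed.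

Lemma mdeg_min_le a : (mdeg (mnm_min a B) < (mdeg B).+1)%N.
Proof. by rewrite ltnS !mdegE; apply: leq_sum => i _; rewrite mnmE geq_minr. Qed.

Lemma rees_gens_gen a : E a -> expo (mnm_min a B) 1 \in rees_gens.
Proof.
move=> Ea; rewrite mem_cat; apply/orP; right; apply/mapP.
exists (BMultinom (mdeg_min_le a)) => //.
by rewrite mem_filter mem_enum /= andbT; apply: EB.
Qed.

Lemma rees_gensP x : x \in rees_gens ->
  (exists j, x = expo U_(j)%MM 0) \/ (exists2 g, E g & x = expo g 1).
Proof.
rewrite mem_cat => /orP[/mapP[j _ ->]|/mapP[g]]; first by left; exists j.
by rewrite mem_filter => /andP[Eg _] ->; right; exists (bmnm g).
Qed.

Variable W : seq 'rV[rat]_n.+1.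
Hypothesis GW : dual_of rees_gens W.
Local Notation C := (cone rees_gens).

Lemma cone_expo0 a : C (expo a 0).
Proof.
have -> : expo a 0 = \sum_j (a j)%:R *: expo U_(j)%MM 0.
  apply/rowP => i; rewrite summxE mxE; case: unliftP => [j ->|->]; last first.
    by rewrite big1 // => k _; rewrite !mxE unlift_none mulr0.
  rewrite (bigD1 j) //= !mxE liftK mnm1E eqxx mulr1 big1 ?addr0 // => k kj.
  by rewrite !mxE liftK mnm1E (negPf kj) mulr0.
apply: (big_ind C) => [|x y|j _]; first exact: cone0 GW.
  exact: (coneD GW).
by apply: (coneZ GW) => //; apply: cone_mem; apply: rees_gens_var.
Qed.

Lemma cone_expo_mpow a k : mpow E k a -> C (expo a k).
Proof.
elim: k a => [|k IH] a; first by move=> _; apply: cone_expo0.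
move=> /asboolP[b [c [-> Eb /IH cC]]]; rewrite -(add1n k) expoD; apply: (coneD GW) => //.
have /mnm_lepP le : (mnm_min b B <= b)%MM by apply/mnm_lepP => i; rewrite mnmE geq_minl.
have -> : expo b 1 = expo (b - mnm_min b B)%MM 0 + expo (mnm_min b B) 1.
  by rewrite -expoD submK //; apply/mnm_lepP.
by apply: (coneD GW); [apply: cone_expo0 | apply/cone_mem/rees_gens_gen].
Qed.

Lemma mpow_cone_expo a k : C (expo a k) -> exists2 N, (0 < N)%N & mpow E (N * k) (a *+ N)%MM.
Proof.
move=> /cone_clear_denominators[N N0 NP]; exists N => //.
have [b [l [Ebl]]] : exists b l, expo (a *+ N)%MM (N * k) = expo b l /\ mpow E l b.
  rewrite expoM; apply: (NP (fun x => exists b l, x = expo b l /\ mpow E l b)).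
  - by exists 0%MM, 0%N; rewrite expo0.
  - move=> _ _ [b [l [-> Eb]]] [c [p [-> Ec]]]; exists (b + c)%MM, (l + p)%N.
    by rewrite expoD; split=> //; apply: mpowD.
  - move=> x /rees_gensP[[j ->]|[g Eg ->]]; first by exists U_(j)%MM, 0%N.
    by exists g, 1%N; rewrite mpow1.
by have [-> ->] := expo_inj Ebl.
Qed.

(** Integrality of a monomial: an equation of the form f^N = c with c in I^N is enough. *)
Definition mclos F a : bool := `[< exists2 N, (0 < N)%N & @mpow n F N (a *+ N)%MM >].

Lemma mclosP a : mclos E a <-> C (expo a 1).
Proof.
split=> [/asboolP[N N0 /cone_expo_mpow]|/mpow_cone_expo[N N0]].
  rewrite -[N in expo _ N]muln1 expoM => h.
  have N0' : N%:R != 0 :> rat by rewrite pnatr_eq0 -lt0n.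
  have := coneZ GW (_ : 0 <= N%:R^-1) h; rewrite scalerA mulVf // scale1r; apply.
  by rewrite invr_ge0 ler0n.
by rewrite muln1 => h; apply/asboolP; exists N.
Qed.

Lemma mpow_separate a : ~~ mclos E a -> exists w,
  (forall b i, mpow E i b -> 0 <= dot w (expo b i)) /\ dot w (expo a 1) < 0.
Proof.
move=> na; have : ~ C (expo a 1) by move=> /mclosP h; rewrite h in na.
move=> /GW/existsNP[w /not_implyP[wW /negP]]; rewrite -ltNge => wa.
by exists w; split=> // b i /cone_expo_mpow/GW; apply.
Qed.

End ReesCone.

(** * The integral closure of a monomial ideal is monomial *)

Section ClosureMonomial.
Variables (K : fieldType) (n : nat).
Local Notation S := {mpoly K[n]}.
Implicit Types (a b c : 'X_{1..n}) (f g : S).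

Definition supp_in (Q : 'X_{1..n} -> Prop) f := forall a, a \in msupp f -> Q a.

Lemma supp_in0 Q : supp_in Q 0.
Proof. by move=> a; rewrite msupp0. Qed.

Lemma supp_inD Q f g : supp_in Q f -> supp_in Q g -> supp_in Q (f + g).
Proof. by move=> fQ gQ a /msuppD_le; rewrite mem_cat => /orP[/fQ|/gQ]. Qed.

Lemma supp_inN Q f : supp_in Q f -> supp_in Q (- f).
Proof. by move=> fQ a; rewrite (perm_mem (msuppN f)) => /fQ. Qed.

Lemma supp_inM (Q1 Q2 Q : 'X_{1..n} -> Prop) f g :
  (forall a b, Q1 a -> Q2 b -> Q (a + b)%MM) ->
  supp_in Q1 f -> supp_in Q2 g -> supp_in Q (f * g).
Proof.
by move=> QQ fQ gQ a /msuppM_le/allpairsP[[b c] /= [/fQ Qb /gQ Qc ->]]; apply: QQ.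
Qed.

Definition mrestrict (P : pred 'X_{1..n}) f : S :=
  \sum_(a <- msupp f) (if P a then f@_a else 0) *: 'X_[a].

Lemma mcoeff_restrict P f a : (mrestrict P f)@_a = if P a then f@_a else 0.
Proof.
rewrite /mrestrict raddf_sum /=; have [af|af] := boolP (a \in msupp f).
  rewrite (bigD1_seq a) //= mcoeffZ mcoeffX eqxx mulr1 big1 ?addr0 // => b ba.
  by rewrite mcoeffZ mcoeffX (negPf ba) mulr0.
rewrite (memN_msupp_eq0 af) if_same big_seq big1 // => b bf.
rewrite mcoeffZ mcoeffX; case: eqP => [E|_]; last by rewrite mulr0.
by rewrite -E bf in af.
Qed.

Lemma supp_in_power (wt : 'X_{1..n} -> rat) v f k :
  wt 0%MM = 0 -> (forall a b, wt (a + b)%MM = wt a + wt b) ->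
  supp_in (fun a => v <= wt a) f -> supp_in (fun a => k%:R * v <= wt a) (f ^+ k).
Proof.
move=> wt0 wtD fv; elim: k => [|k IH].
  by rewrite expr0 => a; rewrite msupp1 mem_seq1 => /eqP->; rewrite wt0 mul0r.
rewrite exprS; apply: supp_inM fv IH => a b; rewrite wtD mulrS mulrDl mul1r; exact: lerD.
Qed.

(* If f t had a term of negative weight, its part of minimal weight would survive in
   (f t)^k, whereas the other terms of an integral equation have larger weights. *)
Lemma integral_closure_weight E (f : S) (w : 'rV[rat]_n.+1) : up_closed E ->
  (forall b i, mpow E i b -> 0 <= dot w (expo b i)) ->
  integral_closure (@mideal K n E) f -> supp_in (fun a => 0 <= dot w (expo a 1)) f.
Proof.
move=> Eu wE [k [c [k0 cE fk]]] a af; rewrite leNgt; apply/negP => wa.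
pose wt b := dot w (expo b 0); pose tau := dot w (expo 0%MM 1).
have wtE b i : dot w (expo b i) = wt b + i%:R * tau.
  rewrite /wt /tau -dotZr -dotDr; congr (dot w _).
  by rewrite -[b in LHS]addm0 -[i in LHS]add0n expoD -[i in LHS]muln1 -[0%MM in LHS](_ : 0 *+ i = 0)%MM ?expoM //;
    apply/mnmP => j; rewrite mulmnE mnm0E.
have wt0 : wt 0%MM = 0 by rewrite /wt expo0 dot0r.
have wtD b d : wt (b + d)%MM = wt b + wt d by rewrite /wt -[0%N in LHS]addn0 expoD dotDr.
(* [v] will be the least weight of a monomial of f, computed as the negative of a maximum. *)
have [z zl zm] := seq_max (- wt a) [seq - wt b | b <- msupp f].
pose v := - z.
have fv : supp_in (fun b => v <= wt b) f.
  by move=> b bf; rewrite /v lerNl; apply: zm; rewrite inE; apply/orP; right; apply/mapP; exists b.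
have [b0 b0f b0v] : exists2 b0, b0 \in msupp f & wt b0 = v.
  move: zl; rewrite inE => /predU1P[Ez|/mapP[b bf Ez]].
    by exists a => //; rewrite /v Ez opprK.
  by exists b => //; rewrite /v Ez opprK.
have vtau : v < - tau.
  have := fv a af; move: wa; rewrite wtE mul1r -ltrBrDr sub0r => wa va.
  exact: le_lt_trans va wa.
pose P b := wt b == v; pose fm := mrestrict P f.
have fm_v : supp_in (fun b => wt b = v) fm.
  by move=> b; rewrite mcoeff_msupp mcoeff_restrict; case: ifP => [/eqP|]; rewrite ?eqxx.
have fm0 : fm != 0.
  apply: contraTneq b0f => fm0; rewrite mcoeff_msupp negbK.
  have := mcoeff_restrict P f b0; rewrite -/fm fm0 mcoeff0 /P b0v eqxx => <- //.
have fr : supp_in (fun b => v < wt b) (f - fm).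
  move=> b; rewrite mcoeff_msupp mcoeffB mcoeff_restrict; case: ifPn => [_|ne].
    by rewrite subrr eqxx.
  by rewrite subr0 -mcoeff_msupp lt_neqAle eq_sym ne => /fv.
have fmpow j : supp_in (fun b => wt b = j%:R * v) (fm ^+ j).
  elim: j => [|j IH]; first by move=> b; rewrite msupp1 mem_seq1 => /eqP->; rewrite wt0 mul0r.
  rewrite exprS; apply: supp_inM fm_v IH => b d hb hd.
  by rewrite wtD hb hd mulrS mulrDl mul1r.
have diff j : supp_in (fun b => j%:R * v < wt b) (f ^+ j - fm ^+ j).
  elim: j => [|j IH]; first by rewrite subrr; apply: supp_in0.
  have -> : f ^+ j.+1 - fm ^+ j.+1 = f * (f ^+ j - fm ^+ j) + (f - fm) * fm ^+ j.
    by rewrite !exprS; ring.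
  apply: supp_inD.
    apply: supp_inM fv IH => b d hb hd; rewrite wtD mulrS mulrDl mul1r; exact: ler_ltD.
  apply: supp_inM fr (fmpow j) => b d hb hd; rewrite wtD hd mulrS mulrDl mul1r ltrD2r //.
(* The monomials of c i have weight at least [- i * tau], which exceeds [i * v], and those of
   f^(k-i) at least [(k - i) * v]. *)
have sum_gt : supp_in (fun b => k%:R * v < wt b) (\sum_(1 <= i < k.+1) c i * f ^+ (k - i)).
  rewrite big_nat; apply: (big_ind (supp_in _)) => [|g h|i ik]; first exact: supp_in0.
    exact: supp_inD.
  have ci : supp_in (fun b => - (i%:R * tau) <= wt b) (c i).
    have := cE i; rewrite -[(i <= k)%N]ltnS ik ideal_exp_mideal // => /(_ isT) cI b /cI/wE.
    by rewrite wtE -lerBlDr sub0r.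
  apply: supp_inM ci (supp_in_power (k := k - i) wt0 wtD fv) => b d hb hd.
  rewrite wtD; apply: lt_le_trans (lerD hb hd).
  have /andP[i0 ik'] := ik.
  rewrite natrB // mulrBl addrCA ltrDl -opprD oppr_gt0 -mulrDr pmulr_rlt0 ?ltr0n //.
  by rewrite addrC -ltrBrDr sub0r.
have : fm ^+ k = 0.
  apply: msuppnil0; case E0 : (msupp _) => [//|b s]; have bs : b \in msupp (fm ^+ k).
    by rewrite E0 inE eqxx.
  have Eb := fmpow k b bs.
  have : supp_in (fun b => k%:R * v < wt b) (fm ^+ k).
    have -> : fm ^+ k = - ((f ^+ k - fm ^+ k) + \sum_(1 <= i < k.+1) c i * f ^+ (k - i)).
      by rewrite addrAC fk sub0r opprK.
    by apply: supp_inN; apply: supp_inD; [apply: diff | apply: sum_gt].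
  by move=> /(_ b bs); rewrite Eb ltxx.
by move/eqP; rewrite expf_eq0 (negPf fm0) andbF.
Qed.

Lemma integral_closure_mideal E : up_closed E ->
  integral_closure (@mideal K n E) = @mideal K n (mclos E).
Proof.
move=> Eu; have [B EB] := dickson_bound Eu; have [W GW] := cone_dual (rees_gens E B).
apply/seteqP; split=> [f fI a af|].
  apply/negPn/negP => /(mpow_separate Eu EB GW)[w [wE wa]].
  by have := integral_closure_weight Eu wE fI af; rewrite leNgt wa.
apply: mideal_sub; first exact: integral_closure_ideal.
move=> a /asboolP[N N0 Ea]; exists N, (fun i => if i == N then - 'X_[a *+ N] else 0).
split=> // [i _|].
  have [I0 _ IM] := ideal_exp_ideal (@mideal K n E) i.
  case: eqP => [EiN|_] //; rewrite -mulN1r; apply: IM; rewrite EiN.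
  by rewrite ideal_exp_mideal //; apply/midealX.
rewrite big_nat_recr //= eqxx subnn expr0 mulr1 mpolyXn big_nat big1 ?add0r ?subrr //.
by move=> i /andP[_ iN]; rewrite (ltn_eqF iN) mul0r.
Qed.

Lemma mclos_up (E : pred 'X_{1..n}) : up_closed E -> up_closed (mclos E).
Proof.
move=> Eu a b ab /asboolP[N N0 Ea]; apply/asboolP; exists N => //.
apply: mpow_up Ea => //; apply/mnm_lepP => i; rewrite !mulmnE leq_mul2r.
by move/mnm_lepP: ab => ->; rewrite orbT.
Qed.

End ClosureMonomial.

(** * Analytic spread *)

Section IdealFacts.
Variables (R : comNzRingType) (P : set R).

Lemma ideal_sub a b : is_ideal P -> P a -> P b -> P (a - b).
Proof. by move=> [_ PD PM] Pa Pb; apply: PD => //; rewrite -mulN1r; apply: PM. Qed.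

Lemma ideal_mulr a b : is_ideal P -> P a -> P (a * b).
Proof. by move=> [_ _ PM] Pa; rewrite mulrC; apply: PM. Qed.

Lemma ideal_sum (I : Type) (r : seq I) (p : pred I) (f : I -> R) :
  is_ideal P -> (forall i, p i -> P (f i)) -> P (\sum_(i <- r | p i) f i).
Proof. by move=> [P0 PD _] h; apply: (big_ind P). Qed.

Lemma prime_ideal_pow a k b : is_prime_ideal P -> P (a ^+ k * b) -> ~ P a -> P b.
Proof.
move=> [PI P1 Pp] + Pa; elim: k => [|k IH]; first by rewrite expr0 mul1r.
by rewrite exprS -mulrA => /Pp[//|/IH].
Qed.

End IdealFacts.

(** * Algebraic dependence and chains of primes in a polynomial ring *)

Section PolynomialDimension.
Variables (K : fieldType) (N : nat).
Local Notation S := {mpoly K[N]}.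

Definition deg_le d (f : S) := supp_in (fun a => (mdeg a <= d)%N) f.

Lemma deg_leM d e f g : deg_le d f -> deg_le e g -> deg_le (d + e) (f * g).
Proof.
by move=> fd ge; apply: supp_inM fd ge => a b ad be; rewrite mdegD leq_add.
Qed.

Lemma deg_le1 d : deg_le d 1.
Proof. by move=> a; rewrite msupp1 mem_seq1 => /eqP->; rewrite mdeg0. Qed.

Lemma deg_leX d k f : deg_le d f -> deg_le (k * d) (f ^+ k).
Proof.
move=> fd; elim: k => [|k IH]; first exact: deg_le1.
by rewrite exprS mulSn; apply: deg_leM.
Qed.

Lemma deg_le_prod (I : Type) (r : seq I) (p : pred I) d (f : I -> S) :
  (forall i, p i -> deg_le (d i) (f i)) ->
  deg_le (\sum_(i <- r | p i) d i) (\prod_(i <- r | p i) f i).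
Proof.
move=> h; elim: r => [|i r IH]; first by rewrite !big_nil; apply: deg_le1.
by rewrite !big_cons; case: ifP => // /h hi; apply: deg_leM.
Qed.

Lemma deg_le_trans d e f : (d <= e)%N -> deg_le d f -> deg_le e f.
Proof. by move=> de fd a /fd/leq_trans; apply. Qed.

Lemma mpoly_dependent (p : 'I_N.+1 -> S) : exists q (c : {ffun 'I_N.+1 -> 'I_q} -> K),
  (exists e, c e != 0) /\ \sum_e c e *: \prod_i p i ^+ e i = 0.
Proof.
(* A count: there are q^(N+1) products with exponents below q, whose monomials have all exponents
   below D. Since D <= M q and q = M^N + 1, one has D^N <= M^N q^N < q^(N+1), so the coefficient
   matrix has a kernel. *)
pose d0 := (\max_i msize (p i))%N; pose M := (N.+1 * d0 + 1)%N.
pose q := (M ^ N).+1; pose D := (N.+1 * q * d0).+1.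
have pd i : deg_le d0 (p i).
  by move=> a /msize_mdeg_lt/ltnW/leq_trans; apply; rewrite /d0 (bigD1 i) //= leq_maxl.
pose T := {ffun 'I_N.+1 -> 'I_q}; pose U := {ffun 'I_N -> 'I_D}.
have prodD (e : T) : deg_le (N.+1 * q * d0) (\prod_i p i ^+ e i).
  apply: (deg_le_trans (d := \sum_(i < N.+1) e i * d0)).
    rewrite -mulnA -[X in (_ <= X * _)%N]card_ord -sum_nat_const; apply: leq_sum => i _.
    by rewrite leq_mul2r ltnW ?orbT.
  by apply: deg_le_prod => i _; apply: deg_leX.
pose mon (u : U) : 'X_{1..N} := [multinom (u j : nat) | j < N].
pose A : 'M[K]_(#|T|, #|U|) := \matrix_(r, s) (\prod_i p i ^+ (enum_val r : T) i)@_(mon (enum_val s)).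
have ltTU : (#|U| < #|T|)%N.
  rewrite !card_ffun !card_ord.
  have DM : (D <= M * q)%N by rewrite /D /M /q; nia.
  have expn_mono x y e : (x <= y -> x ^ e <= y ^ e)%N.
    by move=> xy; elim: e => // e IH; rewrite !expnS leq_mul.
  apply: (leq_ltn_trans (expn_mono _ _ N DM)).
  by rewrite expnMn expnS ltn_mul2r expn_gt0 /= /q ltnS leqnn.
have kA : kermx A != 0.
  rewrite -mxrank_eq0 mxrank_ker subn_eq0 -ltnNge.
  exact: leq_ltn_trans (rank_leq_col A) ltTU.
pose v := nz_row (kermx A).
have vA : v *m A = 0 by apply/sub_kermxP; apply: nz_row_sub.
exists q, (fun e => v 0 (enum_rank e)); split.
  have : v != 0 by rewrite nz_row_eq0.
  by move=> /rV0Pn[r vr]; exists (enum_val r); rewrite enum_valK.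
apply/mpolyP => a; rewrite mcoeff0 raddf_sum /=.
have [aD|aD] := leqP (mdeg a) (N.+1 * q * d0); last first.
  apply: big1 => e _; rewrite mcoeffZ; apply/eqP; rewrite mulf_eq0; apply/orP; right.
  by rewrite mcoeff_eq0; apply/negP => /prodD; rewrite leqNgt aD.
have aj j : (a j < D)%N.
  by rewrite ltnS (leq_trans _ aD) // mdegE (bigD1 j) //= leq_addr.
pose u : U := [ffun j => Ordinal (aj j)].
have Eu : mon u = a by apply/mnmP => j; rewrite mnmE ffunE.
have := congr1 (fun x : 'rV_ _ => x 0 (enum_rank u)) vA; rewrite !mxE => E0; rewrite -[RHS]E0.
rewrite [RHS](reindex_onto (@enum_rank T) enum_val) => [|? _]; last exact: enum_valK.
apply: eq_big => [e|e _]; first by rewrite enum_rankK eqxx.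
by rewrite mcoeffZ mxE !enum_rankK Eu.
Qed.

(** If d > N, elements p_i of P_(i+1) outside P_i, for i <= N, are algebraically dependent. At stage
    i the relation, known to lie in P_i, is divided by the largest common power of p_i; its terms
    still divisible by p_i lie in P_(i+1) and are dropped. In the end a single coefficient, a unit,
    lies in P_(N+1). *)
Lemma mpoly_chain d (P : nat -> set S) : prime_chain d P -> (d <= N)%N.
Proof.
move=> [Pp Pl]; rewrite leqNgt; apply/negP => Nd.
have Psub i : (i < d)%N -> P i `<=` P i.+1 by move=> /Pl/properW.
have /choice[p pP] (i : 'I_N.+1) : exists f, P i.+1 f /\ ~ P i f.
  have id : (i < d)%N by apply: leq_trans (ltn_ord i) Nd.
  by have [_ /nonsubset[f [f1 f2]]] := Pl i id; exists f.
have [q [c [[e0 ce0] rel]]] := mpoly_dependent p.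
pose T := {ffun 'I_N.+1 -> 'I_q}.
suff ind i : (i <= N.+1)%N -> exists A : pred T, [/\ exists e, A e, forall e, A e -> c e != 0,
    P i (\sum_(e | A e) c e *: \prod_(j < N.+1 | (i <= j)%N) p j ^+ e j)
    & forall e e' (j : 'I_N.+1), A e -> A e' -> (j < i)%N -> e j = e' j].
  have [A [[e eA] cA PA agree]] := ind N.+1 (leqnn _).
  have EA e' : A e' = (e' == e).
    apply/idP/eqP => [e'A|->//].
    by apply/ffunP => j; apply: agree.
  have [[_ _ PM] P1 _] := Pp N.+1 Nd; apply: P1.
  move: PA; rewrite (big_pred1 e) // big_pred0 => [Pc|j]; last by rewrite leqNgt ltn_ord.
  have -> : 1 = (c e)^-1%:MP * (c e *: 1) :> S.
    by rewrite mul_mpolyC scalerA mulVf ?scale1r // cA.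
  exact: PM.
elim: i => [|i IH] iN.
  exists (fun e => c e != 0); split=> //; first by exists e0.
  have -> : \sum_(e | c e != 0) c e *: \prod_(j < N.+1 | (0 <= j)%N) p j ^+ e j = 0.
    rewrite -[RHS]rel [RHS](bigID (fun e => c e != 0)) /= [X in _ = _ + X]big1 ?addr0 //.
    by move=> e; rewrite negbK => /eqP->; rewrite scale0r.
  by have [[]] := Pp 0%N isT.
have [A [[e1 e1A] cA PA agree]] := IH (ltnW iN).
pose i' : 'I_N.+1 := Ordinal iN; have [pi1 pi0] := pP i'.
have id : (i < d)%N by apply: leq_trans iN Nd.
have [t tA tmin] : exists2 t, A t & forall e, A e -> (t i' <= e i')%N.
  by case: (arg_minnP (fun e : T => e i' : nat) e1A) => t tA tm; exists t.
pose rest (e : T) := \prod_(j < N.+1 | (i.+1 <= j)%N) p j ^+ e j.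
have split_prod (e : T) : \prod_(j < N.+1 | (i <= j)%N) p j ^+ e j = p i' ^+ e i' * rest e.
  rewrite (bigD1 i') //=; congr (_ * _); apply: eq_bigl => j.
  by rewrite ltn_neqAle andbC eq_sym.
(* The prime P_i does not contain p_i, so the common power of p_i can be cancelled. *)
have PX : P i (\sum_(e | A e) c e *: (p i' ^+ (e i' - t i') * rest e)).
  apply: (prime_ideal_pow (a := p i') (k := t i') (Pp i (ltnW id))) => //.
  rewrite mulr_sumr; move: PA; congr (P i _); apply: eq_bigr => e eA.
  by rewrite split_prod -scalerAr mulrA -exprD subnKC // tmin.
have [PI _ _] := Pp i.+1 id.
exists (fun e => A e && (e i' == t i')); split=> [|e /andP[/cA]//||e e' j].
- by exists t; rewrite tA eqxx.
- have -> : \sum_(e | A e && (e i' == t i')) c e *: rest e =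
    \sum_(e | A e) c e *: (p i' ^+ (e i' - t i') * rest e) -
    \sum_(e | A e && (e i' != t i')) c e *: (p i' ^+ (e i' - t i') * rest e).
    rewrite [in RHS](bigID (fun e : T => e i' == t i')) /= addrK; apply: eq_bigr => e.
    by move=> /andP[_ /eqP->]; rewrite subnn expr0 mul1r.
  apply: (ideal_sub PI); first exact: Psub.
  apply: ideal_sum => // e /andP[eA ne].
  have lt : (0 < e i' - t i')%N by rewrite subn_gt0 ltn_neqAle eq_sym ne tmin.
  rewrite -(prednK lt) exprS -mulrA -mul_mpolyC mulrCA; exact: ideal_mulr.
- move=> /andP[eA /eqP Ee] /andP[e'A /eqP Ee']; rewrite ltnS leq_eqVlt.
  move=> /predU1P[ji|]; last exact: agree.
  by have -> : j = i' by [apply: val_inj]; rewrite Ee Ee'.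
Qed.

End PolynomialDimension.

(** * Primes of the fiber ring as primes of the Rees algebra above the maximal ideal *)

Section FiberChains.
Variables (K : fieldType) (n : nat) (I : set {mpoly K[n]}).
Local Notation Q := {ideal_quot (max_rees_pred (I := I))}.
Local Notation pi := (\pi_Q : rees I -> fiber_ring I).

Lemma max_rees_ideal : is_ideal (@max_rees K n I).
Proof. exact: ideal_gen_ideal. Qed.

Lemma fiber_eqP (x y : rees I) : pi x = pi y <-> max_rees (x - y).
Proof.
split=> [/eqP|h].
  by rewrite -[_ == _]/(x == y %[mod Q])%qT -Quotient.idealrBE => /asboolP.
apply/eqP; rewrite -[_ == _]/(x == y %[mod Q])%qT -Quotient.idealrBE.
exact/asboolP.
Qed.

Definition rees_chain d (P : nat -> set (rees I)) :=
  prime_chain d P /\ @max_rees K n I `<=` P 0%N.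

Lemma fiber_to_rees d (P : nat -> set (fiber_ring I)) : prime_chain d P ->
  rees_chain d (fun i => pi @^-1` P i).
Proof.
move=> [Pp Pl]; split; last first.
  move=> x mx /=; have [[P0 _ _] _ _] := Pp 0%N isT.
  have -> : pi x = 0; last exact: P0.
  by rewrite -[RHS](rmorph0 (\pi_Q)) ; apply/fiber_eqP; rewrite subr0.
split=> [i id|i id].
  have [[P0 PD PM] P1 Pmul] := Pp i id; split.
  - split=> [|a b|a b] /=.
    + by rewrite rmorph0.
    + by rewrite rmorphD; apply: PD.
    + by rewrite rmorphM; apply: PM.
  - by rewrite /= rmorph1.
  - by move=> a b /=; rewrite rmorphM; apply: Pmul.
have [le /nonsubset[f [f1 f2]]] := Pl i id; split=> [x /le//|].
by move=> h; apply: f2; have := h (repr f); rewrite /= reprK; apply.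
Qed.

Lemma rees_chain_sub d (P : nat -> set (rees I)) i : rees_chain d P -> (i <= d)%N ->
  @max_rees K n I `<=` P i.
Proof.
move=> [[_ Pl] P0]; elim: i => // i IH id x mx.
by have [le _] := Pl i id; apply: le; apply: IH mx; apply: ltnW.
Qed.

Lemma rees_to_fiber d (P : nat -> set (rees I)) : rees_chain d P ->
  prime_chain d (fun i => [set q : fiber_ring I | P i (repr q)]).
Proof.
move=> ch; have [[Pp Pl] _] := ch.
have PE i x : (i <= d)%N -> P i (repr (pi x)) <-> P i x.
  move=> id; have [PI _ _] := Pp i id; have := rees_chain_sub ch id.
  have : max_rees (repr (pi x) - x) by apply/fiber_eqP; rewrite reprK.
  move=> mx /(_ _ mx) Px; split=> h.
    by rewrite -[x](subKr (repr (pi x))); apply: ideal_sub.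
  by rewrite -[repr _](subrK x); have [_ PD _] := PI; apply: PD.
split=> [i id|i id].
  have [[P0 PD PM] P1 Pmul] := Pp i id; split.
  - split=> [|a b|a b] /=.
    + by rewrite -(rmorph0 (\pi_Q)); apply/PE.
    + by rewrite -[a]reprK -[b]reprK -rmorphD => /(PE _ _ id) ha /(PE _ _ id) hb; apply/PE => //; apply: PD.
    + by rewrite -[a]reprK -[b]reprK -rmorphM => /(PE _ _ id) hb; apply/PE => //; apply: PM.
  - by rewrite /= -(rmorph1 (\pi_Q)) => /(PE _ _ id).
  - move=> a b /=; rewrite -{1}[a]reprK -{1}[b]reprK -rmorphM => /(PE _ _ id).
    exact: Pmul.
have [le /nonsubset[f [f1 f2]]] := Pl i id; split=> [q /le//|h].
by apply: f2; apply/(PE i f (ltnW id)); apply: h; apply/(PE i.+1 f id).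
Qed.

End FiberChains.

(** * Generators of the fiber ring and monomial primes of the Rees algebra *)

Section ReesAlgebra.
Variables (K : fieldType) (n : nat) (E : pred 'X_{1..n}) (B : 'X_{1..n}).
Hypotheses (Eu : up_closed E) (EB : forall a, E a -> E (mnm_min a B)).
Local Notation S := {mpoly K[n]}.
Local Notation I := (@mideal K n E).
Implicit Types (a b : 'X_{1..n}) (f g : {poly S}).

Definition psupp_in (Q : 'X_{1..n} -> nat -> Prop) f :=
  forall k a, a \in msupp f`_k -> Q a k.

Lemma rees_suppP f : f \in rees_pred I <-> psupp_in (fun a k => mpow E k a) f.
Proof.
split=> [/asboolP h k a|h]; first by have := h k; rewrite ideal_exp_mideal // => /(_ a).
by apply/asboolP => k; rewrite ideal_exp_mideal // => a; apply: h.
Qed.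

Lemma psupp_inD Q f g : psupp_in Q f -> psupp_in Q g -> psupp_in Q (f + g).
Proof. by move=> fQ gQ k; rewrite coefD; apply: supp_inD (fQ k) (gQ k). Qed.

Lemma psupp_inN Q f : psupp_in Q f -> psupp_in Q (- f).
Proof. by move=> fQ k; rewrite coefN; apply: supp_inN (fQ k). Qed.

Lemma psupp_inM (Q1 Q2 Q : 'X_{1..n} -> nat -> Prop) f g :
  (forall a b k l, Q1 a k -> Q2 b l -> Q (a + b)%MM (k + l)%N) ->
  psupp_in Q1 f -> psupp_in Q2 g -> psupp_in Q (f * g).
Proof.
move=> QQ fQ gQ k; rewrite coefM; apply: (big_ind (supp_in (Q^~ k))).
- exact: supp_in0.
- by move=> p q; apply: supp_inD.
move=> i _; apply: supp_inM (fQ i) (gQ (k - i)%N) => a b h1 h2.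
by rewrite -(subnKC (ltn_ord i : i <= k)%N); apply: QQ.
Qed.

Definition pmonomial (c : K) a k : {poly S} := (c *: 'X_[a]) *: 'X^k.

Lemma pmonomial_supp Q c a k : Q a k -> psupp_in Q (pmonomial c a k).
Proof.
move=> Qa l b; rewrite coefZ coefXn; case: eqP => [->|_]; last by rewrite mulr0 msupp0.
by rewrite mulr1 => /msuppZ_le; rewrite msuppX mem_seq1 => /eqP->.
Qed.

Lemma pmonomial_rees c a k : mpow E k a -> pmonomial c a k \in rees_pred I.
Proof. by move=> Ea; apply/rees_suppP; apply: pmonomial_supp. Qed.

Lemma pmonomialM c d a b k l :
  pmonomial c a k * pmonomial d b l = pmonomial (c * d) (a + b)%MM (k + l).
Proof.
by rewrite /pmonomial -scalerAl -scalerAr scalerA -exprD -scalerAl -scalerAr scalerA mpolyXD.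
Qed.

Lemma poly_monomials f :
  f = \sum_(k < size f) \sum_(a <- msupp f`_k) pmonomial (f`_k)@_a a k.
Proof.
rewrite -{1}[f]coefK poly_def; apply: eq_bigr => k _.
by rewrite {1}[f`_k]mpolyE scaler_suml.
Qed.

Lemma max_rees_monomial (x : rees I) c a k j : val x = pmonomial c a k ->
  (0 < a j)%N -> mpow E k (a - U_(j))%MM -> max_rees x.
Proof.
move=> xE aj Ea.
have Xj : ('X_j : S)%:P \in rees_pred I.
  apply/rees_suppP => l b; rewrite coefC; case: eqP => [-> _|_]; last by rewrite msupp0.
  by [].
have -> : x = Rees (pmonomial_rees c Ea) * Rees Xj.
  apply: val_inj; rewrite rmorphM /= -[LHS]/(val x) xE.
  have -> : ('X_j : S)%:P = pmonomial 1 U_(j)%MM 0.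
    by rewrite /pmonomial expr0 scale1r alg_polyC.
  by rewrite pmonomialM mulr1 addn0 submK // lep1mP -lt0n.
have [_ _ mM] := @max_rees_ideal _ _ I; apply: mM; apply: sub_ideal_gen.
by exists 'X_j => //; apply: sub_ideal_gen; exists j.
Qed.

Definition gen_seq : seq 'X_{1..n} :=
  [seq bmnm g | g : 'X_{1..n < (mdeg B).+1} <- enum {: 'X_{1..n < (mdeg B).+1}} & E (bmnm g)].

Lemma gen_seqE b : b \in gen_seq -> E b.
Proof. by case/mapP=> h; rewrite mem_filter => /andP[Eh _] ->. Qed.

Lemma gen_seq_min a : E a -> mnm_min a B \in gen_seq.
Proof.
move=> Ea; apply/mapP; exists (BMultinom (mdeg_min_le B a)) => //.
by rewrite mem_filter mem_enum /= andbT; apply: EB.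
Qed.

Local Notation N := (size gen_seq).

Definition rees_eval (p : {mpoly K[N]}) : {poly S} :=
  mmap (polyC \o @mpolyC n K) (fun i : 'I_N => pmonomial 1 (nth 0%MM gen_seq i) 1) p.

Lemma pmonomial_const (c : K) : c%:MP%:P = pmonomial c 0%MM 0.
Proof. by rewrite /pmonomial mpolyX0 expr0 alg_mpolyC alg_polyC. Qed.

Lemma rees_eval_in p : rees_eval p \in rees_pred I.
Proof.
rewrite /rees_eval /mmap; apply: rpred_sum => a _; apply: rpredM.
  by rewrite /= pmonomial_const pmonomial_rees.
apply: rpred_prod => i _; apply: rpredX; apply: pmonomial_rees.
by rewrite mpow1 //; apply/gen_seqE/mem_nth.
Qed.

Definition rees_ev p : rees I := Rees (rees_eval_in p).

(** A monomial of t-degree k in the Rees algebra is divisible by a product of k listed generators.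
    If it equals that product up to a scalar, it is a value of [rees_ev]; otherwise a variable
    splits off and it lies in the extended maximal ideal. *)
Lemma rees_ev_mod (x : rees I) : exists p, max_rees (x - rees_ev p).
Proof.
have [m0 mD mM] := @max_rees_ideal _ _ I.
pose term k a : rees I := insubd 0 (pmonomial ((val x)`_k)@_a a k).
have termE k a : a \in msupp (val x)`_k -> val (term k a) = pmonomial ((val x)`_k)@_a a k.
  move=> ax; rewrite val_insubd pmonomial_rees //.
  by have /rees_suppP := valP x; apply.
have -> : x = \sum_(k < size (val x)) \sum_(a <- msupp (val x)`_k) term k a.
  apply: val_inj; rewrite rmorph_sum [LHS]poly_monomials; apply: eq_bigr => k _.
  rewrite rmorph_sum big_seq [RHS]big_seq; apply: eq_bigr => a ax.
  by apply: esym; apply: termE.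
have evD p q : rees_ev (p + q) = rees_ev p + rees_ev q.
  by apply: val_inj; rewrite /= /rees_eval rmorphD.
pose A (y : rees I) := exists p, max_rees (y - rees_ev p).
have A0 : A 0.
  exists 0; rewrite (_ : rees_ev 0 = 0) ?subrr //.
  by apply: val_inj; rewrite /= /rees_eval rmorph0.
have AD y z : A y -> A z -> A (y + z).
  move=> [p hp] [q hq]; exists (p + q); rewrite evD opprD addrACA; exact: mD.
apply: (big_ind A) => // k _; rewrite big_seq; apply: (big_ind A) => // a ax.
have /mpowP[//|g [gE ga]] : mpow E k a by have /rees_suppP := valP x; apply.
pose h i := mnm_min (g i) B.
have hgen i : h i \in gen_seq by apply/gen_seq_min/gE.
have hg i j : (h i j <= g i j)%N by rewrite mnmE geq_minl.
pose b : 'X_{1..n} := (\sum_(i < k) h i)%MM.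
have bE : mpow E k b.
  apply/mpowP => //; exists h; split=> [i|j]; first exact: gen_seqE.
  by rewrite mnm_sumE.
have ba : (b <= a)%MM.
  apply/mnm_lepP => j; rewrite mnm_sumE; apply: leq_trans (ga j); exact: leq_sum.
have [Eab|/eqP ne] := eqVneq a b; last first.
  have [j bj baj] := lem_sub1P ba (introN eqP (fun e => ne (esym e))).
  exists 0; rewrite (_ : rees_ev 0 = 0) ?subr0.
    apply: (max_rees_monomial (termE _ _ ax) bj); exact: mpow_up baj bE.
  by apply: val_inj; rewrite /= /rees_eval rmorph0.
pose idx i : 'I_N := Ordinal (etrans (index_mem (h i) gen_seq) (hgen i)).
exists ((((val x)`_k)@_a)%:MP * \prod_(i < k) 'X_(idx i)).
rewrite (_ : rees_ev _ = term k a) ?subrr //; apply: val_inj; rewrite termE //=.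
rewrite /rees_eval rmorphM /= mmapC rmorph_prod /= pmonomial_const.
under eq_bigr do rewrite mmapX mmap1U /= nth_index //.
rewrite Eab /b; clear.
have -> : forall (r : seq 'I_k), \prod_(i <- r) pmonomial 1 (h i) 1 = pmonomial 1 (\sum_(i <- r) h i)%MM (size r).
  elim=> [|i r IH]; first by rewrite !big_nil -pmonomial_const.
  by rewrite !big_cons IH pmonomialM mulr1.
rewrite pmonomialM mulr1 add0m add0n /index_enum -enumT size_enum_ord //.
Qed.

(** Since [rees_ev] is onto modulo the extended maximal ideal, pulling back keeps inclusions strict.
    The bound shows that the maximum in [krull_dim] exists, so that the analytic spread is not a
    default value. *)
Lemma rees_chain_bound d (P : nat -> set (rees I)) : rees_chain d P -> (d <= N)%N.
Proof.
move=> ch; have [[Pp Pl] _] := ch.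
have evD p q : rees_ev (p + q) = rees_ev p + rees_ev q.
  by apply: val_inj; rewrite /= /rees_eval rmorphD.
have evM p q : rees_ev (p * q) = rees_ev p * rees_ev q.
  by apply: val_inj; rewrite /= /rees_eval rmorphM.
have ev0 : rees_ev 0 = 0 by apply: val_inj; rewrite /= /rees_eval rmorph0.
have ev1 : rees_ev 1 = 1 by apply: val_inj; rewrite /= /rees_eval rmorph1.
apply: (@mpoly_chain K N d (fun i => rees_ev @^-1` P i)); split=> i id.
  have [[P0 PD PM] P1 Pmul] := Pp i id; split.
  - by split=> [|p q|p q] /=; rewrite ?ev0 ?evD ?evM //; [apply: PD | apply: PM].
  - by rewrite /= ev1.
  - by move=> p q /=; rewrite evM; apply: Pmul.
have [le /nonsubset[x [x1 x2]]] := Pl i id; split=> [p /le//|h].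
have [p mp] := rees_ev_mod x; have PI j (jd : (j <= d)%N) : is_ideal (P j) by have [] := Pp j jd.
apply: x2; rewrite -[x](subrK (rees_ev p)).
have [_ PD _] := PI i (ltnW id); apply: PD; first exact: (rees_chain_sub ch (ltnW id)).
apply: h => /=; rewrite -[rees_ev p](subKr x); apply: ideal_sub => //; first exact: PI.
exact: (rees_chain_sub ch id).
Qed.

Lemma rees_chain_spread d (P : nat -> set (rees I)) : rees_chain d P -> (d <= analytic_spread I)%N.
Proof.
move=> ch; pose A := [set d | exists P, @prime_chain (fiber_ring I) d P].
have Abd e : A e -> (e <= N)%N.
  by move=> [Q /fiber_to_rees]; apply: rees_chain_bound.
have ex : exists e, `[< A e >] by exists d; apply/asboolP; eexists; apply: rees_to_fiber ch.
have bd e : `[< A e >] -> (e <= N)%N by move=> /asboolP/Abd.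
have [M AM Mub] : exists2 M, A M & ubound A M.
  case: (ex_maxnP ex bd) => M /asboolP AM mM; exists M => // e Ae.
  by rewrite leEnat; apply: mM; apply/asboolP.
have [_ ub] : (A `&` ubound A) (analytic_spread I).
  by apply: (@xgetPex _ 0%N (A `&` ubound A)); exists M.
by rewrite -leEnat; apply: ub; eexists; apply: rees_to_fiber ch.
Qed.

Section FacePrime.
Variable w : 'rV[rat]_n.+1.
Hypothesis w_ge0 : forall a k, mpow E k a -> 0 <= dot w (expo a k).

(** The ideal spanned by the monomials off the face w = 0 of the exponent cone. *)
Definition face_prime : set (rees I) :=
  [set x | psupp_in (fun a k => dot w (expo a k) != 0) (val x)].

Definition face_part f : {poly S} :=
  \poly_(k < size f) mrestrict (fun a => dot w (expo a k) == 0) f`_k.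

Lemma face_part_coef f k a :
  ((face_part f)`_k)@_a = if dot w (expo a k) == 0 then (f`_k)@_a else 0.
Proof.
rewrite coef_poly; case: ltnP => [_|kf]; first exact: mcoeff_restrict.
by rewrite (nth_default _ kf) !mcoeff0 if_same.
Qed.

Lemma face_part_supp f : psupp_in (fun a k => dot w (expo a k) = 0) (face_part f).
Proof.
by move=> k a; rewrite mcoeff_msupp face_part_coef; case: ifPn => [/eqP//|_]; rewrite eqxx.
Qed.

Lemma face_part_eq0 f : face_part f = 0 -> psupp_in (fun a k => dot w (expo a k) != 0) f.
Proof.
move=> f0 k a; rewrite mcoeff_msupp; apply: contraNneq => w0.
have := face_part_coef f k a; rewrite f0 coef0 mcoeff0 w0 eqxx => <- //.
Qed.

(** If x y has no monomial on the face, the product of the face parts of x and y would have all its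
    monomials both on and off the face. It is therefore 0, and one factor vanishes as S[t] is a
    domain. *)
Lemma face_prime_prime : is_prime_ideal face_prime.
Proof.
have pos (x : rees I) k a : a \in msupp (val x)`_k -> 0 <= dot w (expo a k).
  by move=> ax; apply: w_ge0; have /rees_suppP := valP x; apply.
split.
- split=> [|x y hx hy|x y hy].
  + by move=> k a; rewrite rmorph0 coef0 msupp0.
  + change (psupp_in (fun a k => dot w (expo a k) != 0) (val (x + y))).
    by rewrite rmorphD; apply: psupp_inD.
  + change (psupp_in (fun a k => dot w (expo a k) != 0) (val (x * y))); rewrite rmorphM.
    have hy' : psupp_in (fun a k => 0 < dot w (expo a k)) (val y).
      by move=> k a ay; rewrite lt_neqAle eq_sym hy // (pos y).
    apply: psupp_inM (pos x) hy' => a b k l ha hb.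
    by rewrite expoD dotDr gt_eqF // ltr_wpDl.
- move=> /(_ 0%N 0%MM); rewrite rmorph1 coef1 /= msupp1 mem_seq1 eqxx expo0 dot0r eqxx.
  by move/(_ isT).
- move=> x y hxy.
  have rest (z : rees I) : psupp_in (fun a k => 0 < dot w (expo a k)) (val z - face_part (val z)).
    move=> k a; rewrite coefB mcoeff_msupp mcoeffB face_part_coef; case: ifPn => [_|ne].
      by rewrite subrr eqxx.
    by rewrite subr0 -mcoeff_msupp lt_neqAle eq_sym ne => /(pos z).
  have ge0 (z : rees I) : psupp_in (fun a k => 0 <= dot w (expo a k)) (face_part (val z)).
    by move=> k a /face_part_supp ->.
  suff : face_part (val x) * face_part (val y) = 0.
    by move=> /eqP; rewrite mulf_eq0 => /orP[]/eqP/face_part_eq0; [left|right].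
  have hz : psupp_in (fun a k => dot w (expo a k) = 0) (face_part (val x) * face_part (val y)).
    apply: psupp_inM (@face_part_supp (val x)) (@face_part_supp (val y)) => a b k l ha hb.
    by rewrite expoD dotDr ha hb addr0.
  have hp : psupp_in (fun a k => 0 < dot w (expo a k)) (face_part (val x) * face_part (val y)).
    have -> : face_part (val x) * face_part (val y) = val (x * y)
       - (val x * (val y - face_part (val y)) + (val x - face_part (val x)) * face_part (val y)).
      by rewrite rmorphM /=; ring.
    apply: psupp_inD.
      by move=> k a axy; rewrite lt_neqAle eq_sym hxy // (pos (x * y)).
    apply: psupp_inN; apply: psupp_inD.
      apply: psupp_inM (pos x) (rest y) => a b k l ha hb.
      by rewrite expoD dotDr ltr_wpDl.
    apply: psupp_inM (rest x) (ge0 y) => a b k l ha hb.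
    by rewrite expoD dotDr ltr_wpDr.
  apply/polyP => k; rewrite coef0; apply: msuppnil0; case Es : (msupp _) => [//|a s].
  have as_ : a \in msupp (face_part (val x) * face_part (val y))`_k by rewrite Es inE eqxx.
  by have := hp _ _ as_; rewrite hz // ltxx.
Qed.

Lemma face_prime_max : (forall j, 0 < dot w (expo U_(j)%MM 0)) -> @max_rees K n I `<=` face_prime.
Proof.
move=> wj; have [fI _ _] := face_prime_prime; apply: ideal_gen_sub => // x [c mc xc].
move=> k a; rewrite /= -/(val x) in xc *; rewrite xc coefC; case: eqP => [->|_]; last by rewrite msupp0.
move: a; suff : max_ideal c -> supp_in (fun a => dot w (expo a 0) != 0) c by apply.
have w0 a : 0 <= dot w (expo a 0) by apply: w_ge0.
apply: (@ideal_gen_sub _ _ [set c : S | supp_in (fun a => dot w (expo a 0) != 0) c]).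
  split=> [a|f g hf hg|f g hg]; first by rewrite msupp0.
    exact: supp_inD.
  apply: (supp_inM (Q1 := fun=> True) (Q2 := fun a => dot w (expo a 0) != 0)) => // a b _ hb.
  by rewrite (expoD a b 0 0) dotDr gt_eqF // ltr_wpDl // lt_neqAle eq_sym hb w0.
by move=> _ [j _ <-] a; rewrite msuppX mem_seq1 => /eqP->; rewrite gt_eqF.
Qed.

End FacePrime.

End ReesAlgebra.

Lemma cone_ind m (G : seq 'rV[rat]_m) (P : 'rV[rat]_m -> Prop) : P 0 ->
  (forall x y, P x -> P y -> P (x + y)) -> (forall l x, 0 <= l -> P x -> P (l *: x)) ->
  (forall g, g \in G -> P g) -> forall x, cone G x -> P x.
Proof.
move=> P0 PD PZ; elim: G => [|g G IH] PG x /=; first by move=> ->.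
move=> [l l0 /IH Px]; rewrite -[x](subrK (l *: g)); apply: PD.
  by apply: Px => h hG; apply: PG; rewrite inE hG orbT.
by apply: PZ => //; apply: PG; rewrite inE eqxx.
Qed.

Lemma cone_positive_gen m (G : seq 'rV[rat]_m) (i : 'I_m) x :
  (forall g, g \in G -> 0 <= g 0 i) -> cone G x -> 0 < x 0 i ->
  exists g l, [/\ g \in G, 0 < g 0 i, 0 < l & cone G (x - l *: g)].
Proof.
elim: G x => [|g G IH] x G0; first by move=> /= ->; rewrite mxE ltxx.
have gi : 0 <= g 0 i by apply: G0; rewrite inE eqxx.
move=> [l l0 xl] xi; have [lg|lg] := ltrP 0 (l * g 0 i).
  have l0' : 0 < l by rewrite lt_neqAle l0 andbT eq_sym; apply: contraTneq lg => ->; rewrite mul0r ltxx.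
  exists g, l; split; rewrite ?inE ?eqxx //; first by rewrite -(pmulr_rgt0 _ l0').
  by exists 0; rewrite // scale0r subr0.
have [||h [e [hG hi e0 he]]] := IH (x - l *: g) _ xl.
- by move=> h hG; apply: G0; rewrite inE hG orbT.
- by rewrite !mxE; apply: lt_le_trans xi _; rewrite lerDl oppr_ge0.
exists h, e; split=> //; first by rewrite inE hG orbT.
by exists l; rewrite // addrAC.
Qed.

(** * Descent through the faces of the Rees cone *)

Section Descent.
Variables (K : fieldType) (n : nat) (E : pred 'X_{1..n}) (B : 'X_{1..n}).
Hypotheses (Eu : up_closed E) (EB : forall a, E a -> E (mnm_min a B)).
Local Notation S := {mpoly K[n]}.
Local Notation I := (@mideal K n E).
Local Notation G := (rees_gens E B).
Local Notation C := (cone G).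
Implicit Types (a b : 'X_{1..n}) (x y : 'rV[rat]_n.+1).
Variable W : seq 'rV[rat]_n.+1.
Hypothesis GW : dual_of G W.

Lemma rees_cone_ge0 x i : C x -> 0 <= x 0 i.
Proof.
apply: (cone_ind (P := fun x => 0 <= x 0 i)) => [|y z hy hz|l y l0 hy|g].
- by rewrite mxE.
- by rewrite mxE addr_ge0.
- by rewrite mxE mulr_ge0.
move=> /rees_gensP[[j ->]|[b _ ->]]; rewrite mxE; case: (unlift _ _) => *; exact: ler0n.
Qed.

(** The cone lies in the nonnegative orthant, so it does not contain -g and some form of W is
    negative there. This ensures that the subtraction of multiples of g comes to a stop. *)
Lemma rees_cone_pos (g : 'rV[rat]_n.+1) i : 0 < g 0 i -> exists2 w, w \in W & 0 < dot w g.
Proof.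
move=> gi; have : ~ C (- g) by move=> /(@rees_cone_ge0 _ i); rewrite mxE oppr_ge0 leNgt gi.
move=> /GW/existsNP[w /not_implyP[wW /negP]]; rewrite -ltNge -scaleN1r dotZr mulN1r oppr_lt0.
by exists w.
Qed.

(** For x in the cone, its zeros in the cone form the smallest face containing x. *)
Definition face_form x := \sum_(w <- W | dot w x == 0) w.

Lemma face_form_ge0 x y : C y -> 0 <= dot (face_form x) y.
Proof.
move=> /GW yC; rewrite dot_suml big_seq_cond; apply: sumr_ge0 => w /andP[wW _]; exact: yC.
Qed.

Lemma face_form_eq0 x y : C y ->
  dot (face_form x) y = 0 <-> forall w, w \in W -> dot w x = 0 -> dot w y = 0.
Proof.
move=> /GW yC; rewrite dot_suml; split=> [/eqP + w wW wx|h].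
  rewrite big_seq_cond psumr_eq0; last by move=> v /andP[vW _]; exact: yC.
  by move=> /allP/(_ w wW); rewrite wW wx eqxx /= => /eqP.
by rewrite big_seq_cond big1 // => w /andP[wW /eqP wx]; apply: h.
Qed.

Let form_mpow x a k : mpow E k a -> 0 <= dot (face_form x) (expo a k).
Proof. by move=> /(cone_expo_mpow EB GW); apply: face_form_ge0. Qed.

(* Subtracting from x as much of a generator as possible drops x to a proper face,
   so that the corresponding monomial prime of the Rees algebra grows. *)
Lemma cone_drop x : C x -> 0 < x 0 0 -> exists b l, [/\ E b, 0 <= l,
  C (x - l *: expo b 1), forall w, w \in W -> dot w x = 0 -> dot w (x - l *: expo b 1) = 0
  & face_prime (face_form x) `<` (face_prime (face_form (x - l *: expo b 1)) : set (rees I))].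
Proof.
move=> xC x0; have [|g [e [gG g0 e0 xg]]] := cone_positive_gen _ xC x0.
  by move=> g gG; apply: rees_cone_ge0; apply: cone_mem.
have [[j Eg]|[b Eb Eg]] := rees_gensP gG; first by move: g0; rewrite Eg mxE unlift_none ltxx.
have gC : C g by apply: cone_mem.
(* A generator that occurs in x lies in every face that contains x. *)
have gx w : w \in W -> dot w x = 0 -> dot w g = 0.
  move=> wW wx; have /GW/(_ w wW) := xg; rewrite dotBr dotZr wx sub0r oppr_ge0 pmulr_rle0 // => le.
  by apply/eqP; rewrite eq_le le; move/GW: gC => /(_ w wW) ->.
have [w0 w0W w0g] := rees_cone_pos g0.
have [l l0 [yC [w1 [w1W w1y w1g]]]] := cone_reduce GW w0W w0g xC.
rewrite Eg in g0 gC gx w1g yC w1y.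
exists b, l; set y := x - l *: expo b 1 in yC w1y *.
have Wxy w : w \in W -> dot w x = 0 -> dot w y = 0.
  by move=> wW wx; rewrite /y dotBr dotZr wx gx // mulr0 subr0.
split=> //; split=> [z hz k a az|].
  have aC : C (expo a k) by apply: (cone_expo_mpow EB GW); have /rees_suppP := valP z; apply.
  apply/eqP => /(face_form_eq0 _ aC) h; have /eqP := hz k a az; apply.
  by apply/(face_form_eq0 _ aC) => w wW /(Wxy w wW); apply: h.
have Eb1 : mpow E 1 b by rewrite mpow1.
pose z := Rees (pmonomial_rees (K := K) Eu 1 Eb1).
have bz : b \in msupp ((val z)`_1).
  by rewrite /= coefZ coefXn eqxx mulr1 scale1r msuppX inE.
move=> /(_ z) sub.
have : face_prime (face_form x) z.
  apply: sub; apply: pmonomial_supp; apply/eqP => /(face_form_eq0 _ gC) /(_ w1 w1W w1y) w10.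
  by rewrite w10 ltxx in w1g.
move=> /(_ _ _ bz)/eqP; apply; exact/(face_form_eq0 _ gC).
Qed.

(** No variable lies in the smallest face containing x; the prime of that face then contains the
    extended maximal ideal. *)
Definition var_free x :=
  forall j, exists2 w, w \in W & dot w x = 0 /\ 0 < dot w (expo U_(j)%MM 0).

Lemma face_prime_chain0 x : var_free x -> @max_rees K n I `<=` face_prime (face_form x).
Proof.
move=> xe; apply: face_prime_max => // [a k|j]; first exact: form_mpow.
have jC : C (expo U_(j)%MM 0) by apply/cone_mem/rees_gens_var.
rewrite lt_neqAle eq_sym face_form_ge0 // andbT; apply/eqP => /(face_form_eq0 _ jC) h.
by have [w wW [wx]] := xe j; rewrite h // ltxx.
Qed.

(** A drop lowers the bound D on the length of chains by 1, whereas a coefficient l < 1 lowers the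
    t-degree by less than 1; so the hypothesis [D%:R <= x 0 0] persists until some l >= 1 appears.
    It does appear, because for D = 0 a drop would produce a chain of length 1. The conclusion
    [0 < D] later gives the positivity of the spread. *)
Lemma cone_descent D x : C x -> var_free x -> D%:R <= x 0 0 -> 0 < x 0 0 ->
  (forall d (P : nat -> set (rees I)), prime_chain d P -> P 0%N = face_prime (face_form x) ->
     (d <= D)%N) ->
  (0 < D)%N /\ exists2 g, E g & C (x - expo g 1).
Proof.
elim: D x => [|D IH] x xC xe Dx x0 chD;
  have [b [l [Eb l0 yC Wxy lt]]] := cone_drop xC x0; set y := x - l *: expo b 1 in yC Wxy lt;
  have cons d (P : nat -> set (rees I)) :
    prime_chain d P -> P 0%N = face_prime (face_form y) ->
    prime_chain d.+1 (fun i => if i is i'.+1 then P i' else face_prime (face_form x)).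
- move=> [Pp Pl] P0; split=> [[|i]|[|i]] id //; first exact: (face_prime_prime K Eu (@form_mpow x)).
  + exact: Pp.
  + by rewrite P0.
  + exact: Pl.
- have h : prime_chain 0 (fun=> face_prime (face_form y) : set (rees I)).
    by split=> // i _; apply: (face_prime_prime K Eu (@form_mpow y)).
  by have := chD 1%N _ (cons 0%N _ h erefl) erefl.
- move=> [Pp Pl] P0; split=> [[|i]|[|i]] id //; first exact: (face_prime_prime K Eu (@form_mpow x)).
  + exact: Pp.
  + by rewrite P0.
  + exact: Pl.
split=> //; have bC : C (expo b 1) by apply: (cone_expo_mpow EB GW); rewrite mpow1.
have Ex g : x - expo g 1 = (y - expo g 1) + l *: expo b 1 by rewrite addrAC subrK.
have [l1|l1] := lerP 1 l.
  exists b => //; rewrite (_ : x - _ = y + (l - 1) *: expo b 1).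
    by apply: (coneD GW) => //; apply: (coneZ GW) => //; rewrite subr_ge0.
  by rewrite scalerBl scale1r addrA subrK.
have y0 : D%:R < y 0 0.
  rewrite !mxE unlift_none mulr1; move: Dx; rewrite -natr1; lra.
have [||||_ [g Eg gy]] := IH y yC.
- by move=> j; have [w wW [wx wj]] := xe j; exists w => //; split=> //; apply: Wxy.
- exact: ltW.
- by apply: le_lt_trans y0; apply: ler0n.
- by move=> d P hP P0; have := chD _ _ (cons d P hP P0) erefl.
by exists g => //; rewrite Ex; apply: (coneD GW) => //; apply: (coneZ GW).
Qed.

(** Variables are exhausted one after another. A form that vanishes on the remainder keeps
    vanishing: it is nonnegative both on the next remainder and on what is subtracted. *)
Lemma cone_var_reduce x : C x ->
  exists z, [/\ C z, z 0 0 = 0, C (x - z) & var_free (x - z)].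
Proof.
move=> xC.
suff [z [zC z0 xzC ze]] : exists z, [/\ C z, z 0 0 = 0, C (x - z) &
    forall j, j \in enum 'I_n -> exists2 w, w \in W & dot w (x - z) = 0 /\ 0 < dot w (expo U_(j)%MM 0)].
  by exists z; split=> // j; apply: ze; rewrite mem_enum.
elim: (enum 'I_n) => [|j s [z [zC z0 xzC ze]]].
  by exists 0; rewrite subr0 mxE; split=> //; apply: (cone0 GW).
have jC : C (expo U_(j)%MM 0) by apply/cone_mem/rees_gens_var.
have [w0 w0W w0j] : exists2 w, w \in W & 0 < dot w (expo U_(j)%MM 0).
  by apply: (@rees_cone_pos _ (lift ord0 j)); rewrite mxE liftK mnm1E eqxx ltr01.
have [l l0 [yC [w1 [w1W w1y w1g]]]] := cone_reduce GW w0W w0j xzC.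
exists (z + l *: expo U_(j)%MM 0); rewrite opprD addrA; split=> //.
- by apply: (coneD GW) => //; apply: (coneZ GW).
- by rewrite !mxE z0 unlift_none mulr0 addr0.
move=> i; rewrite inE => /predU1P[->|/ze[w wW [wx wi]]]; first by exists w1.
exists w => //; split=> //; apply/eqP; rewrite eq_le; move/GW: yC => /(_ w wW) -> /=.
rewrite andbT dotBr dotZr wx sub0r oppr_le0 mulr_ge0 //.
by move/GW: jC; apply.
Qed.

Lemma spread_descent x : C x -> (analytic_spread I)%:R <= x 0 0 -> 0 < x 0 0 ->
  (0 < analytic_spread I)%N /\ exists2 g, E g & C (x - expo g 1).
Proof.
move=> xC lx x0; have [z [zC z0 yC ye]] := cone_var_reduce xC.
have y0 : (x - z) 0 0 = x 0 0 by rewrite !mxE z0 oppr0 addr0.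
have [|||l0 [g Eg gC]] := cone_descent (D := analytic_spread I) yC ye; rewrite ?y0 //.
  move=> d P ch P0; apply: (rees_chain_spread Eu EB (P := P)); split=> //.
  by rewrite P0; apply: face_prime_chain0.
split=> //; exists g => //; rewrite (_ : x - expo g 1 = x - z - expo g 1 + z).
  exact: (coneD GW).
by rewrite addrAC subrK.
Qed.

(** If the spread were 0, the descent would apply to the exponent of x^a t and return [0 < 0]. *)
Lemma analytic_spread_gt0 : (exists a, E a) -> (0 < analytic_spread I)%N.
Proof.
move=> [a Ea]; rewrite lt0n; apply/eqP => l0.
have aC : C (expo a 1) by apply: (cone_expo_mpow EB GW); rewrite mpow1.
by have [||] := spread_descent aC; rewrite ?l0 // mxE unlift_none // ltr01.
Qed.

End Descent.

(** * The product formula for closures and the common exponent *)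

Section ClosureSpread.
Variables (K : fieldType) (n : nat) (E : pred 'X_{1..n}).
Hypothesis Eu : up_closed E.
Local Notation l := (analytic_spread (@mideal K n E)).

Lemma mpow_mpow k N a : mpow (mpow E k) N a = mpow E (k * N) a.
Proof.
have Eku : up_closed (mpow E k) by apply: mpow_up.
have II := mideal_ideal K Eu.
apply/idP/idP => /(@midealX K n _ _).2; rewrite -ideal_exp_mideal //.
  by rewrite -ideal_exp_mideal // ideal_exp_mul // ideal_exp_mideal // => /midealX.
by rewrite -ideal_exp_mul // !ideal_exp_mideal // => /midealX.
Qed.

Lemma closure_spread_split a : (exists b, E b) -> mclos (mpow E l) a ->
  (0 < l)%N /\ exists g b, [/\ a = (g + b)%MM, E g & mclos (mpow E (l - 1)) b].
Proof.
move=> Ex /asboolP[N N0]; rewrite mpow_mpow => Ea.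
have [B EB] := dickson_bound Eu; have [W GW] := cone_dual (rees_gens E B).
have l0 := analytic_spread_gt0 K Eu EB GW Ex.
have clear b k : (exists2 N, (0 < N)%N & mpow E (k * N) (b *+ N)%MM) <-> cone (rees_gens E B) (expo b k).
  split=> [[M M0 /(cone_expo_mpow EB GW)]|/(mpow_cone_expo Eu)[M M0 h]]; last first.
    by exists M; rewrite // mulnC.
  rewrite mulnC expoM => /(coneZ GW (_ : 0 <= M%:R^-1)).
  rewrite scalerA mulVf ?pnatr_eq0 -?lt0n // scale1r; apply; rewrite invr_ge0 ler0n //.
have aC : cone (rees_gens E B) (expo a l) by apply/clear; exists N.
have [||_ [g Eg gC]] := spread_descent (K := K) Eu EB GW aC; rewrite ?mxE ?unlift_none ?ltr0n //.
split=> //; exists g, (a - g)%MM.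
(* The difference of the exponents lies in the cone, hence in the nonnegative orthant, so x^g
   divides x^a. *)
have ga : (g <= a)%MM.
  apply/mnm_lepP => j; have := rees_cone_ge0 (lift ord0 j) gC.
  by rewrite !mxE !liftK subr_ge0 ler_nat.
split=> //; first by rewrite addmC submK.
have [M M0 h] : exists2 M, (0 < M)%N & mpow E ((l - 1) * M) ((a - g) *+ M)%MM.
  apply/clear; rewrite (_ : expo _ _ = expo a l - expo g 1) //.
  by rewrite -{2}(submK ga) -{2}(subnK l0) expoD addrK.
by apply/asboolP; exists M => //; rewrite mpow_mpow.
Qed.

End ClosureSpread.

Lemma iter_cycle (T : finType) (f : T -> T) (x0 : T) :
  exists x p, [/\ (0 < p <= #|T|)%N & iter p f x = x].
Proof.
have := looping_order f x0; rewrite /looping => /trajectP[i io Ei].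
exists (iter i f x0), (order f x0 - i)%N; rewrite subn_gt0 io.
rewrite (leq_trans (leq_subr _ _)) ?max_card //; split=> //.
by rewrite -iterD subnK // ltnW.
Qed.

Section MinimalGenerators.
Variables (K : fieldType) (n : nat) (E : pred 'X_{1..n}).
Hypothesis Eu : up_closed E.
Implicit Types (a b : 'X_{1..n}).

Lemma min_gens_le (B : 'X_{1..n}) g : (forall a, E a -> E (mnm_min a B)) ->
  min_gens (@mideal K n E) g -> (g <= B)%MM.
Proof.
move=> EB /min_gens_mem[Eg gm]; have le : (mnm_min g B <= g)%MM.
  by apply/mnm_lepP => i; rewrite mnmE geq_minl.
rewrite -(gm _ (EB g Eg) le); apply/mnm_lepP => i; by rewrite mnmE geq_minr.
Qed.

(** [mu] counts through [fset_set], which reflects the set only when it is finite. *)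
Lemma min_gens_finite : finite_set (min_gens (@mideal K n E)).
Proof.
have [B EB] := dickson_bound Eu.
apply: (sub_finite_set (B := range (@bmnm n (mdeg B).+1))); last exact: finite_image.
move=> g /(min_gens_le EB)/mnm_lepP gB.
have gd : (mdeg g < (mdeg B).+1)%N.
  by rewrite ltnS !mdegE; apply: leq_sum => i _.
by exists (BMultinom gd).
Qed.

End MinimalGenerators.

Section CommonPower.
Variables (K : fieldType) (n : nat) (E : pred 'X_{1..n}).
Hypotheses (Eu : up_closed E) (Ex : exists a, E a).
Local Notation l := (analytic_spread (@mideal K n E)).
Local Notation V := (mclos (mpow E (l - 1))).

(* Multiplication by x^u, followed by division by a generator of I, maps the
   minimal generators of the closure of I^(l-1) to each other up to multiples; a cycle
   of length p gives x^(p u) in I^p. *)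
Lemma mclos_power u : mclos E u ->
  exists p, (0 < p <= mu (@mideal K n V))%N /\ mpow E p (u *+ p)%MM.
Proof.
move=> Lu; have Vu : up_closed V by apply/mclos_up/mpow_up.
have fin := min_gens_finite K Vu.
pose F := fset_set (min_gens (@mideal K n V)).
have FP v : v \in F <-> min_gens (@mideal K n V) v.
  by rewrite /F in_fset_set // in_setE.
have Vx : exists v, V v.
  have [a Ea] := Ex; exists (a *+ (l - 1))%MM; apply/asboolP; exists 1%N => //.
  rewrite mulm1n mpow1; last exact: mpow_up.
  have := @mpowM n E 1 (l - 1) a Eu; rewrite muln1 mpow1 //; exact.
have step (v : F) : exists v' : F, exists g, E g /\ (g + val v' <= u + val v)%MM.
  have [Vv _] : V (val v) /\ forall b, V b -> (b <= val v)%MM -> b = val v.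
    by apply/(min_gens_mem K)/FP; apply: valP.
  have uv : mclos (mpow E l) (u + val v)%MM.
    move: Lu Vv => /asboolP[M M0 Mu] /asboolP[M' M'0 M'v]; apply/asboolP.
    exists (M * M')%N; first by rewrite muln_gt0 M0.
    move: M'v; rewrite !mpow_mpow // => M'v.
    have h1 := mpowM M' Eu Mu; have h2 := mpowM M Eu M'v.
    have l0 : (0 < l)%N.
      have [B EB] := dickson_bound Eu; have [W GW] := cone_dual (rees_gens E B).
      exact: (analytic_spread_gt0 K Eu EB GW Ex).
    have -> : (l * (M * M') = M' * M + M * ((l - 1) * M'))%N by nia.
    have -> : ((u + val v) *+ (M * M') = u *+ M *+ M' + val v *+ M' *+ M)%MM.
      by apply/mnmP => i; rewrite !(mulmnE, mnmDE) mulnDl !mulnA; congr (_ + _)%N; rewrite mulnAC.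
    exact: mpowD.
  have [_ [g [b [ugb Eg Vb]]]] := closure_spread_split Eu Ex uv.
  have [w /FP wF wb] := min_gens_below K Vb.
  exists [` wF]%fset, g; split=> //; rewrite ugb; apply/mnm_lepP => i.
  by rewrite !mnmDE leq_add2l; apply/mnm_lepP.
have [f fP] := choice step.
(* [c] accumulates the generators of I split off along p steps of the orbit; once the orbit closes,
   the two generators of V cancel and x^c divides x^(p u). *)
have iterP p (v : F) : exists c, mpow E p c /\ (c + val (iter p f v) <= u *+ p + val v)%MM.
  elim: p => [|p [c [Ec /mnm_lepP le]]]; first by exists 0%MM; rewrite mulm0n; split=> //; apply: lepm_refl.
  have [g [Eg /mnm_lepP le']] := fP (iter p f v); exists (g + c)%MM; split.
    by rewrite -add1n; apply: mpowD => //; rewrite mpow1.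
  apply/mnm_lepP => i; have := le i; have := le' i; rewrite /= !(mnmDE, mulmnE); nia.
have [v0 Vv0] := Vx; have [w /FP wF _] := min_gens_below K Vv0.
have [x [p [pF xp]]] := iter_cycle f [` wF]%fset.
exists p; split; first by rewrite /mu -/F cardfE.
have [c [Ec]] := iterP p x; rewrite xp => /mnm_lepP le.
apply: mpow_up Ec => //; apply/mnm_lepP => i; have := le i.
by rewrite !mnmDE leq_add2r.
Qed.

Lemma mclos_factorial u m : (0 < m)%N ->
  mclos E u = mpow E ((mu (@mideal K n V))`! * m) (u *+ ((mu (@mideal K n V))`! * m))%MM.
Proof.
move=> m0; apply/idP/idP => [/mclos_power[p [/andP[p0 pmu] pu]]|h]; last first.
  by apply/asboolP; eexists; last exact: h; rewrite muln_gt0 fact_gt0.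
set k := (_ * m)%N; have /dvdnP[q Eq] : (p %| k)%N.
  by apply: dvdn_mulr; apply: dvdn_fact; rewrite p0.
rewrite Eq; have -> : (u *+ (q * p) = u *+ p *+ q)%MM.
  by apply/mnmP => i; rewrite !mulmnE -mulnA [(p * q)%N]mulnC.
exact: mpowM.
Qed.

End CommonPower.

(** A positive exponent of a minimal generator makes the set in [gamma] nonempty, so [gamma] is a
    true minimum and not the default 0. *)
Lemma gamma_min (K : fieldType) n (I : set {mpoly K[n]}) g j :
  min_gens I g -> (0 < g j)%N -> (0 < gamma I <= g j)%N.
Proof.
move=> gI gj; pose D := [set d | exists (a : 'X_{1..n}) (j : 'I_n),
                 [/\ min_gens I a, (0 < a j)%N & d = a j]].
have ex : exists d, `[< D d >] by exists (g j); apply/asboolP; exists g, j.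
have [[a [i [_ ai ->]]] lb] : (D `&` lbound D) (gamma I).
  apply: (@xgetPex _ 0%N (D `&` lbound D)).
  case: (ex_minnP ex) => d /asboolP Dd dm; exists d; split=> // e De.
  by rewrite leEnat; apply: dm; apply/asboolP.
by rewrite ai /=; move: lb => /(_ (g j)); rewrite leEnat; apply; exists g, j.
Qed.

Theorem theorem4p3 (K : fieldType) (n : nat) (I : set {mpoly K[n]})
    (Imon : is_monomial_ideal I) (Iproper : I <> [set: {mpoly K[n]}])
    (Inonzero : I <> [set 0]) (m : nat) (m_gt0 : (1 <= m)%N) :
  let l := analytic_spread I in
  let s := ((mu (integral_closure (ideal_exp I (l - 1)%N)))`!)%N in
  reg (integral_closure I) <=
    reg (ideal_exp I (s * m)%N) - (gamma I)%:Z * ((s * m)%N%:Z - 1).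
Proof.
have [E Eu EI] := monomial_idealE Imon.
have Ex : exists a, E a.
  apply: contrapT => nE; apply: Inonzero; rewrite EI; apply/seteqP; split=> [f fE|_ ->].
    apply: msuppnil0; case Es : (msupp f) => [//|a s]; case: nE; exists a.
    by apply: fE; rewrite Es inE eqxx.
  by move=> a; rewrite msupp0.
have E0 : ~~ E 0%MM.
  apply/negP => h; apply: Iproper; rewrite EI; apply/seteqP; split=> // f _ a _.
  by apply: Eu h; apply/mnm_lepP => i; rewrite mnm0E.
cbv zeta; set l := analytic_spread I; set s := (mu _)`!%N; set k := (s * m)%N.
have sE : s = ((mu (@mideal K n (mclos (mpow E (analytic_spread (@mideal K n E) - 1)))))`!)%N.
  rewrite /s /l EI ideal_exp_mideal // integral_closure_mideal //; exact: mpow_up.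
have k0 : (0 < k)%N by rewrite muln_gt0 fact_gt0.
have [B EB] := dickson_bound Eu.
have gens a : E a -> exists g, [/\ (g <= a)%MM, (g <= B)%MM, E g &
    forall j, (0 < g j)%N -> (gamma I <= g j)%N].
  move=> Ea; have [g gm ga] := min_gens_below K Ea.
  exists g; split=> //; first exact: min_gens_le EB gm.
    by have /min_gens_mem[] := gm.
  by move=> j gj; have /andP[] : (0 < gamma I <= g j)%N by apply: gamma_min; rewrite ?EI.
have gam0 : (0 < gamma I)%N.
  have [a Ea] := Ex; have [g gm _] := min_gens_below K Ea.
  have [j gj] : exists j, (0 < g j)%N.
    apply: contrapT => ng; have /min_gens_mem[Eg _] := gm; move/negP: E0; apply.
    rewrite -(_ : g = 0%MM) //; apply/mnmP => j; rewrite mnm0E.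
    by apply/eqP; rewrite -leqn0 leqNgt; apply/negP => gj; apply: ng; exists j.
  by have /andP[] : (0 < gamma I <= g j)%N by apply: gamma_min; rewrite ?EI.
have EJP a := mpowP k a Eu.
have ELP a : mclos E a = mpow E k (a *+ k)%MM.
  by rewrite /k sE; apply: mclos_factorial.
have := reg_scaled_le K k0 gam0 E0 Ex gens EJP ELP.
rewrite -integral_closure_mideal // -ideal_exp_mideal // -EI => le.
by rewrite lerBrDr; apply: le_trans le; rewrite lerD2l PoszM -subzn.
Qed.
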